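(* Let $f$ and $g$ be two expanding piecewise $\mathcal{C}^{1+\epsilon}$ interval maps with $s\ge2$ full branches, with coding maps $\pi_f,\pi_g:I^{\mathbb{N}}\to[0,1]$, where $I=\{1,\dots,s\}$, and geometric potentials $\varphi_f,\varphi_g:I^{\mathbb{N}}\to\mathbb{R}$. Let $\Lambda:=\pi_f(I^{\mathbb{N}})$ and suppose that $\pi_g(I^{\mathbb{N}})=[0,1]$. Let \[ \alpha_-:=\inf_{\omega\in I^{\mathbb{N}}}\liminf_{n\to\infty}\frac{S_n\varphi_g(\omega)}{S_n\varphi_f(\omega)},\qquad \alpha_+:=\sup_{\omega\in I^{\mathbb{N}}}\limsup_{n\to\infty}\frac{S_n\varphi_g(\omega)}{S_n\varphi_f(\omega)}. \] Let $t:\mathbb{R}\to\mathbb{R}$ be defined implicitly by $\mathcal{P}(t(\beta)\varphi_f+\beta\varphi_g)=0$, and let $t^*(a):=\sup_{x\in\mathbb{R}}(ax-t(x))$ for $a\in\mathbb{R}$. Then the conjugacy map $\Theta:\Lambda\to[0,1]$, $\Theta:=\pi_g\circ\pi_f^{-1}$, satisfies for every $\alpha\in[\alpha_-,\alpha_+]$ \[ \dim_H\{x\in\Lambda : \mathrm{H\ddot{o}l}(\Theta,x)=\alpha\}=-t^*(-\alpha). \]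
   Context: $\dim_H$ denotes Hausdorff dimension. Expanding piecewise $\mathcal{C}^{1+\epsilon}$ interval map $f$ with $s$ full branches: there are closed intervals $J_1,\dots,J_s\subset[0,1]$ with nonempty, pairwise disjoint interiors, listed in increasing order ($\sup J_i\le\inf J_j$ if $i<j$), such that each branch $f_{|J_i}$ has a $\mathcal{C}^{1+\epsilon}$ extension (i.e. $\mathcal{C}^1$ with $\epsilon$-Hölder derivative, for some $\epsilon>0$) to a neighbourhood of $J_i$, with $(f_{|J_i})'>1$ on $J_i$ and $f_{|J_i}(J_i)=[0,1]$, for $1\le i\le s$. The same definition applies to $g$ (with its own intervals, also listed in increasing order). Coding map: let $I=\{1,\dots,s\}$ and let $\phi_i:=(f_{|J_i})^{-1}:[0,1]\to[0,1]$ be the contracting inverse branches. For $\omega\in I^{\mathbb{N}}$, $\pi_f(\omega)$ is the unique point of $\bigcap_{n\ge1}\phi_{\omega_1}\circ\cdots\circ\phi_{\omega_n}([0,1])$. The repeller of $f$ is $\Lambda=\pi_f(I^{\mathbb{N}})$. The map $\pi_g$ is defined in the same way from $g$. When $\pi_g(I^{\mathbb{N}})=[0,1]$, the map $\Theta=\pi_g\circ\pi_f^{-1}:\Lambda\to[0,1]$ is well defined: $\Theta(x)=\pi_g(\omega)$ for any $\omega\in I^{\mathbb{N}}$ with $\pi_f(\omega)=x$. Geometric potentials: $\varphi_f:=-\log f'\circ\pi_f$ and $\varphi_g:=-\log g'\circ\pi_g$, where at $\omega$ the derivative is that of the branch with index $\omega_1$, e.g. $\varphi_f(\omega)=-\log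 (f_{|J_{\omega_1}})'(\pi_f(\omega))$. $\sigma$ is the left shift on $I^{\mathbb{N}}$ (with the usual shift metric), $S_nu:=\sum_{k=0}^{n-1}u\circ\sigma^k$, and $\mathcal{P}(u)$ denotes the topological pressure of a continuous $u:I^{\mathbb{N}}\to\mathbb{R}$ with respect to $\sigma$. For each $\beta\in\mathbb{R}$ there is a unique real $t(\beta)$ with $\mathcal{P}(t(\beta)\varphi_f+\beta\varphi_g)=0$. Pointwise Hölder exponent: for $x\in\Lambda$, \[ \mathrm{H\ddot{o}l}(\Theta,x):=\sup\Big\{\alpha>0 : \limsup_{y\to x,\ y\in\Lambda}\frac{|\Theta(y)-\Theta(x)|}{|y-x|^{\alpha}}<\infty\Big\}. \] *)

(* Defs.v *)
From HB Require Import structures.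
From mathcomp Require Import all_boot all_order all_algebra.
From mathcomp Require Import all_classical all_reals all_analysis.
Import Order.TTheory GRing.Theory Num.Theory.
Import numFieldNormedType.Exports.

Set Implicit Arguments.
Unset Strict Implicit.
Unset Printing Implicit Defensive.

Local Open Scope classical_set_scope.
Local Open Scope ring_scope.

(* Continuity of the derivative on U is a consequence of the Hoelder bound
   when 0 < e, hence is not required separately. *)
Definition C1_hoelder (R : realType) (e : R) (U : set R) (F : R -> R) : Prop :=
  (forall x, U x -> derivable F x 1) /\
  exists C : R, forall x y, U x -> U y ->
    `|derive1 F x - derive1 F y| <= C * `|x - y| `^ e.

(* Branches are kept as a family, because two of them may take different values
   at a common endpoint. [branch i] is a C^{1+e} extension, to a neighbourhood
   of J_i = [lo i, hi i], of the restriction of the map to J_i; its values away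
   from that neighbourhood are irrelevant. *)
Record expanding_map (R : realType) (s : nat) := ExpandingMap {
  lo : 'I_s -> R;
  hi : 'I_s -> R;
  branch : 'I_s -> R -> R;
  lo_ge0 : forall i, 0 <= lo i;
  lo_lt_hi : forall i, lo i < hi i;
  hi_le1 : forall i, hi i <= 1;
  hi_le_lo : forall i j : 'I_s, (i < j)%N -> hi i <= lo j;
  branch_C1_hoelder : exists2 e : R, 0 < e &
    forall i, exists U : set R,
      [/\ open U, `[lo i, hi i] `<=` U & C1_hoelder e U (branch i)];
  branch_expanding : forall i x, x \in `[lo i, hi i] -> 1 < derive1 (branch i) x;
  branch_full : forall i, branch i @` `[lo i, hi i] = `[0, 1]%classic
}.

(* I^N is nat -> 'I_s: the letters omega_1, omega_2, ... are omega 0, omega 1, ... *)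
Section SymbolicDynamics.
Context {R : realType} {s : nat}.
Implicit Types (w v : nat -> 'I_s) (u : (nat -> 'I_s) -> R).

Definition shift_map w : nat -> 'I_s := fun k => w k.+1.

Definition birkhoff u (n : nat) w : R := \sum_(k < n) u (iter k shift_map w).

Definition shift_dist w v : R :=
  match pselect (exists k, w k != v k) with
  | left wv => 2^-1 ^+ ex_minn wv
  | right _ => 0
  end.

Definition bowen_separated (n : nat) (e : R) (E : set (nat -> 'I_s)) : Prop :=
  forall w v, E w -> E v -> w <> v ->
    exists2 k, (k < n)%N & e < shift_dist (iter k shift_map w) (iter k shift_map v).

Definition separated_sum u (n : nat) (e : R) : \bar R :=
  ereal_sup [set (\sum_(w \in E) expR (birkhoff u n w))%:E
            | E in [set E | finite_set E /\ bowen_separated n e E]].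

(* Bowen's definition through (n, e)-separated sets. *)
Definition pressure u : \bar R :=
  lim (limn_esup (fun n => (n%:R^-1)%:E * lne (separated_sum u n e))%E
       @[e --> 0^'+]).

End SymbolicDynamics.

Section Coding.
Context {R : realType} {s : nat}.
Implicit Types (f g : expanding_map R s) (w : nat -> 'I_s).

Definition inverse_branch f (i : 'I_s) (y : R) : R :=
  get [set x | x \in `[lo f i, hi f i] /\ branch f i x = y].

(* phi_(w 0) \o ... \o phi_(w (n - 1)) *)
Fixpoint inverse_word f w (n : nat) : R -> R :=
  if n is m.+1 then inverse_word f w m \o inverse_branch f (w m) else id.

Definition coding f w : R :=
  get (\bigcap_(n in [set n | (1 <= n)%N]) (inverse_word f w n @` `[0, 1])).

Definition repeller f : set R := range (coding f).

Definition geometric_potential f w : R :=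
  - ln (derive1 (branch f (w 0%N)) (coding f w)).

(* Only meaningful on the repeller and when coding g is onto [0, 1]; the value
   then does not depend on the chosen code of x. *)
Definition conjugacy f g (x : R) : R :=
  get (coding g @` (coding f @^-1` [set x])).

Definition birkhoff_ratio f g w (n : nat) : \bar R :=
  (birkhoff (geometric_potential g) n w /
   birkhoff (geometric_potential f) n w)%:E.

Definition alpha_minus f g : \bar R :=
  ereal_inf (range (fun w => limn_einf (birkhoff_ratio f g w))).

Definition alpha_plus f g : \bar R :=
  ereal_sup (range (fun w => limn_esup (birkhoff_ratio f g w))).

End Coding.

Section Regularity.
Context {R : realType}.

Definition hoelder_exponent (L : set R) (T : R -> R) (x : R) : \bar R :=
  ereal_sup [set a%:E | a in [set a : R | 0 < a /\
    (limf_esup (fun y => (`|T y - T x| / `|y - x| `^ a)%:E)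
       (within L x^') < +oo)%E]].

(* Conjugate function; it may take the value +oo. *)
Definition legendre (t : R -> R) (a : R) : \bar R :=
  ereal_sup (range (fun x => (a * x - t x)%:E)).

(* The diameter of set0 is -oo here; [diam_power] gives it weight 0. *)
Definition diam (U : set R) : \bar R :=
  ereal_sup [set (`|p.1 - p.2|)%:E | p in U `*` U].

(* For d = 0 a nonempty set has weight 1, singletons included. *)
Definition diam_power (d : R) (U : set R) : \bar R :=
  if U == set0 then 0%E else (diam U `^ d)%E.

Definition hausdorff_content (d e : R) (A : set R) : \bar R :=
  ereal_inf [set (\sum_(0 <= k <oo) diam_power d (U k))%E
            | U in [set U : nat -> set R | A `<=` \bigcup_k U k /\
                                           forall k, (diam (U k) <= e%:E)%E]].

Definition hausdorff_measure (d : R) (A : set R) : \bar R :=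
  ereal_sup [set hausdorff_content d e A | e in [set e : R | 0 < e]].

Definition hausdorff_dim (A : set R) : \bar R :=
  ereal_inf [set d%:E | d in [set d : R | 0 <= d /\ hausdorff_measure d A = 0%E]].

End Regularity.

(* Main.v *)
Require Import Defs.
From mathcomp Require Import all_boot all_order all_algebra.
From mathcomp Require Import all_classical all_reals all_analysis.
From mathcomp Require Import ring lra zify.
Import Order.TTheory GRing.Theory Num.Theory.
Import numFieldNormedType.Exports.
Set Implicit Arguments.
Unset Strict Implicit.
Unset Printing Implicit Defensive.
Local Open Scope classical_set_scope.
Local Open Scope ring_scope.

(* Write A_w and B_w for minus the logarithms of the lengths of the f- and
   g-cylinder of a word w; bounded distortion makes both additive up to a constant
   under concatenation and comparable to the Birkhoff sums of the potentials.

   Let D = inf_b (t b + alpha b), so that D = -t^*(-alpha).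

   dim <= D: if Theta has exponent alpha at x then, at infinitely many scales, x lies
   within one cylinder length of a cylinder w with b B_w <= (b alpha + o(1)) A_w; the
   sign of b decides which half of the definition of the exponent is used. Summing
   |w|^d over those w costs at most sum_w exp(-t(b) A_w - b B_w) times a geometric
   factor as soon as d > t b + alpha b.

   dim >= D: put V = B - alpha A. Since D <= t b + alpha b, the sums
   sum_w exp(-D A_w - b V_w) over words of length N are bounded below uniformly in N,
   for every b. Sorting the words by the integer parts of A and V, some class is
   dominant at each b. Moving b from -eN to eN, either a dominant class has bounded V,
   or two dominant classes at essentially the same b have V of opposite signs, and a
   suitable concatenation of the two has V = 0. This gives about exp(D x) words with
   A close to x and V close to 0, with no appeal to differentiability of t and with
   the endpoints of the spectrum treated like all other values. Concatenating such
   families with slowly growing lengths, each word ended by the letters "first, last"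
   to stay away from cylinder endpoints, yields a Moran set on which the exponent is
   alpha; it is parametrised by [0,1[ with a d-Hoelder inverse for every d < D. *)

(** The obstacle is that distances are not read off codes: two points on either side of a cylinder
    endpoint may be much closer than the cylinders of their common prefix are long. A letter other
    than the last leaves a gap of fixed proportion to the right end of its cylinder, a letter other
    than the first leaves one to the left; this is what the two marker letters provide. Arbitrary
    points, met in the upper bound, carry no markers. There one takes the cylinders of x and of y at
    the scale |x - y|: their g-lengths add up to at least |Theta y - Theta x|, so one of them
    carries half of it, possibly the one of y, whence the enlargement of cylinders by their own
    length.

    In the lower bound b runs up to r N, where N is the word length, so every error has to be at
    most linear in |b|; a small r then makes it a small multiple of N. This requires lower bounds
    for the tilted sums at every N, whereas zero pressure gives them only for infinitely many N;
    submultiplicativity closes that gap. *)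

Lemma archi_ge {R : realType} (c Q : R) : 0 < c ->
  exists n0 : nat, forall n : nat, (n0 <= n)%N -> Q <= c * n%:R.
Proof.
move=> c0; exists (Num.truncn (Q / c)).+1 => n hn.
rewrite [leRHS]mulrC -ler_pdivrMr//; apply: le_trans (ltW (truncnS_gt _)) _.
by rewrite ler_nat.
Qed.

(** * Inverse branches and cylinders *)

Section Branches.
Context {R : realType} {s : nat} (f : expanding_map R s).
Implicit Types (i : 'I_s) (x y : R).

Lemma branch_derivable i x : x \in `[lo f i, hi f i] -> derivable (branch f i) x 1.
Proof.
have [e e0 /(_ i)[U [oU sU [dU _]]]] := branch_C1_hoelder f.
by move=> xi; apply: dU; apply: sU.
Qed.

Lemma branch_mvt i x y : lo f i <= x -> x < y -> y <= hi f i ->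
  exists2 z, z \in `[x, y] & branch f i y - branch f i x = derive1 (branch f i) z * (y - x).
Proof.
move=> lx xy yh.
have sub : {subset `[x, y] <= `[lo f i, hi f i]}.
  by move=> z; rewrite !in_itv/= => /andP[xz zy]; rewrite (le_trans lx xz) (le_trans zy yh).
have [||z zi ->] := @MVT R (branch f i) (derive1 (branch f i)) x y xy; last first.
- by exists z => //; apply: subset_itv_oo_cc.
- apply: derivable_within_continuous => z zi.
  by apply: branch_derivable; apply: sub.
- move=> z /subset_itv_oo_cc zi; rewrite derive1E; apply: DeriveDef => //.
  by apply: branch_derivable; apply: sub.
Qed.

Lemma branch_mono i : {in `[lo f i, hi f i] &, {mono branch f i : x y / x <= y}}.
Proof.
apply: le_mono_in => x y; rewrite !in_itv/= => /andP[lx xh] /andP[ly yh] xy.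
have [z zi E] := branch_mvt lx xy yh.
rewrite -subr_gt0 E mulr_gt0 ?subr_gt0//.
apply: lt_trans ltr01 _; apply: branch_expanding.
move: zi; rewrite !in_itv/= => /andP[xz zy].
by rewrite (le_trans lx xz) (le_trans zy yh).
Qed.

Lemma branch_in01 i x : x \in `[lo f i, hi f i] -> branch f i x \in `[0, 1].
Proof.
move=> xi; have : (branch f i @` `[lo f i, hi f i]) (branch f i x) by exists x.
by rewrite branch_full.
Qed.

Lemma mem_lo i : lo f i \in `[lo f i, hi f i].
Proof. by rewrite in_itv/= lexx ltW// lo_lt_hi. Qed.

Lemma mem_hi i : hi f i \in `[lo f i, hi f i].
Proof. by rewrite in_itv/= lexx ltW// lo_lt_hi. Qed.

Lemma inverse_branchP i y : y \in `[0, 1] ->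
  inverse_branch f i y \in `[lo f i, hi f i] /\ branch f i (inverse_branch f i y) = y.
Proof.
move=> y01; have : [set` `[0, 1]] y by [].
rewrite -(branch_full f i) => -[x xi xy].
exact: (@getPex _ [set x | x \in `[lo f i, hi f i] /\ branch f i x = y] (ex_intro _ x (conj xi xy))).
Qed.

Lemma inverse_branch_in i y : y \in `[0, 1] -> inverse_branch f i y \in `[lo f i, hi f i].
Proof. by case/(inverse_branchP i). Qed.

Lemma branchK i x : x \in `[lo f i, hi f i] -> inverse_branch f i (branch f i x) = x.
Proof.
move=> xi; have [zi zE] := inverse_branchP i (branch_in01 xi).
exact: (inc_inj_in (branch_mono (i := i))).
Qed.

Lemma inverse_branch_mono i : {in `[0, 1] &, {mono inverse_branch f i : x y / x <= y}}.
Proof.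
move=> x y x0 y0; have [ax ex] := inverse_branchP i x0; have [ay ey] := inverse_branchP i y0.
by rewrite -(branch_mono ax ay) ex ey.
Qed.

Lemma inverse_branch0 i : inverse_branch f i 0 = lo f i.
Proof.
have z0 : (0 : R) \in `[0, 1] by rewrite in_itv/= lexx ler01.
apply/eqP; rewrite eq_le; apply/andP; split; last first.
  by have := inverse_branch_in i z0; rewrite in_itv/= => /andP[].
rewrite -[leRHS](branchK (mem_lo i)) inverse_branch_mono//;
  have := branch_in01 (mem_lo i) ; rewrite in_itv/= => /andP[h1 h2] //; exact/andP.
Qed.

Lemma inverse_branch1 i : inverse_branch f i 1 = hi f i.
Proof.
have z0 : (1 : R) \in `[0, 1] by rewrite in_itv/= lexx ler01.
apply/eqP; rewrite eq_le; apply/andP; split.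
  by have := inverse_branch_in i z0; rewrite in_itv/= => /andP[].
rewrite -[leLHS](branchK (mem_hi i)) inverse_branch_mono//;
  have := branch_in01 (mem_hi i) ; rewrite in_itv/= => /andP[h1 h2] //; exact/andP.
Qed.

Lemma inverse_branch_mvt i x y : 0 <= x -> x < y -> y <= 1 ->
  exists2 z, z \in `[inverse_branch f i x, inverse_branch f i y] &
    y - x = derive1 (branch f i) z * (inverse_branch f i y - inverse_branch f i x).
Proof.
move=> x0 xy y1.
have xi : x \in `[0, 1] by rewrite in_itv/= x0 (le_trans (ltW xy)).
have yi : y \in `[0, 1] by rewrite in_itv/= y1 (le_trans x0 (ltW xy)).
have [ax ex] := inverse_branchP i xi; have [ay ey] := inverse_branchP i yi.
have lxy : inverse_branch f i x < inverse_branch f i y.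
  by rewrite (leW_mono_in (inverse_branch_mono i)).
move: (ax) (ay); rewrite !in_itv/= => /andP[lx _] /andP[_ yh].
by have [z zi] := branch_mvt lx lxy yh; rewrite ex ey => E; exists z.
Qed.

Lemma derive1_hoelder : exists2 e : R, 0 < e & exists2 C : R, 0 <= C &
  forall i x y, x \in `[lo f i, hi f i] -> y \in `[lo f i, hi f i] ->
  `|derive1 (branch f i) x - derive1 (branch f i) y| <= C * `|x - y| `^ e.
Proof.
have [e e0 H] := branch_C1_hoelder f.
exists e => //.
have /choice[C HC] : forall i, exists C : R, 0 <= C /\
  forall x y, x \in `[lo f i, hi f i] -> y \in `[lo f i, hi f i] ->
  `|derive1 (branch f i) x - derive1 (branch f i) y| <= C * `|x - y| `^ e.
  move=> i; have [U [oU sU [dU [C HC]]]] := H i.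
  exists `|C|; split => // x y xi yi; apply: le_trans (HC _ _ _ _) _; [exact: sU|exact: sU|].
  by rewrite ler_wpM2r ?powR_ge0// ler_norm.
exists (\sum_i C i); first by apply: sumr_ge0 => i _; have [] := HC i.
move=> i x y xi yi; have [C0 /(_ _ _ xi yi) h] := HC i.
apply: le_trans h _; rewrite ler_wpM2r ?powR_ge0// (bigD1 i)//= lerDl.
by apply: sumr_ge0 => j _; have [] := HC j.
Qed.

Lemma derive1_branch_continuous i : {within `[lo f i, hi f i], continuous (derive1 (branch f i))}.
Proof.
have [e e0 /(_ i)[U [oU sU [dU [C HC]]]]] := branch_C1_hoelder f.
apply: continuous_in_subspaceT => x /set_mem /sU Ux.
apply/cvgrPdist_le => /= d d0.
pose r := (d / (`|C| + 1)) `^ e^-1.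
have C1 : 0 < `|C| + 1 by rewrite ltr_wpDl.
have r0 : 0 < r by rewrite powR_gt0// divr_gt0.
near=> y.
have Uy : U y by near: y; exact: open_nbhs_nbhs (conj oU Ux).
have xyr : `|x - y| <= r by near: y; apply: cvgr_dist_le => //; exact: cvg_id.
apply: le_trans (HC _ _ Ux Uy) _.
have : `|x - y| `^ e <= d / (`|C| + 1).
  apply: le_trans (_ : r `^ e <= _); first by rewrite ge0_ler_powR ?nnegrE// ltW.
  by rewrite /r -powRrM mulVf ?gt_eqF// powRr1// ltW// divr_gt0.
move=> h; apply: le_trans (_ : (`|C| + 1) * (`|x - y| `^ e) <= _).
  by rewrite ler_wpM2r ?powR_ge0// (le_trans (ler_norm _))// lerDl.
by rewrite mulrC -ler_pdivlMr.
Unshelve. all: by end_near.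
Qed.

(** Compactness turns the pointwise bound [1 < f'] into a uniform one. *)
Lemma derive1_bounds : exists k M : R, [/\ 1 < k, k <= M & forall i x, x \in `[lo f i, hi f i] ->
  k <= derive1 (branch f i) x <= M].
Proof.
(* Both bounds depend on one natural number and weaken as it grows, so the maximum over the branches
   serves all of them. *)
have /choice[n Hn] : forall i, exists n : nat, forall x, x \in `[lo f i, hi f i] ->
    1 + n.+1%:R^-1 <= derive1 (branch f i) x <= n.+2%:R.
  move=> i; have lh := ltW (lo_lt_hi f i).
  have [a ai amin] := EVT_min lh (derive1_branch_continuous (i := i)).
  have [b bi bmax] := EVT_max lh (derive1_branch_continuous (i := i)).
  have a1 : 0 < derive1 (branch f i) a - 1 by rewrite subr_gt0; apply: branch_expanding.
  exists (maxn (Num.truncn (derive1 (branch f i) a - 1)^-1) (Num.truncn (derive1 (branch f i) b))).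
  set m := maxn _ _ => x xi; apply/andP; split.
    apply: le_trans (amin _ xi); rewrite -lerBrDl -[leRHS]invrK lef_pV2 ?posrE ?invr_gt0//.
    apply: le_trans (ltW (truncnS_gt _)) _; rewrite ler_nat ltnS; exact: leq_maxl.
  apply: le_trans (bmax _ xi) _; apply: le_trans (ltW (truncnS_gt _)) _.
  by rewrite ler_nat ltnS leqW// leq_maxr.
pose N := \max_i n i.
exists (1 + N.+1%:R^-1), N.+2%:R; split.
- by rewrite ltrDl invr_gt0.
- rewrite -(natr1 N.+1) addrC lerD2r; apply: le_trans (_ : 1 <= _); last by rewrite ler1n.
  by rewrite invf_le1// ler1n.
- move=> i x xi; have /andP[h1 h2] := Hn i x xi.
  have nN : (n i <= N)%N by exact: leq_bigmax.
  apply/andP; split.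
    by apply: le_trans h1; rewrite lerD2l lef_pV2 ?posrE// ler_nat.
  by apply: le_trans h2 _; rewrite ler_nat !ltnS.
Qed.

End Branches.

Section Words.
Context {R : realType} {s : nat} (f : expanding_map R s).
Implicit Types (i : 'I_s) (u v w : seq 'I_s) (x y : R) (om : nat -> 'I_s).

(** It maps [0, 1] onto the cylinder of [w], whose endpoints are the images of 0 and 1. Words are
    finite lists because cylinders get concatenated and summed over. *)
Definition word_map w y : R := foldr (inverse_branch f) y w.

Definition len w : R := word_map w 1 - word_map w 0.

Lemma word_map_cat u v y : word_map (u ++ v) y = word_map u (word_map v y).
Proof. exact: foldr_cat. Qed.

Lemma inverse_wordE om n y : inverse_word f om n y = word_map (mkseq om n) y.
Proof.
elim: n y => [//|n ih] y.
have -> : inverse_word f om n.+1 y = inverse_word f om n (inverse_branch f (om n) y) by [].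
by rewrite ih /word_map mkseqS foldr_rcons.
Qed.

Lemma itv01P y : reflect (0 <= y /\ y <= 1) (y \in `[0, 1 : R]).
Proof. by rewrite in_itv/=; apply: andP. Qed.

Lemma inverse_branch01 i y : y \in `[0, 1] -> inverse_branch f i y \in `[0, 1].
Proof.
move=> /(inverse_branch_in f i); rewrite in_itv/= => /andP[a b]; apply/itv01P; split.
  exact: le_trans (lo_ge0 f i) a.
exact: le_trans b (hi_le1 f i).
Qed.

Lemma word_map01 w y : y \in `[0, 1] -> word_map w y \in `[0, 1].
Proof. by move=> y01; elim: w => [//|i w ih]; apply: inverse_branch01. Qed.

Lemma word_map_mono w : {in `[0, 1] &, {mono word_map w : x y / x <= y}}.
Proof.
move=> x y x0 y0; elim: w => [//|i w ih] /=.
by rewrite inverse_branch_mono ?word_map01.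
Qed.

Let m0 : (0 : R) \in `[0, 1]. Proof. by rewrite in_itv/= lexx ler01. Qed.
Let m1 : (1 : R) \in `[0, 1]. Proof. by rewrite in_itv/= lexx ler01. Qed.

Lemma len_gt0 w : 0 < len w.
Proof. by rewrite subr_gt0 (leW_mono_in (word_map_mono w)) ?ltr01. Qed.

Lemma word_map_itv w y : y \in `[0, 1] -> word_map w 0 <= y <= word_map w 1 ->
  exists2 z, z \in `[0, 1] & y = word_map w z.
Proof.
elim: w y => [|i w ih] y y0 /= yw; first by exists y.
have yi : y \in `[lo f i, hi f i].
  move: yw => /andP[a b]; rewrite in_itv/=; apply/andP; split.
    by apply: le_trans a; have := inverse_branch_in f i (word_map01 w m0); rewrite in_itv/= => /andP[].
  by apply: le_trans b _; have := inverse_branch_in f i (word_map01 w m1); rewrite in_itv/= => /andP[].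
have b0 := branch_in01 yi.
have [|z z0 zE] := ih (branch f i y) b0.
  by move: yw; rewrite -(branchK yi) !inverse_branch_mono ?word_map01// branchK.
by exists z => //=; rewrite -zE branchK.
Qed.

(** Replaces the intersection of images in [coding] by inequalities; [n = 0] gives membership in
    [0, 1]. *)
Definition in_cylinders om x := forall n, word_map (mkseq om n) 0 <= x <= word_map (mkseq om n) 1.

Lemma cylinder_in_lo u v : word_map u 0 <= word_map (u ++ v) 0.
Proof. by rewrite word_map_cat word_map_mono ?word_map01//; have /itv01P[] := word_map01 v m0. Qed.

Lemma cylinder_in_hi u v : word_map (u ++ v) 1 <= word_map u 1.
Proof. by rewrite word_map_cat word_map_mono ?word_map01//; have /itv01P[] := word_map01 v m1. Qed.

Lemma mkseq_cat om m n : mkseq om (m + n) = mkseq om m ++ mkseq (fun k => om (m + k)%N) n.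
Proof. by rewrite /mkseq iotaD map_cat add0n -{2}(addn0 m) iotaDl -map_comp. Qed.

Lemma in_cylinders_ex om : exists x, in_cylinders om x.
Proof.
pose L := range (fun n => word_map (mkseq om n) 0).
have nest m n : word_map (mkseq om m) 0 <= word_map (mkseq om n) 1.
  have lt w : word_map w 0 <= word_map w 1 by rewrite -subr_ge0; exact: ltW (len_gt0 w).
  case/orP: (leq_total m n) => /subnKC <-; rewrite mkseq_cat.
    apply: le_trans (cylinder_in_lo _ _) _; exact: lt.
  by apply: le_trans (lt _) _; exact: cylinder_in_hi.
have Ls : has_sup L.
  by split; [exists (word_map (mkseq om 0) 0), 0%N | exists (word_map (mkseq om 0) 1) => _ [n _ <-]; exact: nest].
exists (sup L) => n; apply/andP; split.
  by apply: ub_le_sup; [case: Ls | exists n].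
by apply: ge_sup; [case: Ls | move=> _ [m _ <-]; exact: nest].
Qed.

End Words.

(** * Lengths of cylinders and bounded distortion *)

Section Expansion.
Context {R : realType} {s : nat} (f : expanding_map R s).
Implicit Types (i : 'I_s) (u v w : seq 'I_s) (x y : R) (om : nat -> 'I_s).

(** Removing the first letter is one step of the dynamics, and the mean value theorem expresses the
    ratio of lengths by the derivative at a point of the cylinder. *)
Lemma len_cons i w : exists2 z, z \in `[word_map f (i :: w) 0, word_map f (i :: w) 1] &
  len f w = derive1 (branch f i) z * len f (i :: w).
Proof.
have m0 : (0 : R) \in `[0, 1] by rewrite in_itv/= lexx ler01.
have m1 : (1 : R) \in `[0, 1] by rewrite in_itv/= lexx ler01.
have /itv01P[a _] := word_map01 f w m0; have /itv01P[_ b] := word_map01 f w m1.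
by have [|z zi E] := @inverse_branch_mvt _ _ f i _ _ a _ b; [rewrite -subr_gt0 len_gt0 | exists z].
Qed.

Lemma cylinder_sub_branch i w z : z \in `[word_map f (i :: w) 0, word_map f (i :: w) 1] ->
  z \in `[lo f i, hi f i].
Proof.
have m0 : (0 : R) \in `[0, 1] by rewrite in_itv/= lexx ler01.
have m1 : (1 : R) \in `[0, 1] by rewrite in_itv/= lexx ler01.
rewrite in_itv/= => /andP[a b].
have := inverse_branch_in f i (word_map01 f w m0); rewrite !in_itv/= => /andP[c _].
have := inverse_branch_in f i (word_map01 f w m1); rewrite !in_itv/= => /andP[_ d].
by rewrite (le_trans c a) (le_trans b d).
Qed.

Lemma len_bounds : exists k M : R, [/\ 1 < k, k <= M &
  forall w, M ^- size w <= len f w <= k ^- size w].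
Proof.
have [k [M [k1 kM H]]] := derive1_bounds f; exists k, M; split => //.
have k0 := lt_trans ltr01 k1; have M0 := lt_le_trans k0 kM.
elim=> [|i w /andP[h1 h2]]; first by rewrite /len/= subr0 !expr0 invr1 lexx.
have [z /cylinder_sub_branch /H /andP[d1 d2] E] := len_cons i w.
have l0 := len_gt0 f (i :: w).
rewrite /= !exprS !invfM; apply/andP; split.
  rewrite ler_pdivrMl//; apply: le_trans h1 _; rewrite E.
  by rewrite ler_pM2r.
rewrite ler_pdivlMl//; apply: le_trans h2; rewrite E.
by rewrite ler_pM2r.
Qed.

Lemma len_le1 w : len f w <= 1.
Proof.
have [k [M [k1 kM /(_ w)/andP[_ h]]]] := len_bounds; apply: le_trans h _.
by rewrite invf_le1 ?exprn_gt0 ?(lt_trans ltr01 k1)// exprn_ege1// ltW.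
Qed.

Lemma len_small (e : R) : 0 < e -> exists n0, forall w, (n0 <= size w)%N -> len f w < e.
Proof.
move=> e0; have [k [M [k1 kM H]]] := len_bounds; have k0 := lt_trans ltr01 k1.
have : (k^-1) ^+ n @[n --> \oo] --> (0 : R).
  by apply: cvg_expr; rewrite ger0_norm ?invr_ge0 ?(ltW k0)// invf_lt1.
move=> /cvgrPdist_lt /(_ e e0)[n0 _ h]; exists n0 => w sw.
have /andP[_ le] := H w; apply: le_lt_trans le _.
have := h (size w) sw; rewrite /= sub0r normrN ger0_norm ?exprVn//.
by rewrite invr_ge0 exprn_ge0// ltW.
Qed.

Lemma in_cylinders_uniq om x y : in_cylinders f om x -> in_cylinders f om y -> x = y.
Proof.
move=> hx hy; apply/eqP; rewrite -subr_eq0 -normr_le0; apply/ler_addgt0Pl => e e0.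
rewrite addr0; have [n0 h] := len_small e0.
have {h} := h (mkseq om n0); rewrite size_mkseq => /(_ (leqnn _)) h.
have /andP[a b] := hx n0; have /andP[c d] := hy n0.
apply: le_trans (ltW h); rewrite /len ler_norml; apply/andP; split; lra.
Qed.

Lemma coding_in om : in_cylinders f om (coding f om).
Proof.
have m0 : (0 : R) \in `[0, 1] by rewrite in_itv/= lexx ler01.
have m1 : (1 : R) \in `[0, 1] by rewrite in_itv/= lexx ler01.
have [x hx] := in_cylinders_ex f om.
pose P := \bigcap_(n in [set n | (1 <= n)%N]) (inverse_word f om n @` `[0, 1]).
have : P (coding f om).
  apply: (@getPex _ P); exists x => n _ /=.
  have x01 : x \in `[0, 1] by have := hx 0%N; rewrite /= in_itv.
  by have [z z01 ->] := word_map_itv x01 (hx n); exists z => //; rewrite inverse_wordE.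
move=> Pc; have H n : (1 <= n)%N -> word_map f (mkseq om n) 0 <= coding f om <= word_map f (mkseq om n) 1.
  move=> /Pc[z /= z01 <-]; rewrite inverse_wordE.
  by have /itv01P[a b] := z01; rewrite !word_map_mono// a b.
(* [coding] intersects over [n >= 1] only; the bounds at 0 are inherited from level 1. *)
case=> [|n]; last exact: H.
have /andP[a b] := H 1%N isT; apply/andP; split.
  by apply: le_trans a; exact: (cylinder_in_lo f [::]).
by apply: le_trans b _; exact: (cylinder_in_hi f [::]).
Qed.

Lemma coding_uniq om x : in_cylinders f om x -> coding f om = x.
Proof. exact: in_cylinders_uniq (coding_in om). Qed.

Lemma coding01 om : coding f om \in `[0, 1].
Proof. by have := coding_in om 0; rewrite /= in_itv. Qed.

(** Turns the Hoelder bound for the derivative into one for its logarithm, with the same constant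
    because derivatives exceed 1. *)
Lemma ln_dist (k x y : R) : 1 <= k -> k <= x -> k <= y -> `|ln x - ln y| <= `|x - y|.
Proof.
wlog xy : x y / x <= y.
  move=> H k1 kx ky; case/orP: (le_total x y) => h; first exact: H.
  by rewrite distrC (distrC x); apply: H.
move=> k1 kx ky; have x1 := le_trans k1 kx; have x0 := lt_le_trans ltr01 x1.
have y0 := lt_le_trans x0 xy.
rewrite distrC (distrC x) !ger0_norm ?subr_ge0 ?ler_ln ?posrE//.
rewrite -ln_div ?posrE//.
have -> : y / x = 1 + (y - x) / x by rewrite mulrBl divff ?gt_eqF//; ring.
apply: le_trans (le_ln1Dx _) _.
  by apply: lt_le_trans (_ : 0 <= _); rewrite ?ltrN10// divr_ge0 ?subr_ge0// ltW.
by rewrite ler_pdivrMr// ler_peMr// subr_ge0.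
Qed.

Lemma iter_shift n om k : iter n (@shift_map s) om k = om (n + k)%N.
Proof. by elim: n k => [//|n ih] k /=; rewrite /shift_map ih addnS addSn. Qed.

Lemma birkhoffS (u : (nat -> 'I_s) -> R) n om :
  birkhoff u n.+1 om = u om + birkhoff u n (shift_map om).
Proof.
by rewrite /birkhoff big_ord_recl /=; congr (_ + _); apply: eq_bigr => i _; rewrite -iterSr.
Qed.

Lemma birkhoffD (u : (nat -> 'I_s) -> R) m n om :
  birkhoff u (m + n) om = birkhoff u m om + birkhoff u n (iter m (@shift_map s) om).
Proof.
elim: m om => [|m ih] om; first by rewrite add0n /birkhoff big_ord0 add0r.
by rewrite addSn !birkhoffS ih addrA iterSr.
Qed.

Lemma powR_exprVn (k e : R) m : 0 < k -> (k ^- m) `^ e = (k `^ (- e)) ^+ m.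
Proof.
move=> k0; have -> : k ^- m = k `^ (- m%:R) by rewrite powRN powR_mulrn// ltW.
rewrite -powR_mulrn; last exact: powR_ge0.
rewrite -(powRrM k (- m%:R) e) -(powRrM k (- e) m%:R).
by congr powR; ring.
Qed.

Lemma len_distortion : exists K : R, 0 <= K /\ forall om n,
  `|ln (len f (mkseq om n)) - birkhoff (geometric_potential f) n om| <= K.
Proof.
have [e e0 [C C0 hC]] := derive1_hoelder f.
have [k1 [M1 [k11 kM1 hd]]] := derive1_bounds f.
have [k [M [kg kM hl]]] := len_bounds; have k0 := lt_trans ltr01 kg.
pose q := k `^ (- e).
have q0 : 0 < q by rewrite powR_gt0.
have q1 : q < 1.
  rewrite /q powRN invf_lt1 ?powR_gt0//.
  have : 1 `^ e < k `^ e by apply: gt0_ltr_powR => //; rewrite nnegrE ?ltW.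
  by rewrite powR1.
have step om n : `|ln (len f (mkseq om n)) - birkhoff (geometric_potential f) n om|
    <= C * \sum_(j < n) q ^+ j.+1.
  elim: n om => [|n ih] om.
    by rewrite /birkhoff !big_ord0 /len /= !subr0 ln1 normr0 mulr0.
  have -> : mkseq om n.+1 = om 0%N :: mkseq (shift_map om) n by rewrite /mkseq /= (iotaDl 1 0) -map_comp.
  rewrite birkhoffS; set i := om 0%N; set w := mkseq _ n.
  have sw : size w = n by rewrite size_mkseq.
  have [z zi E] := len_cons i w.
  have ci : coding f om \in `[word_map f (i :: w) 0, word_map f (i :: w) 1].
    have := coding_in om n.+1.
    by have -> : mkseq om n.+1 = i :: w by rewrite /mkseq /= (iotaDl 1 0) -map_comp.
  have zJ := cylinder_sub_branch zi; have cJ := cylinder_sub_branch ci.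
  have /andP[dz _] := hd _ _ zJ; have /andP[dc _] := hd _ _ cJ.
  have lE : ln (len f (i :: w)) = ln (len f w) - ln (derive1 (branch f i) z).
    rewrite E lnM ?posrE ?len_gt0//; first by ring.
    by apply: lt_le_trans dz; apply: lt_trans k11.
  rewrite lE big_ord_recr /= mulrDr.
  have -> : ln (len f w) - ln (derive1 (branch f i) z) -
     (geometric_potential f om + birkhoff (geometric_potential f) n (shift_map om)) =
    (ln (len f w) - birkhoff (geometric_potential f) n (shift_map om)) -
    (ln (derive1 (branch f i) z) - ln (derive1 (branch f i) (coding f om))).
    by rewrite /geometric_potential -/i; ring.
  apply: le_trans (ler_normB _ _) _; apply: lerD; first exact: ih.
  apply: le_trans (ln_dist (ltW k11) dz dc) _.
  apply: le_trans (hC _ _ _ zJ cJ) _; apply: ler_wpM2l => //.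
  have : `|z - coding f om| <= k ^- n.+1.
    have /andP[_ h] := hl (i :: w); rewrite /= sw in h; apply: le_trans h.
    move: zi ci; rewrite /len; move: (word_map f _ 0) (word_map f _ 1) => a0 a1.
    rewrite !in_itv/= => /andP[a b] /andP[c d].
    by rewrite ler_norml; apply/andP; split; lra.
  move=> h; apply: le_trans (_ : (k ^- n.+1) `^ e <= _).
    by rewrite ge0_ler_powR ?nnegrE// ?ltW// invr_gt0 exprn_gt0.
  by rewrite /q powR_exprVn.
exists (C * (1 - q)^-1); split; first by rewrite mulr_ge0// invr_ge0 subr_ge0 ltW.
move=> om n; apply: le_trans (step om n) _; apply: ler_wpM2l => //.
rewrite -[leRHS]mul1r ler_pdivlMr ?subr_gt0//.
have H m : (\sum_(j < m) q ^+ j.+1) * (1 - q) = q - q ^+ m.+1.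
  elim: m => [|m ih]; first by rewrite big_ord0 expr1 mul0r subrr.
  rewrite big_ord_recr /= mulrDl ih !exprS; ring.
by rewrite H lerBlDr; apply: le_trans (ltW q1) _; rewrite lerDl exprn_ge0// ltW.
Qed.

End Expansion.

(** * Separation of cylinders and the conjugacy *)

Section Exponent.
Context {R : realType} {s : nat} (f : expanding_map R s.+1).
Implicit Types (i : 'I_s.+1) (u v w : seq 'I_s.+1) (om nu : nat -> 'I_s.+1).

(** Padding a word with [ord0] gives a code, through which estimates on Birkhoff sums pass to
    words. *)
Definition ext w : nat -> 'I_s.+1 := nth ord0 w.

Lemma mkseq_ext w : mkseq (ext w) (size w) = w.
Proof. exact: mkseq_nth. Qed.

Lemma mkseq_ext_cat u v : mkseq (ext (u ++ v)) (size u) = u.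
Proof.
apply: (@eq_from_nth _ ord0); rewrite size_mkseq// => k ku.
by rewrite nth_mkseq// /ext nth_cat ku.
Qed.

Lemma mkseq_ext_shift u v : mkseq (fun k => ext (u ++ v) (size u + k)) (size v) = v.
Proof.
apply: (@eq_from_nth _ ord0); rewrite size_mkseq// => k kv.
by rewrite nth_mkseq// /ext nth_cat ltnNge leq_addr /= addKn.
Qed.

(** The quantity A_w of the overview, or B_w when the map is g. *)
Definition lam w : R := - ln (len f w).

Lemma expR_lam w : expR (- lam w) = len f w.
Proof. by rewrite opprK lnK// posrE len_gt0. Qed.

Lemma lam_birkhoff : exists K : R, 0 <= K /\ forall om n,
  `|lam (mkseq om n) + birkhoff (geometric_potential f) n om| <= K.
Proof.
have [K [K0 H]] := len_distortion f; exists K; split => // om n.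
by rewrite -normrN opprD opprK; exact: H.
Qed.

(** Birkhoff sums are exactly additive along a code; three uses of the distortion bound transfer
    this to words. *)
Lemma lam_cat : exists K : R, 0 <= K /\ forall u v, `|lam (u ++ v) - (lam u + lam v)| <= K.
Proof.
have [K [K0 H]] := lam_birkhoff; exists (K + K + K); split; first by rewrite !addr_ge0.
move=> u v; set om := ext (u ++ v).
have := H om (size u + size v)%N; have := H om (size u); have := H (iter (size u) (@shift_map _) om) (size v).
rewrite birkhoffD mkseq_ext_cat -size_cat mkseq_ext.
have -> : mkseq (iter (size u) (@shift_map _) om) (size v) = v.
  rewrite -[RHS](mkseq_ext_shift u v); apply: eq_mkseq => k; exact: iter_shift.
rewrite !ler_norml => /andP[a1 a2] /andP[b1 b2] /andP[c1 c2]; apply/andP; split; lra.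
Qed.

Lemma lam_bounds : exists c C : R, [/\ 0 < c, c <= C &
  forall w, c * (size w)%:R <= lam w <= C * (size w)%:R].
Proof.
have [k [M [k1 kM H]]] := len_bounds f.
have k0 := lt_trans ltr01 k1; have M0 := lt_le_trans k0 kM.
exists (ln k), (ln M); split; first exact: ln_gt0.
  by rewrite ler_ln ?posrE.
move=> w; have /andP[a b] := H w; have l0 := len_gt0 f w.
have X (x : R) : 0 < x -> ln (x ^- size w) = - (ln x * (size w)%:R).
  by move=> x0; rewrite lnV ?posrE ?exprn_gt0// lnXn// mulr_natr.
rewrite /lam; apply/andP; split.
  by rewrite lerNr -X// ler_ln ?posrE ?invr_gt0 ?exprn_gt0.
by rewrite lerNl -X// ler_ln ?posrE ?invr_gt0 ?exprn_gt0.
Qed.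

(** The constant [c] is the proportion in which all gaps between cylinders are measured below. *)
Lemma len_rcons : exists c : R, 0 < c /\ forall w i, c * len f w <= len f (rcons w i).
Proof.
have [K [K0 H]] := lam_cat; have [c [C [c0 cC B]]] := lam_bounds.
exists (expR (- (K + C))); split; first exact: expR_gt0.
move=> w i; rewrite -!expR_lam -expRD ler_expR -cats1.
have := H w [:: i]; have /andP[_] := B [:: i]; rewrite /= mulr1 ler_norml => h /andP[_ h2].
lra.
Qed.

Lemma len_cat_le u v : len f (u ++ v) <= len f u.
Proof.
by rewrite /len; have := cylinder_in_lo f u v; have := cylinder_in_hi f u v; lra.
Qed.

Lemma len_mkseq_le om m n : (m <= n)%N -> len f (mkseq om n) <= len f (mkseq om m).
Proof. by move=> /subnKC <-; rewrite mkseq_cat len_cat_le. Qed.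

Lemma word_map_rcons w i y : word_map f (rcons w i) y = word_map f w (inverse_branch f i y).
Proof. exact: foldr_rcons. Qed.

Lemma sep_letter w (a b : 'I_s.+1) : (a < b)%N ->
  word_map f (rcons w a) 1 <= word_map f (rcons w b) 0.
Proof.
move=> ab; rewrite !word_map_rcons inverse_branch0 inverse_branch1 word_map_mono; first exact: hi_le_lo.
- apply/itv01P; split; last exact: hi_le1.
  exact: le_trans (lo_ge0 f a) (ltW (lo_lt_hi f a)).
- apply/itv01P; split; first exact: lo_ge0.
  exact: le_trans (ltW (lo_lt_hi f b)) (hi_le1 f b).
Qed.

Lemma cylinder_mkseq om m n : (m <= n)%N ->
  word_map f (mkseq om m) 0 <= word_map f (mkseq om n) 0 /\
  word_map f (mkseq om n) 1 <= word_map f (mkseq om m) 1.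
Proof.
by move=> /subnKC <-; rewrite mkseq_cat; split; [exact: cylinder_in_lo | exact: cylinder_in_hi].
Qed.

(** As the letter at [i] is not the last one, the whole child cylinder of the last letter lies
    between the point and the right end. *)
Lemma right_gap (c : R) : (forall w i, c * len f w <= len f (rcons w i)) ->
  forall om (i j : nat), (j <= i)%N -> om i != ord_max ->
  coding f om + c * len f (mkseq om i) <= word_map f (mkseq om j) 1.
Proof.
move=> hc om i j ji oi; have /andP[_ a] := coding_in f om i.+1.
have [_ b] := cylinder_mkseq om ji; apply: le_trans b.
rewrite mkseqS in a.
have h : (om i < @ord_max s)%N.
  by rewrite ltn_neqAle -ltnS ltn_ord andbT; exact: oi.
have := sep_letter (mkseq om i) h; have := hc (mkseq om i) ord_max.
have := cylinder_in_hi f (mkseq om i) [:: ord_max]; rewrite cats1 /len; lra.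
Qed.

Lemma left_gap (c : R) : (forall w i, c * len f w <= len f (rcons w i)) ->
  forall om (i j : nat), (j <= i)%N -> om i != ord0 ->
  word_map f (mkseq om j) 0 + c * len f (mkseq om i) <= coding f om.
Proof.
move=> hc om i j ji oi; have /andP[a _] := coding_in f om i.+1.
have [b _] := cylinder_mkseq om ji; apply: le_trans (lerD b (lexx _)) _.
rewrite mkseqS in a.
have h : (@ord0 s < om i)%N by rewrite lt0n; apply: contra oi => /eqP h; apply/eqP/val_inj.
have := sep_letter (mkseq om i) h; have := hc (mkseq om i) ord0.
have := cylinder_in_lo f (mkseq om i) [:: ord0]; rewrite cats1 /len; lra.
Qed.

Lemma sep_coding om nu j : mkseq om j = mkseq nu j -> (om j < nu j)%N ->
  word_map f (mkseq om j.+1) 1 <= word_map f (mkseq nu j.+1) 0.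
Proof. by move=> E h; rewrite !mkseqS -E; exact: sep_letter. Qed.

End Exponent.

Lemma mkseq_first_diff (T : eqType) (om nu : nat -> T) m : mkseq om m != mkseq nu m ->
  exists j, [/\ (j < m)%N, mkseq om j = mkseq nu j & om j != nu j].
Proof.
elim: m => [|m ih]; first by rewrite eqxx.
have [E|/ih [j [jm E d]] _] := eqVneq (mkseq om m) (mkseq nu m).
  rewrite !mkseqS E => d; exists m; split => //; apply: contra d => /eqP ->; exact: eqxx.
by exists j; split => //; exact: ltnW.
Qed.

Section Separation.
Context {R : realType} {s : nat} (f : expanding_map R s.+1).
Implicit Types (om nu : nat -> 'I_s.+1).

(** Only [om] carries markers, [nu] is arbitrary. Its point lies to the right or to the left of the
    cylinder of [om] at the first disagreement, which comes before [m]; the corresponding marker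
    supplies a gap on that side. *)
Lemma marked_separation (c : R) : (forall w i, c * len f w <= len f (rcons w i)) -> 0 < c ->
  forall om nu m p i1 i2, mkseq om m != mkseq nu m ->
  (m <= i1 < p)%N -> (m <= i2 < p)%N -> om i1 != ord_max -> om i2 != ord0 ->
  c * len f (mkseq om p) <= `|coding f om - coding f nu|.
Proof.
move=> hc c0 om nu m p i1 i2 /mkseq_first_diff[j [jm E d]] /andP[m1 p1] /andP[m2 p2] o1 o2.
have lp i : (i < p)%N -> c * len f (mkseq om p) <= c * len f (mkseq om i).
  by move=> ip; rewrite ler_pM2l// len_mkseq_le// ltnW.
case: (ltngtP (om j) (nu j)) => h.
- have a := sep_coding f E h; have /andP[b _] := coding_in f nu j.+1.
  have := right_gap hc (leq_trans jm m1) o1; have := lp _ p1 => h1 h2.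
  rewrite distrC; apply: le_trans (ler_norm _); lra.
- have a := sep_coding f (esym E) h; have /andP[_ b] := coding_in f nu j.+1.
  have := left_gap hc (leq_trans jm m2) o2; have := lp _ p2 => h1 h2.
  apply: le_trans (ler_norm _); lra.
- by move/eqP: d => []; apply: val_inj.
Qed.

(** The cylinders of length one cover [0, 1]; the midpoint of a gap between neighbours would have no
    code. *)
Lemma full_touching : range (coding f) = `[0, 1]%classic ->
  [/\ lo f ord0 = 0, hi f ord_max = 1 &
      forall a b : 'I_s.+1, b = a.+1 :> nat -> hi f a = lo f b].
Proof.
move=> H; have cov y : y \in `[0, 1] -> exists a, lo f a <= y <= hi f a.
  move=> y01; have : [set` `[0, 1]] y by [].
  rewrite -H => -[om _ <-]; exists (om 0%N); have := coding_in f om 1.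
  by rewrite /= inverse_branch0 inverse_branch1.
split.
- have [|a /andP[h1 h2]] := cov 0; first by rewrite in_itv/= lexx ler01.
  apply/eqP; rewrite eq_le lo_ge0 andbT.
  have [E|n0] := eqVneq a ord0; first by rewrite -E.
  have h : (@ord0 s < a)%N by rewrite lt0n; apply: contra n0 => /eqP h; apply/eqP/val_inj.
  apply: le_trans (ltW (lo_lt_hi f ord0)) _; exact: le_trans (hi_le_lo f h) h1.
- have [|a /andP[h1 h2]] := cov 1; first by rewrite in_itv/= lexx ler01.
  apply/eqP; rewrite eq_le hi_le1 /=.
  have [<-//|n0] := eqVneq a ord_max.
  have h : (a < @ord_max s)%N.
    by rewrite ltn_neqAle -ltnS ltn_ord andbT; exact: n0.
  apply: le_trans h2 _; apply: le_trans (hi_le_lo f h) (ltW (lo_lt_hi f ord_max)).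
- move=> a b ba; have ab : (a < b)%N by rewrite ba.
  apply/eqP; rewrite eq_le (hi_le_lo f ab) /= leNgt; apply/negP => h.
  have [|d /andP[h1 h2]] := cov ((hi f a + lo f b) / 2).
    rewrite in_itv/=; have := hi_le1 f b; have := lo_ge0 f a; have := lo_lt_hi f a; have := lo_lt_hi f b.
    by move=> *; apply/andP; split; lra.
  case: (ltngtP d b) => db.
  + have /orP[/eqP/val_inj E|da] : (d == a :> nat) || (d < a)%N by rewrite -leq_eqVlt -ltnS -ba.
      by rewrite E in h2; clear H ba E; lra.
    by have := hi_le_lo f da; have := lo_lt_hi f a; clear H ba; lra.
  + by have := hi_le_lo f db; have := lo_lt_hi f b; clear H ba; lra.
  + by move/val_inj: db h1 => ->; clear H ba; lra.
Qed.

End Separation.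

Section TwoMaps.
Context {R : realType} {s : nat} (f g : expanding_map R s.+1).
Hypothesis full : range (coding g) = `[0, 1]%classic.
Implicit Types (om nu : nat -> 'I_s.+1).

(** Under [full] the inverse of the last branch fixes 1, so trailing last letters do not move the
    right end. *)
Lemma word_map_max om j n : (j <= n)%N -> (forall i, (j <= i < n)%N -> om i = ord_max) ->
  word_map g (mkseq om n) 1 = word_map g (mkseq om j) 1.
Proof.
have [_ h1 _] := full_touching full.
elim: n => [|n ih]; first by rewrite leqn0 => /eqP ->.
rewrite leq_eqVlt ltnS => /orP[/eqP ->//|jn] h.
rewrite mkseqS word_map_rcons inverse_branch1 (h n) ?jn/= ?h1 ?ih// => i /andP[a b].
by rewrite h// a ltnW.
Qed.

Lemma word_map_min om j n : (j <= n)%N -> (forall i, (j <= i < n)%N -> om i = ord0) ->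
  word_map g (mkseq om n) 0 = word_map g (mkseq om j) 0.
Proof.
have [h1 _ _] := full_touching full.
elim: n => [|n ih]; first by rewrite leqn0 => /eqP ->.
rewrite leq_eqVlt ltnS => /orP[/eqP ->//|jn] h.
rewrite mkseqS word_map_rcons inverse_branch0 (h n) ?jn/= ?h1 ?ih// => i /andP[a b].
by rewrite h// a ltnW.
Qed.

Lemma coding_dist_le om nu p : mkseq om p = mkseq nu p ->
  `|coding g om - coding g nu| <= len g (mkseq om p).
Proof.
move=> E; have /andP[a b] := coding_in g om p; have /andP[c d] := coding_in g nu p.
rewrite -E in c d; rewrite /len ler_norml; apply/andP; split; lra.
Qed.

(* Two cylinders much longer than |x - y| that contain x and y are nested or
   consecutive, and since the g-cylinders cover [0, 1] the images of consecutive ones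
   share an endpoint. *)
Lemma conjugacy_dist (c : R) : (forall w i, c * len f w <= len f (rcons w i)) -> 0 < c ->
  forall om nu n m, `|coding f om - coding f nu| < c * len f (mkseq om n) ->
  `|coding f om - coding f nu| < c * len f (mkseq nu m) ->
  `|coding g om - coding g nu| <= len g (mkseq om n) + len g (mkseq nu m).
Proof.
move=> hc c0 om nu n m h1 h2.
have lo0 := len_gt0 g (mkseq om n); have ln0 := len_gt0 g (mkseq nu m).
(* If the prefixes agree up to the shorter length, the cylinders are nested and the larger one alone
   bounds the distance. *)
have [E|/mkseq_first_diff] := eqVneq (mkseq om (minn n m)) (mkseq nu (minn n m)).
  have := coding_dist_le E; move: E; rewrite /minn; case: ifP => nm E h.
    by apply: le_trans h _; rewrite lerDl ltW.
  by apply: le_trans h _; rewrite E lerDr ltW.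
case=> j [jm E d]; have {jm}[jn jm] : (j < n)%N /\ (j < m)%N.
  by apply/andP; rewrite leq_min in jm.
wlog lt : om nu n m h1 h2 lo0 ln0 E d jn jm / (om j < nu j)%N.
  move=> H; case: (ltngtP (om j) (nu j)) => h; first exact: (H om nu n m).
    rewrite distrC [leRHS]addrC; apply: (H nu om m n) => //; rewrite 1?distrC//.
    by rewrite eq_sym.
  by move/eqP: d => []; apply: val_inj.
have a := sep_coding f E lt.
have /andP[_ xo] := coding_in f om j.+1; have /andP[yo _] := coding_in f nu j.+1.
have D : `|coding f om - coding f nu| = coding f nu - coding f om.
  by rewrite distrC ger0_norm// subr_ge0; lra.
rewrite {}D in h1 h2.
have mon i k w : (i <= k)%N -> c * len f (mkseq w k) <= c * len f (mkseq w i).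
  by move=> ik; rewrite ler_pM2l// len_mkseq_le.
(* A letter strictly in between would place a child of the common cylinder between the two points,
   hence too large a distance. *)
have adj : nu j = (om j).+1 :> nat.
  apply/eqP; rewrite eqn_leq lt andbT leqNgt; apply/negP => gt.
  have k_lt : ((om j).+1 < s.+1)%N by exact: ltn_trans gt (ltn_ord _).
  pose k := Ordinal k_lt.
  have := @sep_letter _ _ f (mkseq om j) (om j) k (ltnSn _).
  have := @sep_letter _ _ f (mkseq om j) k (nu j) gt.
  rewrite {2}E -!mkseqS; have := hc (mkseq om j) k; have := mon _ _ om (ltnW jn).
  have -> : len f (rcons (mkseq om j) k) =
    word_map f (rcons (mkseq om j) k) 1 - word_map f (rcons (mkseq om j) k) 0 by [].
  lra.
(* Any other letter would leave a right gap longer than the distance of the points; likewise on the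
   left for [nu]. *)
have om_max i : (j.+1 <= i < n)%N -> om i = ord_max.
  move=> /andP[ji i_n]; apply/eqP/negPn/negP => oi.
  have := right_gap hc ji oi; have := mon _ _ om (ltnW i_n); lra.
have nu_min i : (j.+1 <= i < m)%N -> nu i = ord0.
  move=> /andP[ji im]; apply/eqP/negPn/negP => oi.
  have := left_gap hc ji oi; have := mon _ _ nu (ltnW im); lra.
have [_ _ touch] := full_touching full.
have G : word_map g (mkseq om n) 1 = word_map g (mkseq nu m) 0.
  rewrite (word_map_max jn om_max) (word_map_min jm nu_min) !mkseqS -E.
  by rewrite !word_map_rcons inverse_branch0 inverse_branch1 (touch _ _ adj).
have /andP[a1 a2] := coding_in g om n; have /andP[b1 b2] := coding_in g nu m.
rewrite distrC ger0_norm; last by rewrite subr_ge0; lra.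
by rewrite /len; lra.
Qed.

(** The conjugacy is well defined: distance 0 lies below every scale, so [conjugacy_dist] applies at
    all lengths. *)
Lemma coding_eq om nu : coding f om = coding f nu -> coding g om = coding g nu.
Proof.
move=> E; have [c [c0 hc]] := len_rcons f.
apply/eqP; rewrite -subr_eq0 -normr_le0; apply/ler_addgt0Pl => e e0; rewrite addr0.
have e2 : 0 < e / 2 by lra.
have [n0 h] := len_small g e2.
have D : `|coding f om - coding f nu| = 0 by rewrite E subrr normr0.
have := @conjugacy_dist c hc c0 om nu n0 n0; rewrite D !mulr_gt0 ?len_gt0// => /(_ isT isT) H.
have := h (mkseq om n0); have := h (mkseq nu n0); rewrite !size_mkseq leqnn => /(_ isT) k1 /(_ isT) k2.
by apply: le_trans H _; lra.
Qed.

Lemma conjugacyE om : conjugacy f g (coding f om) = coding g om.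
Proof.
rewrite /conjugacy; set P := _ @` _; have : P (get P).
  by apply: (@getPex _ P); exists (coding g om), om.
by case=> nu /= E <-; exact: coding_eq.
Qed.

End TwoMaps.

(** * Pressure as growth rate of sums over words *)

Lemma limf_esup_lt {T : choiceType} {X : filteredType T} {R : realType} (F : X -> \bar R)
    (G : set_system X) {FG : Filter G} (r : \bar R) :
  (limf_esup F G < r)%E -> \forall x \near G, (F x < r)%E.
Proof.
move=> /ereal_inf_lt[_ [V GV <-] h].
apply: filterS GV => x Vx; apply: le_lt_trans h.
by apply: ereal_sup_ubound; exists x.
Qed.

Lemma limf_esup_le {T : choiceType} {X : filteredType T} {R : realType} (F : X -> \bar R)
    (G : set_system X) (r : \bar R) :
  (\forall x \near G, (F x <= r)%E) -> (limf_esup F G <= r)%E.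
Proof.
move=> h; apply: ge_ereal_inf; exists (ereal_sup [set F x | x in [set x | (F x <= r)%E]]).
  by exists [set x | (F x <= r)%E].
by apply: ge_ereal_sup => _ [x /= hx <-].
Qed.

Section WordLists.
Context {s : nat}.
Implicit Types (u v w : seq 'I_s) (n m : nat).

Fixpoint words n : seq (seq 'I_s) :=
  if n is m.+1 then [seq i :: w | i <- enum 'I_s, w <- words m] else [:: [::]].

Lemma mem_words n w : (w \in words n) = (size w == n).
Proof.
elim: n w => [|n ih] w; first by rewrite inE; case: w.
apply/allpairsP/idP => [[[i v] /= [_ h ->]]|].
  by rewrite /= eqSS -ih.
by case: w => [//|i w]; rewrite /= eqSS -ih => h; exists (i, w); rewrite mem_enum.
Qed.

Lemma uniq_words n : uniq (words n).
Proof.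
elim: n => [//|n ih]; apply: allpairs_uniq => //; first exact: enum_uniq.
by move=> [i u] [j v] _ _ /= [-> ->].
Qed.

Lemma size_words n : size (words n) = (s ^ n)%N.
Proof. by elim: n => [//|n ih]; rewrite size_allpairs size_enum_ord ih expnS. Qed.

Lemma words_cat n m : perm_eq (words (n + m)) [seq u ++ v | u <- words n, v <- words m].
Proof.
apply: uniq_perm; first exact: uniq_words.
  apply: allpairs_uniq; try exact: uniq_words.
  move=> [u v] [u' v'] /allpairsP[[a b] /= [ha hb [-> ->]]] /allpairsP[[c d] /= [hc hd [-> ->]]] /= /eqP.
  rewrite eqseq_cat; first by move=> /andP[/eqP -> /eqP ->].
  by move: ha hc; rewrite !mem_words => /eqP -> /eqP.
move=> w; rewrite mem_words; apply/idP/allpairsP.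
  move=> /eqP sw; exists (take n w, drop n w); rewrite /= !mem_words size_drop sw addKn eqxx cat_take_drop.
  rewrite size_take sw; case: ltnP; rewrite ?eqxx//.
  by rewrite -{2}(addn0 n) leq_add2l leqn0 => /eqP ->; rewrite addn0 eqxx.
by move=> [[a b] /= []]; rewrite !mem_words => /eqP <- /eqP <- ->; rewrite size_cat.
Qed.

Lemma sum_words_cat (R : realType) (F : seq 'I_s -> R) n m :
  \sum_(w <- words (n + m)) F w = \sum_(u <- words n) \sum_(v <- words m) F (u ++ v).
Proof. by rewrite (perm_big _ (words_cat n m)) /= big_allpairs_dep. Qed.

End WordLists.

Lemma sum_uniq_sub_le (R : realType) (T : eqType) (l L : seq T) (F : T -> R) :
  uniq l -> uniq L -> {subset l <= L} -> (forall x, 0 <= F x) ->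
  \sum_(x <- l) F x <= \sum_(x <- L) F x.
Proof.
move=> ul uL sub F0; rewrite [leRHS](bigID (mem l)) /=.
have -> : \sum_(x <- l) F x = \sum_(x <- L | x \in l) F x.
  rewrite -[RHS]big_filter; apply: perm_big; apply: uniq_perm => //; first exact: filter_uniq.
  by move=> x; rewrite mem_filter; case: (boolP (x \in l)) => //= /sub ->.
by rewrite lerDl sumr_ge0.
Qed.

Section Pressure.
Context {R : realType} {s : nat}.
Implicit Types (om nu : nat -> 'I_s.+1) (w v : seq 'I_s.+1).

Lemma shift_dist_gt om nu (e : R) m : 2^-1 ^+ m <= e -> e < shift_dist om nu ->
  exists2 k, (k < m)%N & om k != nu k.
Proof.
rewrite /shift_dist; case: pselect => [ex h1 h2|_ h1 h2]; last first.
  by have := lt_trans (le_lt_trans h1 h2) (exprn_gt0 m (_ : (0 : R) < 2^-1));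
    rewrite ltxx invr_gt0 ltr0n => /(_ isT).
have := le_lt_trans h1 h2; case: ex_minnP => k kd _ kk; exists k => //.
rewrite ltnNge; apply/negP => mk; move: kk; rewrite ltNge => /negP; apply.
by apply: ler_wiXn2l => //; rewrite ?invr_ge0 ?ler0n// invf_le1// ler1n.
Qed.

Lemma shift_dist1 om nu : om 0%N != nu 0%N -> shift_dist om nu = 1 :> R.
Proof.
move=> h; rewrite /shift_dist; case: pselect => [ex|]; last by case; exists 0%N.
by case: ex_minnP => k kd /(_ _ h); rewrite leqn0 => /eqP ->; rewrite expr0.
Qed.

Variables (u : (nat -> 'I_s.+1) -> R) (U : seq 'I_s.+1 -> R) (K : R).
Hypothesis uU : forall om n, `|birkhoff u n om - U (mkseq om n)| <= K.

(** [U] is any function of words within [K] of the Birkhoff sums of [u]; this allows [lam] in place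
    of suprema over cylinders. *)
Definition partition_sum n : R := \sum_(w <- words n) expR (U w).

Lemma partition_sum_gt0 n : 0 < partition_sum n.
Proof.
have h : nseq n ord0 \in @words s.+1 n by rewrite mem_words size_nseq.
rewrite /partition_sum (big_rem _ h) /= ltr_pwDl ?expR_gt0//.
by apply: sumr_ge0 => w _; rewrite expR_ge0.
Qed.

(** One code per word: at a position where two words differ, the shifted codes are at distance 1. *)
Lemma separated_sum_ge n e : e < 1 -> ((expR (- K) * partition_sum n)%:E <= separated_sum u n e)%E.
Proof.
move=> e1; pose l := [seq ext w | w <- words n].
have ul : uniq l.
  rewrite map_inj_in_uniq ?uniq_words// => v w; rewrite !mem_words => /eqP sv /eqP sw E.
  by rewrite -(mkseq_ext v) -(mkseq_ext w) sv sw E.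
apply: le_trans (_ : (\sum_(w \in [set` l]) expR (birkhoff u n w))%:E <= _)%E; last first.
  apply: ereal_sup_ubound; exists [set` l] => //; split; first exact: finite_seq.
  move=> _ _ /= /mapP[w ww ->] /mapP[v wv ->] wv_neq.
  move: ww wv; rewrite !mem_words => /eqP sw /eqP sv.
  have : mkseq (ext w) n != mkseq (ext v) n.
    by apply/negP => /eqP; rewrite -{1}sw -sv !mkseq_ext => wvE; apply: wv_neq; rewrite wvE.
  move=> /mkseq_first_diff[j [jn _ d]]; exists j => //.
  by rewrite shift_dist1// !iter_shift addn0.
rewrite lee_fin -fsbig_seq// big_map /partition_sum mulr_sumr big_seq_cond [leRHS]big_seq_cond.
apply: ler_sum => w; rewrite andbT mem_words => /eqP sw.
rewrite -expRD ler_expR; have := uU (ext w) n; rewrite -{2}sw mkseq_ext ler_norml => /andP[h1 h2].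
lra.
Qed.

(** A separated set has at most one code in each cylinder of length [n + m], and every word of
    length [n] has [s.+1 ^ m] extensions to that length. *)
Lemma separated_sum_le n e m : 2^-1 ^+ m <= e ->
  (separated_sum u n e <= (s.+1%:R ^+ m * expR K * partition_sum n)%:E)%E.
Proof.
move=> em; apply: ge_ereal_sup => _ [E [finE sepE] <-]; rewrite lee_fin.
rewrite fsbig_finite//=; set l := finmap.enum_fset _.
have lE x : x \in l -> E x by rewrite /l in_fset_set// inE.
have ul : uniq l by exact: finmap.fset_uniq.
pose F w := expR K * expR (U (take n w)).
have F0 w : 0 <= F w by rewrite mulr_ge0 ?expR_ge0.
apply: le_trans (_ : \sum_(w <- [seq mkseq om (n + m) | om <- l]) F w <= _).
  rewrite big_map; apply: ler_sum => om _; rewrite /F -expRD ler_expR.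
  rewrite mkseq_cat take_size_cat ?size_mkseq//.
  by have := uU om n; rewrite ler_norml => /andP[h1 h2]; lra.
apply: le_trans (_ : \sum_(w <- words (n + m)) F w <= _).
  apply: sum_uniq_sub_le => //; last 2 first.
  - exact: uniq_words.
  - by move=> w /mapP[om _ ->]; rewrite mem_words size_mkseq.
  rewrite map_inj_in_uniq// => om nu /lE Eo /lE En eq; apply: contrapT => neq.
  have [k kn] := sepE _ _ Eo En neq; case/(shift_dist_gt em) => p pm.
  rewrite !iter_shift; apply/negP/negPn.
  have kp : (k + p < n + m)%N by rewrite -addSn leq_add// ltnW.
  by rewrite -(nth_mkseq ord0 om kp) eq nth_mkseq.
rewrite sum_words_cat /partition_sum mulr_sumr big_seq_cond [leRHS]big_seq_cond.
apply: ler_sum => w; rewrite andbT mem_words => /eqP sw.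
rewrite (eq_bigr (fun=> expR K * expR (U w))); last by move=> v _; rewrite /F take_size_cat.
rewrite big_const_seq count_predT size_words iter_addr_0 -[leLHS]mulr_natl natrX.
by rewrite mulrA.
Qed.

Let psi e := limn_esup (fun n => (n%:R^-1)%:E * lne (separated_sum u n e))%E.

Let lo_n n e : (0 < n)%N -> e < 1 ->
  ((n%:R^-1 * (ln (partition_sum n) - K))%:E <= (n%:R^-1)%:E * lne (separated_sum u n e))%E.
Proof.
move=> n0 e1; rewrite EFinM; apply: lee_wpmul2l; first by rewrite lee_fin invr_ge0.
have h := separated_sum_ge n e1; have p0 := partition_sum_gt0 n.
have q0 : 0 < expR (- K) * partition_sum n by rewrite mulr_gt0 ?expR_gt0.
have -> : (ln (partition_sum n) - K)%:E = lne (expR (- K) * partition_sum n)%:E.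
  by rewrite lne_EFin// lnM ?posrE ?expR_gt0// expRK addrC.
rewrite lee_lne//; rewrite in_itv/= leey andbT ?lee_fin ?(ltW q0)//.
by apply: le_trans h; rewrite lee_fin ltW.
Qed.

Let hi_n n e m : (0 < n)%N -> e < 1 -> 2^-1 ^+ m <= e ->
  ((n%:R^-1)%:E * lne (separated_sum u n e) <=
   (n%:R^-1 * (m%:R * ln s.+1%:R + K + ln (partition_sum n)))%:E)%E.
Proof.
move=> n0 e1 em; rewrite [leRHS]EFinM; apply: lee_wpmul2l; first by rewrite lee_fin invr_ge0.
have h := separated_sum_le n em; have p0 := partition_sum_gt0 n.
have h' := separated_sum_ge n e1.
have q0 : 0 < expR (- K) * partition_sum n by rewrite mulr_gt0 ?expR_gt0.
have s0 : 0 < s.+1%:R ^+ m * expR K * partition_sum n by rewrite !mulr_gt0 ?expR_gt0 ?exprn_gt0.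
have -> : (m%:R * ln s.+1%:R + K + ln (partition_sum n))%:E = lne (s.+1%:R ^+ m * expR K * partition_sum n)%:E.
  rewrite lne_EFin// lnM ?posrE ?mulr_gt0 ?expR_gt0 ?exprn_gt0// lnM ?posrE ?expR_gt0 ?exprn_gt0//.
  by rewrite expRK lnXn// mulr_natl.
rewrite lee_lne//; rewrite in_itv/= leey andbT ?lee_fin ?(ltW s0)//.
by apply: le_trans h'; rewrite lee_fin ltW.
Qed.

Let ex_pow (e : R) : 0 < e -> exists m, 2^-1 ^+ m <= e.
Proof.
move=> e0; have : (2^-1 : R) ^+ n @[n --> \oo] --> (0 : R).
  by apply: cvg_expr; rewrite ger0_norm ?invr_ge0// invf_lt1// ltr1n.
move=> /cvgrPdist_lt /(_ e e0)[m _ h]; exists m.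
have := h m (leqnn m); rewrite /= sub0r normrN ger0_norm ?exprn_ge0 ?invr_ge0//.
exact: ltW.
Qed.

Let eventually_small (C d : R) : 0 < d -> exists n0, forall n, (n0 <= n)%N -> (0 < n)%N -> n%:R^-1 * C <= d.
Proof.
move=> d0; exists (Num.truncn (C / d)).+1 => n hn n0.
rewrite ler_pdivrMl ?ltr0n//; rewrite -ler_pdivrMr//.
by apply: le_trans (ltW (truncnS_gt _)) _; rewrite ler_nat.
Qed.

Let psi_lt_sum e r : e < 1 -> (psi e < r%:E)%E ->
  exists n0, forall n, (n0 <= n)%N -> n%:R^-1 * (ln (partition_sum n) - K) < r.
Proof.
move=> e1 /limf_esup_lt [n0 _ h]; exists n0.+1 => n hn.
have np : (0 < n)%N by case: n hn.
by rewrite -lte_fin; apply: le_lt_trans (lo_n np e1) _; apply: h; apply: ltnW.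
Qed.

(* The number of (n, e)-separated points per n-cylinder is bounded independently of n,
   so the growth rate does not depend on e in ]0, 1[. *)
Let psi_le e e' : 0 < e -> e < 1 -> e' < 1 -> (psi e <= psi e')%E.
Proof.
move=> e0 e1 e1'; apply: contrapT => /negP; rewrite -ltNge => lt.
have [r [h1 h2]] : exists r : R, (psi e' < r%:E)%E /\ (r%:E < psi e)%E.
  case: (psi e') (psi e) lt => [x| |] [y| |] //=.
  - by rewrite lte_fin => xy; exists ((x + y) / 2); rewrite !lte_fin; split; lra.
  - by exists (x + 1); rewrite ltry lte_fin ltrDl.
  - by exists (y - 1); rewrite ltNyr lte_fin; split => //; rewrite ltrBlDr ltrDl.
  - by exists 0; rewrite ltNyr ltry.
have [r' [h3 h4]] : exists r' : R, (psi e' < r'%:E)%E /\ r' < r.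
  case: (psi e') h1 => [x| |] //=.
  - by rewrite lte_fin => xy; exists ((x + r) / 2); rewrite !lte_fin; split; lra.
  - by exists (r - 1); rewrite ltNyr; split => //; rewrite ltrBlDr ltrDl.
have [m em] := ex_pow e0.
have [n0 H0] := psi_lt_sum e1' h3.
have rr : 0 < r - r' by rewrite subr_gt0.
have [n1 H1] := @eventually_small (m%:R * ln s.+1%:R + K + K) (r - r') rr.
move: h2; rewrite ltNge => /negP; apply; apply: limf_esup_le.
exists (maxn n0 n1).+1 => // n /= hn.
have np : (0 < n)%N by case: n hn.
have g0 : (n0 <= n)%N by apply: leq_trans (ltnW hn); rewrite leq_max leqnn.
have g1 : (n1 <= n)%N by apply: leq_trans (ltnW hn); rewrite leq_max leqnn orbT.
apply: le_trans (hi_n np e1 em) _; rewrite lee_fin.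
have -> : m%:R * ln s.+1%:R + K + ln (partition_sum n) =
  (m%:R * ln s.+1%:R + K + K) + (ln (partition_sum n) - K) by ring.
rewrite mulrDr; have := H0 n g0; have := H1 n g1 np; lra.
Qed.

(** Pressure is a limit superior, so the upper bound holds for all large n but the lower one only
    for infinitely many; [partition_lower] repairs this. *)
Lemma pressure0_partition_sum : pressure u = 0%E ->
  (forall e : R, 0 < e -> exists n0, forall n, (n0 <= n)%N -> partition_sum n <= expR (e * n%:R)) /\
  (forall e : R, 0 < e -> forall n0, exists2 n, (n0 <= n)%N & expR (- (e * n%:R)) <= partition_sum n).
Proof.
have half0 : 0 < (2^-1 : R) by rewrite invr_gt0.
have half1 : (2^-1 : R) < 1 by rewrite invf_lt1// ltr1n.
(* By [psi_le] the function [psi] is constant on ]0, 1[, so its limit at 0 is its value at any point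
   there. *)
have -> : pressure u = psi 2^-1.
  apply: lim_near_cst => //.
  near=> e; apply/eqP; rewrite eq_le.
  have e0 : 0 < e by near: e; exact: nbhs_right_gt.
  have e1 : e < 1 by near: e; exact: nbhs_right_lt.
  by rewrite !psi_le.
move=> P0; split.
  move=> e e0; have e2 : 0 < e / 2 by rewrite divr_gt0.
  have h : (psi 2^-1 < (e / 2)%:E)%E by rewrite P0 lte_fin.
  have [n0 H0] := psi_lt_sum half1 h.
  have [n1 H1] := @eventually_small K _ e2.
  exists (maxn n0 n1).+1 => n hn.
  have np : (0 < n)%N by case: n hn.
  have g0 : (n0 <= n)%N by apply: leq_trans (ltnW hn); rewrite leq_max leqnn.
  have g1 : (n1 <= n)%N by apply: leq_trans (ltnW hn); rewrite leq_max leqnn orbT.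
  rewrite -[leLHS]lnK ?posrE ?partition_sum_gt0// ler_expR.
  have := H0 n g0; have := H1 n g1 np; rewrite mulrBr => h1 h2.
  have : n%:R^-1 * ln (partition_sum n) <= e by lra.
  by rewrite ler_pdivrMl ?ltr0n// mulrC.
move=> e e0 n0; have e2 : 0 < e / 2 by rewrite divr_gt0.
have [m em] := ex_pow half0.
have [n1 H1] := @eventually_small (m%:R * ln s.+1%:R + K) _ e2.
apply: contrapT => H.
have : (psi 2^-1 <= (- (e / 2))%:E)%E.
  apply: limf_esup_le; exists (maxn n0 n1).+1 => // n /= hn.
  have np : (0 < n)%N by case: n hn.
  have g0 : (n0 <= n)%N by apply: leq_trans (ltnW hn); rewrite leq_max leqnn.
  have g1 : (n1 <= n)%N by apply: leq_trans (ltnW hn); rewrite leq_max leqnn orbT.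
  apply: le_trans (hi_n np half1 em) _; rewrite lee_fin mulrDr.
  have : partition_sum n < expR (- (e * n%:R)).
    by rewrite ltNge; apply/negP => h; apply: H; exists n.
  rewrite -[ltLHS]lnK ?posrE ?partition_sum_gt0// ltr_expR => h.
  have := H1 n g1 np.
  have : n%:R^-1 * ln (partition_sum n) <= - e.
    by rewrite ler_pdivrMl ?ltr0n// mulrC mulNr ltW.
  lra.
by rewrite P0 lee_fin; lra.
Unshelve. all: by end_near.
Qed.

End Pressure.

(** * Many words with prescribed exponents *)

Section Growth.
Context {R : realType}.

(** The left side has the shape of [bin_error]; the logarithm is bounded by its tangent of slope
    [d], with [d * (a + 1) = e / 4]. *)
Lemma linear_beats_ln (a b e : R) : 0 <= a -> 0 < e -> exists n0 : nat, forall n : nat,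
  (n0 <= n)%N -> b + 2 * ln (1 + a * n%:R) <= e * n%:R.
Proof.
move=> a0 e0; pose d := e / (4 * (a + 1)).
have d0 : 0 < d by rewrite divr_gt0// mulr_gt0// ltr_wpDl.
exists (Num.truncn ((b + 2 * (d - 1 - ln d)) / (e / 2))).+1 => n hn.
have n1 : (b + 2 * (d - 1 - ln d)) <= e / 2 * n%:R.
  rewrite [leRHS]mulrC -ler_pdivrMr ?divr_gt0//.
  by apply: le_trans (ltW (truncnS_gt _)) _; rewrite ler_nat.
have x0 : 0 < 1 + a * n%:R by rewrite ltr_pwDl// mulr_ge0.
have : ln (1 + a * n%:R) <= d * (1 + a * n%:R) - 1 - ln d.
  have -> : ln (1 + a * n%:R) = ln (d * (1 + a * n%:R)) - ln d.
    by rewrite lnM ?posrE//; ring.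
  rewrite lerB// -[leLHS]/(ln _).
  have := @le_ln1Dx R (d * (1 + a * n%:R) - 1); rewrite addrCA subrr addr0; apply.
  by rewrite ltrBrDl subrr mulr_gt0.
have dE : d * (a + 1) = e / 4.
  by rewrite /d; field; rewrite gt_eqF// ltr_wpDl.
have dn : 0 <= d * n%:R by rewrite mulr_ge0// ltW.
have dE2 : d * (1 + a * n%:R) = d + e / 4 * n%:R - d * n%:R by rewrite -dE; ring.
rewrite dE2 => h; move: n1; clear -h dn => n1; lra.
Qed.

Lemma sum_le_size (T : eqType) (l : seq T) (F : T -> R) (c : R) :
  (forall x, x \in l -> F x <= c) -> \sum_(x <- l) F x <= (size l)%:R * c.
Proof.
elim: l => [|x l ih] h; first by rewrite big_nil mul0r.
rewrite big_cons /= -natr1 mulrDl mul1r addrC lerD ?h ?mem_head// ih// => y yl.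
by apply: h; rewrite inE yl orbT.
Qed.

End Growth.

Section Partition.
Context {R : realType} {s : nat}.
Implicit Types (u v w : seq 'I_s.+1).

(* A submultiplicative sequence below exp(-k) at one index decays exponentially. *)
Lemma partition_lower (U : seq 'I_s.+1 -> R) (k : R) :
  (forall u v, `|U (u ++ v) - (U u + U v)| <= k) ->
  (forall e : R, 0 < e -> forall n0, exists2 n, (n0 <= n)%N & expR (- (e * n%:R)) <= partition_sum U n) ->
  forall N, (0 < N)%N -> expR (- k) <= partition_sum U N.
Proof.
move=> hU low N N0; rewrite leNgt; apply/negP => lt.
pose Z := partition_sum U; have Z0 n : 0 < Z n := partition_sum_gt0 U n.
pose q := expR k * Z N.
have q0 : 0 < q by rewrite mulr_gt0 ?expR_gt0.
have q1 : q < 1 by rewrite /q mulrC -ltr_pdivlMr ?expR_gt0// div1r -expRN.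
have sub n m : Z (n + m)%N <= expR k * Z n * Z m.
  rewrite /Z /partition_sum sum_words_cat -mulrA mulr_suml mulr_sumr.
  apply: ler_sum => u _; rewrite mulr_sumr mulr_sumr; apply: ler_sum => v _.
  rewrite -!expRD ler_expR; have := hU u v; rewrite ler_norml => /andP[h1 h2]; lra.
have pow j m : Z (j * N + m)%N <= q ^+ j * Z m.
  elim: j => [|j ih]; first by rewrite mul0n add0n expr0 mul1r.
  rewrite mulSn -addnA exprS; apply: le_trans (sub _ _) _.
  by rewrite -/q -mulrA ler_pM2l.
pose M := \sum_(r < N) Z r.
have lq : 0 < - ln q by rewrite oppr_gt0 ln_lt0// q0 q1.
have N1 : 0 < N%:R :> R by rewrite ltr0n.
(* Half the decay rate per letter forced by the factor [q < 1] per [N] letters, so the assumed lower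
   bound fails for large n. *)
pose e := - ln q / (2 * N%:R).
have e0 : 0 < e by rewrite divr_gt0// mulr_gt0.
have [n hn] := low e e0 (Num.truncn ((ln M - ln q) / e)).+1.
apply/negP; rewrite -ltNge.
have rN : (n %% N < N)%N by rewrite ltn_mod.
have ZM : Z (n %% N)%N <= M.
  rewrite /M (bigD1 (Ordinal rN))//= lerDl sumr_ge0// => i _; exact: ltW.
have M0 : 0 < M := lt_le_trans (Z0 _) ZM.
have h : ln M - ln q < e * n%:R.
  rewrite mulrC -ltr_pdivrMr//; apply: lt_le_trans (truncnS_gt _) _; by rewrite ler_nat.
have := pow (n %/ N)%N (n %% N)%N; rewrite -divn_eq => /le_lt_trans; apply.
apply: le_lt_trans (_ : q ^+ (n %/ N) * M < _); first by rewrite ler_pM2l ?exprn_gt0.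
have -> : q ^+ (n %/ N) * M = expR ((n %/ N)%:R * ln q + ln M).
  by rewrite expRD expRM_natl !lnK ?posrE.
rewrite ltr_expR.
have : n%:R < ((n %/ N)%:R + 1) * N%:R :> R.
  by rewrite natr1 -natrM ltr_nat mulSn {1}(divn_eq n N) addnC ltn_add2r.
move=> hd; have : - ln q * n%:R < - ln q * (((n %/ N)%:R + 1) * N%:R) by rewrite ltr_pM2l.
have eE : e * n%:R * 2 * N%:R = - ln q * n%:R by rewrite /e; field; rewrite gt_eqF.
rewrite -eE mulrA ltr_pM2r// => h3; lra.
Qed.

Variables (X V : seq 'I_s.+1 -> R) (K : R).
Hypothesis K0 : 0 <= K.
Hypothesis hX : forall u v, `|X (u ++ v) - (X u + X v)| <= K.
Hypothesis hV : forall u v, `|V (u ++ v) - (V u + V v)| <= K.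

(** The common length makes concatenation of two families injective, so cardinalities multiply;
    centres and a tolerance stand for exact values of [X] and [V]. *)
Definition block N (x v d : R) (W : seq (seq 'I_s.+1)) :=
  [/\ uniq W, forall w, w \in W -> size w = N &
      forall w, w \in W -> `|X w - x| <= d /\ `|V w - v| <= d].

Definition cat_blocks (W1 W2 : seq (seq 'I_s.+1)) := [seq u ++ v | u <- W1, v <- W2].

Lemma size_cat_blocks W1 W2 : size (cat_blocks W1 W2) = (size W1 * size W2)%N.
Proof. exact: size_allpairs. Qed.

Lemma block_cat N1 N2 x1 x2 y1 y2 d1 d2 W1 W2 :
  block N1 x1 y1 d1 W1 -> block N2 x2 y2 d2 W2 ->
  block (N1 + N2) (x1 + x2) (y1 + y2) (d1 + d2 + K) (cat_blocks W1 W2).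
Proof.
move=> [u1 s1 h1] [u2 s2 h2]; split.
- apply: allpairs_uniq => // -[a b] [a' b'] /allpairsP[[c e] /= [hc he [-> ->]]]
    /allpairsP[[c' e'] /= [hc' he' [-> ->]]] /= /eqP.
  by rewrite eqseq_cat ?s1// => /andP[/eqP -> /eqP ->].
- by move=> w /allpairsP[[a b] /= [/s1 sa /s2 sb ->]]; rewrite size_cat sa sb.
move=> w /allpairsP[[a b] /= [/h1 [xa va] /h2 [xb vb] ->]].
have := hX a b; have := hV a b; move: xa va xb vb; rewrite !ler_norml.
move=> /andP[? ?] /andP[? ?] /andP[? ?] /andP[? ?] /andP[? ?] /andP[? ?].
split; apply/andP; split; lra.
Qed.

(** Quasi-additivity at two empty words bounds [X] and [V] there by [K]. *)
Lemma block_nil : block 0 0 0 K [:: [::]].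
Proof.
split => //; first by move=> w; rewrite inE => /eqP ->.
move=> w; rewrite inE => /eqP ->; have := hX [::] [::]; have := hV [::] [::].
by rewrite /= !opprD !addNKr !normrN !subr0.
Qed.

Definition pow_blocks W k := iter k (cat_blocks W) [:: [::]].

Lemma size_pow_blocks W k : size (pow_blocks W k) = (size W ^ k)%N.
Proof. by elim: k => [//|k ih]; rewrite /= size_cat_blocks ih expnS. Qed.

Lemma block_pow N x y d W k : block N x y d W ->
  block (k * N) (k%:R * x) (k%:R * y) (k%:R * (d + K) + K) (pow_blocks W k).
Proof.
move=> b; elim: k => [|k ih]; first by rewrite mul0n !mul0r add0r; exact: block_nil.
rewrite mulSn /=.
have -> : k.+1%:R * x = x + k%:R * x by rewrite -natr1; ring.
have -> : k.+1%:R * y = y + k%:R * y by rewrite -natr1; ring.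
have -> : k.+1%:R * (d + K) + K = d + (k%:R * (d + K) + K) + K by rewrite -natr1; ring.
exact: block_cat.
Qed.

Variables (C : nat) (C1 D : R).
Hypothesis C10 : 0 <= C1.
Hypothesis D0 : 0 <= D.
Hypothesis bX : forall w, 0 <= X w <= C%:R * (size w)%:R.
Hypothesis bV : forall w, `|V w| <= C%:R * (size w)%:R.
Hypothesis low : forall (b : R) N, (0 < N)%N ->
  expR (- (C1 * (1 + `|b|))) <= partition_sum (fun w => - (D * X w) - b * V w) N.

(** Allows for the losses in [dominant_bin]: the constant in [low], the number of bins, and the
    rounding of [X] and [V] to integers. *)
Definition bin_error N (b : R) : R :=
  C1 * (1 + `|b|) + 2 * ln (1 + (2 * C)%:R * N%:R) + D + `|b|.

(** Pigeonhole: some bin carries at least the average share of the tilted sum. The weights in a bin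
    are nearly equal, so this bounds its cardinality from below. *)
Lemma dominant_bin N (b : R) : (0 < N)%N -> exists (x : R) (z : int) W,
  [/\ block N x z%:~R 1 W, (0 < size W)%N, `|z%:~R : R| <= C%:R * N%:R, 0 <= x &
      D * x + b * z%:~R - bin_error N b <= ln (size W)%:R].
Proof.
move=> N0; pose M' := (2 * C * N)%N.
pose F w := expR (- (D * X w) - b * V w).
have F0 w : 0 < F w by exact: expR_gt0.
pose ix w : 'I_M'.+1 := inord (Num.truncn (X w)).
(* The shift by [C * N] makes [V] nonnegative before truncation; both indices stay at most [M'], so
   [inord] does not change them. *)
pose iv w : 'I_M'.+1 := inord (Num.truncn (V w + (C * N)%:R)).
pose idx w := (ix w, iv w).
have tot : partition_sum (fun w => - (D * X w) - b * V w) N =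
    \sum_(j : 'I_M'.+1 * 'I_M'.+1) \sum_(w <- words N | idx w == j) F w.
  by rewrite /partition_sum (partition_big idx xpredT).
pose S j := \sum_(w <- words N | idx w == j) F w.
have [j hj] : exists j, expR (- (C1 * (1 + `|b|))) <= M'.+1%:R * M'.+1%:R * S j.
  apply: contrapT => H; have := low b N0; rewrite leNgt => /negP; apply.
  rewrite tot; apply: lt_le_trans (_ : \sum_(j : 'I_M'.+1 * 'I_M'.+1)
    expR (- (C1 * (1 + `|b|))) / (M'.+1%:R * M'.+1%:R) <= _).
    rewrite (bigD1 (ord0, ord0))//= [ltRHS](bigD1 (ord0, ord0))//=.
    have hS j : S j < expR (- (C1 * (1 + `|b|))) / (M'.+1%:R * M'.+1%:R).
      rewrite ltr_pdivlMr ?mulr_gt0// mulrC ltNge; apply/negP => h; apply: H; by exists j.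
    apply: ltr_leD; first exact: hS.
    by apply: ler_sum => i _; exact: ltW (hS i).
  rewrite sumr_const card_prod card_ord -natrM -[leLHS]mulr_natr.
  by rewrite divfK// gt_eqF// ltr0n muln_gt0.
pose W := [seq w <- words N | idx w == j].
(* An integer centre, because its absolute value will serve as a number of copies. *)
pose z : int := (j.2 : nat)%:Z - (C * N)%:Z.
have CN0 : (0 : R) <= (C * N)%:R by [].
have inW w : w \in W -> [/\ size w = N, (j.1 : nat) = Num.truncn (X w) &
    (j.2 : nat) = Num.truncn (V w + (C * N)%:R)].
  rewrite mem_filter mem_words => /andP[/eqP <- /eqP sw].
  have /andP[x0 x1] := bX w; have := bV w; rewrite sw ler_norml => /andP[v0 v1].
  rewrite sw -natrM in x1; rewrite -natrM in v0 v1.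
  split => //; rewrite /= inordK// ltnS.
    rewrite truncn_le_nat; apply: le_lt_trans x1 _; by rewrite ltr_nat /M' ltnS -mulnA leq_pmull.
  rewrite truncn_le_nat; apply: le_lt_trans (_ : (C * N)%:R + (C * N)%:R < _).
    by rewrite lerD2r.
  by rewrite -natrD ltr_nat /M' -mulnA mul2n addnn.
have zE : z%:~R = (j.2 : nat)%:R - (C * N)%:R :> R by rewrite /z rmorphB.
have bW : block N (j.1 : nat)%:R z%:~R 1 W.
  split; first by rewrite filter_uniq// uniq_words.
    by move=> w /inW[].
  move=> w /inW[sw -> E2]; have /andP[x0 _] := bX w.
  have := bV w; rewrite sw ler_norml -natrM => /andP[v0 v1].
  have vp : 0 <= V w + (C * N)%:R by lra.
  rewrite zE E2; have /andP[a1 a2] := truncn_itv x0; have /andP[a3 a4] := truncn_itv vp.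
  by rewrite -natr1 in a2; rewrite -natr1 in a4; split; rewrite ler_norml; apply/andP; split; lra.
have SE : S j <= (size W)%:R * expR (- (D * (j.1 : nat)%:R) - b * z%:~R + `|b|).
  rewrite /S -big_filter -/W; apply: sum_le_size => w wW; rewrite ler_expR.
  have [_ _ h] := bW; have [_ hv] := h _ wW.
  have [sw jE _] := inW _ wW; have /andP[x0 _] := bX w; have /andP[a1 _] := truncn_itv x0.
  have : D * (j.1 : nat)%:R <= D * X w by rewrite ler_wpM2l// jE.
  have : `|b * (V w - z%:~R)| <= `|b| by rewrite normrM ler_piMr.
  rewrite ler_norml => /andP[h1 h2] h3; move: h1 h2; rewrite mulrBr; lra.
have sW : (0 < size W)%N.
  rewrite lt0n; apply/eqP => W0; have := lt_le_trans (expR_gt0 _) hj.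
  by move: SE; rewrite W0 mul0r => Sj; rewrite ltNge mulr_ge0_le0.
exists (j.1 : nat)%:R, z, W; split => //.
  case: (W) sW inW => [//|w W'] _ /(_ w); rewrite inE eqxx => /(_ isT)[sw _ E2].
  rewrite zE E2; have := bV w; rewrite sw -natrM ler_norml => /andP[v0 v1].
  have vp : 0 <= V w + (C * N)%:R by lra.
  have /andP[a3 a4] := truncn_itv vp.
  rewrite ler_norml; apply/andP; split; last by lra.
  by rewrite lerBrDl subrr.
have s0 : (0 : R) < (size W)%:R by rewrite ltr0n.
have MM : (0 : R) < M'.+1%:R by [].
have : expR (- (C1 * (1 + `|b|))) <= expR (ln M'.+1%:R + ln M'.+1%:R + ln (size W)%:R
   + (- (D * (j.1 : nat)%:R) - b * z%:~R + `|b|)).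
  apply: le_trans hj _; rewrite !expRD !lnK ?posrE// -[leRHS]mulrA -!expRD.
  by rewrite ler_pM2l// mulr_gt0.
rewrite ler_expR /bin_error.
have -> : ln (1 + (2 * C)%:R * N%:R) = ln M'.+1%:R :> R by rewrite -natrM addrC natr1.
suff aux (a1 a2 a3 a4 a5 a6 : R) : - a1 <= a2 + a2 + a3 + (- a4 - a5 + a6) ->
    a4 + a5 - (a1 + 2 * a2 + D + a6) <= a3 by exact: aux.
by have := D0; lra.
Qed.

Lemma block_weaken N x y y' d d' W : block N x y d W -> d <= d' -> `|y - y'| + d <= d' ->
  block N x y' d' W.
Proof.
move=> [uW sW h] dd dy; split => // w /h[h1 h2]; split; first exact: le_trans h1 dd.
apply: le_trans dy; rewrite [leRHS]addrC; apply: le_trans (lerD h2 (lexx `|y - y'|)).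
by apply: le_trans (ler_normD _ _); rewrite subrKA.
Qed.

Lemma ln_size_pow W k : (0 < size W)%N ->
  ln (size (pow_blocks W k))%:R = k%:R * ln (size W)%:R :> R.
Proof. by move=> h; rewrite size_pow_blocks natrX lnXn ?ltr0n// mulr_natl. Qed.

(* The inverse temperature ranges over |b| <= r N: at the two ends dominance forces
   |V| <= Ce with Ce independent of N. *)
Lemma typical_block (e : R) (n0 : nat) : 0 < e -> exists N x W,
  [/\ (n0 <= N)%N, block N x 0 (e * N%:R) W, (0 < size W)%N & D * x - e * N%:R <= ln (size W)%:R].
Proof.
(* Chosen so that the binning error over [|b| <= r N] plus the cost [r C N] of one step of the grid
   stays below [e N]. *)
move=> e0; pose r := e / (C1 + 2 + C%:R + 1).
have Cp : 0 < C1 + 2 + C%:R + 1 by rewrite ltr_wpDl// !addr_ge0.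
have r0 : 0 < r by rewrite divr_gt0.
have rE : r * (C1 + 2 + C%:R + 1) = e by rewrite /r divfK// gt_eqF.
pose L := ln (s.+1%:R : R).
have L0 : 0 <= L by rewrite ln_ge0// ler1n.
(* At [|b| = r N] with [b z >= 0], dominance and [ln (size W) <= L N] give
   [r N |z| <= L N + (C1 + 2) r N], that is [|z| <= Ce]. *)
pose Ce := (L + (C1 + 2) * r) / r.
have Ce0 : 0 <= Ce by rewrite divr_ge0 ?(ltW r0)// addr_ge0// mulr_ge0 ?(ltW r0)// addr_ge0.
have [n1 Hn1] := @linear_beats_ln R (2 * C)%:R (C1 + D) r (ler0n _ _) r0.
pose n2 := (Num.truncn ((Ce + 1 + 4 * K) / e)).+1.
pose N := maxn (maxn n0 n1) n2.+1.
have N0 : (0 < N)%N by rewrite leq_max orbT.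
have Np : (0 : R) < N%:R by rewrite ltr0n.
have nN0 : (n0 <= N)%N by rewrite !leq_max leqnn.
have nN1 : (n1 <= N)%N by rewrite !leq_max leqnn orbT.
have nN2 : Ce + 1 + 4 * K <= e * N%:R.
  rewrite [leRHS]mulrC -ler_pdivrMr//; apply: le_trans (ltW (truncnS_gt _)) _.
  by rewrite ler_nat -/n2 !leq_max leqnSn orbT.
have CeE : Ce * r = L + (C1 + 2) * r by rewrite /Ce divfK// gt_eqF.
clearbody Ce N; have Kp := K0.
have err b : `|b| <= r * N%:R -> bin_error N b <= (C1 + 2) * r * N%:R.
  move=> hb; rewrite /bin_error; have := Hn1 N nN1 => h1.
  have : C1 * `|b| <= C1 * (r * N%:R) by rewrite ler_wpM2l.
  lra.
(* A grid of step [r] from [- r N] to [r N]; neighbouring values play the part of a common inverse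
   temperature. *)
pose beta i : R := r * (i%:R - N%:R).
have betaN i : (i <= 2 * N)%N -> `|beta i| <= r * N%:R.
  move=> iN; rewrite normrM (gtr0_norm r0) ler_pM2l// ler_norml.
  have : i%:R <= 2 * N%:R :> R by rewrite -natrM ler_nat.
  have : 0 <= i%:R :> R by [].
  by move=> *; apply/andP; split; lra.
pose good i x (z : int) W := [/\ block N x z%:~R 1 W, (0 < size W)%N, `|z%:~R : R| <= C%:R * N%:R, 0 <= x &
      D * x + beta i * z%:~R - (C1 + 2) * r * N%:R <= ln (size W)%:R].
have gex i : (i <= 2 * N)%N -> exists x z W, good i x z W.
  move=> iN; have [x [z [W [h1 h2 h3 h4 h5]]]] := dominant_bin (beta i) N0.
  exists x, z, W; split => //; apply: le_trans h5; rewrite lerD2l lerN2; exact: err (betaN _ iN).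
pose P i := exists x z W, good i x z W /\ (0 <= z)%R.
have nP i : (i <= 2 * N)%N -> ~ P i -> exists x z W, good i x z W /\ (z < 0)%R.
  move=> iN h; have [x [z [W g]]] := gex i iN; exists x, z, W; split => //.
  by rewrite ltNge; apply/negP => z0; apply: h; exists x, z, W.
have single i x z W : good i x z W -> 0 <= beta i * z%:~R -> beta i * z%:~R = r * N%:R * `|z%:~R| ->
  exists N x W,
  [/\ (n0 <= N)%N, block N x 0 (e * N%:R) W, (0 < size W)%N & D * x - e * N%:R <= ln (size W)%:R].
  move=> [h1 h2 h3 h4 h5] b0 bE; exists N, x, W.
  have CrN : (C1 + 2) * r * N%:R <= e * N%:R.
    rewrite ler_pM2r// -rE [leLHS]mulrC ler_pM2l// -addrA lerDl addr_ge0//.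
  split => //; last by lra.
  have lW : ln (size W)%:R <= L * N%:R.
    have [uW sW _] := h1; rewrite mulr_natr -lnXn// -natrX ler_ln ?posrE ?ltr0n ?expn_gt0//.
    rewrite ler_nat -size_words; apply: uniq_leq_size => // w /sW; rewrite mem_words => ->; exact: eqxx.
  have zC : `|z%:~R : R| <= Ce.
    rewrite -(ler_pM2r r0) CeE -(ler_pM2r Np).
    have : 0 <= D * x by rewrite mulr_ge0.
    move: bE; set t := `|_|; move=> bE h; rewrite bE in h5; lra.
  apply: block_weaken h1 _ _; last rewrite subr0.
    by lra.
  by move: zC; move: `|z%:~R : R| => t zC; lra.
have [PN|nPN] := pselect (P (2 * N)%N).
  have [x [z [W [g z0]]]] := PN; have z0' : 0 <= z%:~R :> R by rewrite ler0z.
  have bE : beta (2 * N)%N = r * N%:R by rewrite /beta natrM; ring.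
  apply: (single _ _ _ _ g); rewrite bE; first by apply: mulr_ge0 => //; apply: mulr_ge0; exact: ltW.
  by rewrite (ger0_norm z0').
have [P0|nP0] := pselect (P 0%N); last first.
  have [x [z [W [g z0]]]] := nP 0%N isT nP0; have z0' : z%:~R < 0 :> R by rewrite ltrz0.
  have bE : beta 0%N = - (r * N%:R) by rewrite /beta; ring.
  apply: (single _ _ _ _ g); rewrite bE; last by rewrite (ltr0_norm z0') mulNr mulrN.
  by rewrite mulNr oppr_ge0; apply: mulr_ge0_le0; [apply: mulr_ge0; exact: ltW | exact: ltW].
(* Discrete intermediate value: a class with nonnegative centre at [i], and only negative centres at
   [i.+1]. *)
have [i [iN Pi nPi]] : exists i, [/\ (i < 2 * N)%N, P i & ~ P i.+1].
  apply: contrapT => H; apply: nPN.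
  have : forall j, (j <= 2 * N)%N -> P j; last exact.
  elim=> [//|j ih] jN; apply: contrapT => h; apply: H; exists j; split => //; exact: ih (ltnW jN).
have [x1 [z1 [W1 [[b1 s1 c1 p1 l1] z10]]]] := Pi.
have [x2 [z2 [W2 [[b2 s2 c2 p2 l2] z20]]]] := nP i.+1 iN nPi.
(* Class centres are integers, so |z2| copies of the first class and z1 copies of the
   second have total V exactly 0. *)
pose k1 := `|z2|%N; pose k2 := `|z1|%N.
have k1E : k1%:R = - z2%:~R :> R by rewrite /k1 natr_absz ltr0_norm// rmorphN.
have k2E : k2%:R = z1%:~R :> R by rewrite /k2 natr_absz ger0_norm.
have k1p : (0 < k1)%N by rewrite absz_gt0 lt_eqF.
have kk : 1 <= k1%:R + k2%:R :> R by rewrite -natrD ler1n addn_gt0 k1p.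
have B := block_cat (block_pow k1 b1) (block_pow k2 b2).
have vE : k1%:R * z1%:~R + k2%:R * z2%:~R = 0 :> R by rewrite k1E k2E; ring.
rewrite vE in B.
exists (k1 * N + k2 * N)%N, (k1%:R * x1 + k2%:R * x2), (cat_blocks (pow_blocks W1 k1) (pow_blocks W2 k2)).
have NE : (k1 * N + k2 * N)%:R = (k1%:R + k2%:R) * N%:R :> R by rewrite -mulnDl natrM natrD.
split.
- by apply: leq_trans nN0 _; rewrite -mulnDl leq_pmull// addn_gt0 k1p.
- have main : k1%:R * (1 + K) + K + (k2%:R * (1 + K) + K) + K <= e * (k1 * N + k2 * N)%:R.
    rewrite NE mulrCA; apply: le_trans (_ : (k1%:R + k2%:R) * (Ce + 1 + 4 * K) <= _).
      have : 3 * K <= (k1%:R + k2%:R) * (3 * K) by rewrite ler_peMl// mulr_ge0.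
      have : 0 <= (k1%:R + k2%:R) * Ce by rewrite mulr_ge0// addr_ge0.
      rewrite !mulrDr !mulrDl; lra.
    by rewrite ler_pM2l//; apply: lt_le_trans kk.
  apply: (block_weaken B main); rewrite subrr normr0 add0r; exact: main.
- by rewrite size_cat_blocks !size_pow_blocks muln_gt0 !expn_gt0 s1 s2.
rewrite size_cat_blocks natrM lnM ?posrE ?ltr0n ?size_pow_blocks ?expn_gt0 ?s1 ?s2//.
rewrite -!size_pow_blocks !ln_size_pow// NE.
have bS : beta i.+1 = beta i + r by rewrite /beta -natr1; ring.
rewrite bS in l2.
have z2N : - z2%:~R <= C%:R * N%:R :> R by apply: le_trans c2; rewrite -normrN ler_norm.
(* Moving the second class from [beta i.+1] to [beta i] costs at most [r C N]; afterwards the terms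
   in [beta i] cancel in the combination. *)
have l2' : D * x2 + beta i * z2%:~R - (C1 + 2 + C%:R) * r * N%:R <= ln (size W2)%:R.
  have : r * (- z2%:~R) <= r * (C%:R * N%:R) by rewrite ler_pM2l.
  lra.
have l1' : D * x1 + beta i * z1%:~R - (C1 + 2 + C%:R) * r * N%:R <= ln (size W1)%:R.
  have : 0 <= r * (C%:R * N%:R) by rewrite mulr_ge0 ?(ltW r0)// mulr_ge0.
  lra.
have K1 : k1%:R * (D * x1 + beta i * z1%:~R - (C1 + 2 + C%:R) * r * N%:R) <= k1%:R * ln (size W1)%:R.
  by rewrite ler_wpM2l.
have K2 : k2%:R * (D * x2 + beta i * z2%:~R - (C1 + 2 + C%:R) * r * N%:R) <= k2%:R * ln (size W2)%:R.
  by rewrite ler_wpM2l.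
apply: le_trans (lerD K1 K2).
have -> : k1%:R * (D * x1 + beta i * z1%:~R - (C1 + 2 + C%:R) * r * N%:R) +
  k2%:R * (D * x2 + beta i * z2%:~R - (C1 + 2 + C%:R) * r * N%:R) =
  D * (k1%:R * x1 + k2%:R * x2) + beta i * (k1%:R * z1%:~R + k2%:R * z2%:~R)
   - (k1%:R + k2%:R) * ((C1 + 2 + C%:R) * r * N%:R) by ring.
rewrite vE mulr0 addr0 lerD2l lerN2 [leRHS]mulrCA ler_wpM2l ?addr_ge0//.
by rewrite ler_pM2r// -rE mulrC ler_pM2l// lerDl.
Qed.

End Partition.

(** * The pointwise Hoelder exponent *)

Section HoelderExponent.
Context {R : realType}.
Implicit Types (L : set R) (T : R -> R) (x a : R).

Lemma hoelder_limsupP L T x a :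
  (limf_esup (fun y => (`|T y - T x| / `|y - x| `^ a)%:E) (within L x^') < +oo)%E <->
  exists M r, 0 < r /\ forall y, L y -> 0 < `|y - x| -> `|y - x| < r -> `|T y - T x| <= M * `|y - x| `^ a.
Proof.
split.
  move=> /ereal_inf_lt[_ [V GV <-] h].
  have [M HM] : exists M : R, forall y, V y -> `|T y - T x| / `|y - x| `^ a <= M.
    move: h; case E : (ereal_sup _) => [m| |]//= _.
      exists m => y Vy; rewrite -lee_fin -E; apply: ereal_sup_ubound; by exists y.
    exists 0 => y Vy; have : ((`|T y - T x| / `|y - x| `^ a)%:E <= -oo)%E; last by rewrite leNgt ltNyr.
    by rewrite -E; apply: ereal_sup_ubound; exists y.
  move: GV => /nbhs_ballP[r /= r0 hr]; exists M, r; split => // y Ly yx yr.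
  rewrite -ler_pdivrMr ?powR_gt0//; apply: HM; apply: (hr y) => //.
    by rewrite /ball/= distrC.
  by apply/eqP => E; rewrite E subrr normr0 ltxx in yx.
move=> [M [r [r0 H]]]; apply: le_lt_trans (_ : (M%:E < +oo)%E); last exact: ltry.
apply: limf_esup_le; apply/nbhs_ballP; exists r => //= y; rewrite /ball/= distrC => yr /= yx Ly.
have p : 0 < `|y - x| by rewrite normr_gt0 subr_eq0.
by rewrite lee_fin ler_pdivrMr ?powR_gt0//; exact: H.
Qed.

Lemma hoelder_exponent_eq L T x (al : R) : 0 < al ->
  (forall a, 0 < a -> a < al ->
    exists M r, 0 < r /\ forall y, L y -> 0 < `|y - x| -> `|y - x| < r -> `|T y - T x| <= M * `|y - x| `^ a) ->
  (forall a, al < a -> ~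
    exists M r, 0 < r /\ forall y, L y -> 0 < `|y - x| -> `|y - x| < r -> `|T y - T x| <= M * `|y - x| `^ a) ->
  hoelder_exponent L T x = al%:E.
Proof.
move=> al0 h1 h2; apply/eqP; rewrite eq_le; apply/andP; split.
  apply: ge_ereal_sup => _ [a /= [a0 /hoelder_limsupP ha] <-].
  by rewrite lee_fin leNgt; apply/negP => /h2; apply.
apply/lee_subgt0Pr => e e0.
have [ae|ae] := leP al e.
  apply: le_trans (_ : ((al / 2)%:E <= _)%E); first by rewrite -EFinB lee_fin; lra.
  apply: ereal_sup_ubound; exists (al / 2) => //=; split; first by rewrite divr_gt0.
  by apply/hoelder_limsupP/h1; lra.
apply: ereal_sup_ubound; exists (al - e) => //=; split; first by rewrite subr_gt0.
by apply/hoelder_limsupP/h1; lra.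
Qed.

Lemma hoelder_exponent_lt L T x (al a : R) : hoelder_exponent L T x = al%:E -> a < al ->
  exists a' M r, [/\ a < a', 0 < r & forall y, L y -> 0 < `|y - x| -> `|y - x| < r ->
    `|T y - T x| <= M * `|y - x| `^ a'].
Proof.
move=> E aal; have : (a%:E < hoelder_exponent L T x)%E by rewrite E lte_fin.
move=> /ereal_sup_gt[_ [a' /= [a'0 /hoelder_limsupP[M [r [r0 H]]]] <-]]; rewrite lte_fin => aa'.
by exists a', M, r.
Qed.

(** If the opposite inequality held within [r] of [x], then [a] would be an admissible exponent
    above [al]. *)
Lemma hoelder_exponent_gt L T x (al a M r : R) : hoelder_exponent L T x = al%:E -> al < a -> 0 < a ->
  0 < r -> exists y, [/\ L y, 0 < `|y - x|, `|y - x| < r & M * `|y - x| `^ a < `|T y - T x|].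
Proof.
move=> E aal a0 r0; apply: contrapT => H.
have : (a%:E <= hoelder_exponent L T x)%E.
  apply: ereal_sup_ubound; exists a => //=; split => //; apply/hoelder_limsupP.
  exists M, r; split => // y Ly y0 yr; rewrite leNgt; apply/negP => h; apply: H.
  by exists y.
by rewrite E lee_fin leNgt aal.
Qed.

End HoelderExponent.

Section HoelderAtCodes.
Context {R : realType} {s : nat} (f g : expanding_map R s.+1).
Hypothesis full : range (coding g) = `[0, 1]%classic.
Implicit Types (om nu : nat -> 'I_s.+1).

Lemma word_map01_lt w : word_map g w 0 < word_map g w 1.
Proof. by have := len_gt0 g w; rewrite /len subr_gt0. Qed.

Lemma coding_min om n : (forall i, (n <= i)%N -> om i = ord0) -> coding g om = word_map g (mkseq om n) 0.
Proof.
move=> h; apply: coding_uniq => m.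
have <- : word_map g (mkseq om (n + m)) 0 = word_map g (mkseq om n) 0.
  by apply: word_map_min => //; [exact: leq_addr | move=> i /andP[/h]].
have [a b] := cylinder_mkseq g om (leq_addl n m); rewrite a /=.
by apply: le_trans b; exact: ltW (word_map01_lt _).
Qed.

Lemma coding_max om n : (forall i, (n <= i)%N -> om i = ord_max) -> coding g om = word_map g (mkseq om n) 1.
Proof.
move=> h; apply: coding_uniq => m.
have <- : word_map g (mkseq om (n + m)) 1 = word_map g (mkseq om n) 1.
  by apply: word_map_max => //; [exact: leq_addr | move=> i /andP[/h]].
have [a b] := cylinder_mkseq g om (leq_addl n m); rewrite b andbT.
by apply: le_trans a _; exact: ltW (word_map01_lt _).
Qed.

(** Both ends of a g-cylinder are coded, by words continued with first or with last letters only;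
    the farther end is at least half the length away. *)
Lemma cylinder_half_osc om n : exists nu, mkseq nu n = mkseq om n /\
  len g (mkseq om n) <= 2 * `|coding g nu - coding g om|.
Proof.
pose nu1 k := if (k < n)%N then om k else ord0.
pose nu2 k := if (k < n)%N then om k else ord_max.
have E1 : mkseq nu1 n = mkseq om n.
  by apply/eq_in_map => k; rewrite mem_iota add0n /= /nu1 => ->.
have E2 : mkseq nu2 n = mkseq om n.
  by apply/eq_in_map => k; rewrite mem_iota add0n /= /nu2 => ->.
have c1 : coding g nu1 = word_map g (mkseq om n) 0.
  by rewrite -E1; apply: coding_min => i; rewrite /nu1 ltnNge => ->.
have c2 : coding g nu2 = word_map g (mkseq om n) 1.
  by rewrite -E2; apply: coding_max => i; rewrite /nu2 ltnNge => ->.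
have /andP[a b] := coding_in g om n.
rewrite -c1 in a; rewrite -c2 in b.
have lE : len g (mkseq om n) = coding g nu2 - coding g nu1 by rewrite c1 c2.
have [h|h] := leP (coding g nu2 - coding g om) (coding g om - coding g nu1).
  by exists nu1; split => //; rewrite lE distrC ger0_norm ?subr_ge0//; lra.
by exists nu2; split => //; rewrite lE ger0_norm ?subr_ge0//; lra.
Qed.

(** The second hypothesis puts both markers into a window of length [o(n)] after each [n]. So |x -
    y| is at least the length of the f-cylinder of the common prefix up to a factor [exp(-o(n))],
    while the images differ by at most the g-length, which the first hypothesis controls. Exponents
    above [al] fail by [cylinder_half_osc]. *)
Lemma hoelder_exponent_coding om (al : R) : 0 < al ->
  (forall d : R, 0 < d -> exists n0, forall n, (n0 <= n)%N ->
     `|lam g (mkseq om n) - al * lam f (mkseq om n)| <= d * n%:R) ->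
  (forall d : R, 0 < d -> exists n0, forall n, (n0 <= n)%N -> exists i1 i2 p,
     [/\ (n <= i1 < p)%N, (n <= i2 < p)%N, om i1 != ord_max, om i2 != ord0 & p%:R <= n%:R + 1 + d * n%:R]) ->
  hoelder_exponent (repeller f) (conjugacy f g) (coding f om) = al%:E.
Proof.
move=> al0 reg mark.
have [c [C [c0 cC bd]]] := lam_bounds f.
have [c1 [c10 hc1]] := len_rcons f; have [K [K0 hK]] := lam_cat f.
have C0 := lt_le_trans c0 cC.
apply: hoelder_exponent_eq => //.
  move=> a a0 aal; exists 1.
  (* The errors [d j] from [reg] and [a C d j] from the marker window then use up half of the gain
     [(al - a) c j]; the bounded losses, collected in [E], are covered by the other half. *)
  pose d := (al - a) * c / (2 * (1 + a * C)).
  have aC : 0 < 1 + a * C by rewrite ltr_pwDl// mulr_ge0// ltW.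
  have d0 : 0 < d by rewrite divr_gt0 ?mulr_gt0// subr_gt0.
  have dE : d * (1 + a * C) = (al - a) * c / 2 by rewrite /d; field; rewrite gt_eqF.
  have [n1 H1] := reg d d0; have [n2 H2] := mark d d0.
  pose E := C * (2 + d) + K - ln c1.
  pose n3 := (Num.truncn (2 * a * E / ((al - a) * c))).+1.
  pose n0 := maxn (maxn n1 n2) n3.
  have m1 : (n1 <= n0)%N by rewrite !leq_max leqnn.
  have m2 : (n2 <= n0)%N by rewrite !leq_max leqnn orbT.
  have m3 : (n3 <= n0)%N by rewrite !leq_max leqnn orbT.
  have [i1 [i2 [p [b1 b2 o1 o2 _]]]] := H2 n0 m2.
  (* A point of the repeller closer than this has a code agreeing with [om] on the first [n0]
     letters. *)
  exists (c1 * len f (mkseq om p)); split; first by rewrite mulr_gt0 ?len_gt0.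
  move=> _ [nu _ <-]; rewrite !conjugacyE// mul1r => y0 yr.
  have E0 : mkseq om n0 = mkseq nu n0.
    apply/eqP/negPn/negP => h; have := marked_separation hc1 c10 h b1 b2 o1 o2.
    by rewrite distrC leNgt yr.
  have [m Em] : exists m, mkseq om m != mkseq nu m.
    apply: contrapT => H; suff omnu : om = nu by rewrite omnu subrr normr0 ltxx in y0.
    apply/funext => k; have : mkseq om k.+1 = mkseq nu k.+1.
      by apply/eqP/negPn/negP => h; apply: H; exists k.+1.
    by move/(congr1 (nth ord0 ^~ k)); rewrite !nth_mkseq.
  have [j [_ Ej dj]] := mkseq_first_diff Em.
  have jn0 : (n0 <= j)%N.
    rewrite leqNgt; apply/negP => jn; move/(congr1 (nth ord0 ^~ j)): E0.
    by rewrite !nth_mkseq// => h; rewrite h eqxx in dj.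
  have [k1 [k2 [q [e1 e2 u1 u2 hq]]]] := H2 j.+1 (leq_trans m2 (leqW jn0)).
  have dj1 : mkseq om j.+1 != mkseq nu j.+1.
    by apply/eqP => /(congr1 (nth ord0 ^~ j)); rewrite !nth_mkseq// => h; rewrite h eqxx in dj.
  have sep := marked_separation hc1 c10 dj1 e1 e2 u1 u2.
  have jq : (j <= q)%N.
    by case/andP: e1 => h1 h2; exact: leq_trans (leqnSn j) (leq_trans h1 (ltnW h2)).
  have oscg := coding_dist_le g Ej.
  rewrite distrC; apply: le_trans oscg _.
  have l0 : 0 < c1 * len f (mkseq om q) by rewrite mulr_gt0 ?len_gt0.
  apply: le_trans (_ : (c1 * len f (mkseq om q)) `^ a <= _); last first.
    by rewrite distrC ge0_ler_powR ?nnegrE// ltW.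
  rewrite -(expR_lam g) /powR (gt_eqF l0) ler_expR lnM ?posrE ?len_gt0//.
  have -> : ln (len f (mkseq om q)) = - lam f (mkseq om q) by rewrite opprK.
  have Aq : lam f (mkseq om q) <= lam f (mkseq om j) + C * (q%:R - j%:R) + K.
    rewrite -natrB// -{1}(subnKC jq) mkseq_cat.
    set w := mkseq (fun k => om (j + k)%N) _; have := hK (mkseq om j) w; have /andP[_] := bd w.
    rewrite size_mkseq ler_norml => h1 /andP[_ h2]; lra.
  have /andP[Aj _] := bd (mkseq om j); rewrite size_mkseq in Aj.
  have := H1 j (leq_trans m1 jn0); rewrite ler_norml => /andP[hB _].
  have jE : 2 * a * E <= (al - a) * c * j%:R.
    rewrite [leRHS]mulrC -ler_pdivrMr ?mulr_gt0 ?subr_gt0//; apply: le_trans (ltW (truncnS_gt _)) _.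
    by rewrite ler_nat (leq_trans m3 jn0).
  have qj : C * (q%:R - j%:R) <= C * (2 + d + d * j%:R).
    rewrite ler_pM2l//; move: hq; rewrite -natr1; lra.
  have q1 : a * lam f (mkseq om q) <= a * (lam f (mkseq om j) + C * (2 + d + d * j%:R) + K).
    by rewrite ler_pM2l//; lra.
  have q2 : (al - a) * (c * j%:R) <= (al - a) * lam f (mkseq om j) by rewrite ler_pM2l// subr_gt0.
  have q3 : d * (1 + a * C) * j%:R = (al - a) * c / 2 * j%:R by rewrite dE.
  move: jE; rewrite /E => jE.
  clear - q1 q2 q3 jE hB; lra.
move=> a ala [M [r [r0 H]]].
(* A Hoelder bound with exponent [a] would give [(a - al) * lam f <= Q + d n], whereas the left side
   is at least [2 d n] and [Q < d n]. *)
pose d := (a - al) * c / 2.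
have d0 : 0 < d by rewrite divr_gt0// mulr_gt0// subr_gt0.
have [n1 H1] := reg d d0; have [n2 H2] := len_small f r0.
pose Q := ln (2 * `|M| + 1).
pose n3 := (Num.truncn (Q / d)).+1.
pose n := maxn (maxn n1 n2) n3.
have m1 : (n1 <= n)%N by rewrite !leq_max leqnn.
have m2 : (n2 <= n)%N by rewrite !leq_max leqnn orbT.
have m3 : (n3 <= n)%N by rewrite !leq_max leqnn orbT.
have [nu [Enu osc]] := cylinder_half_osc om n.
have lg := len_gt0 g (mkseq om n); have lf := len_gt0 f (mkseq om n).
have dle : `|coding f nu - coding f om| <= len f (mkseq om n).
  by rewrite -Enu; exact: coding_dist_le.
have dpos : 0 < `|coding f nu - coding f om|.
  rewrite normr_gt0 subr_eq0; apply/eqP => h; move: osc; rewrite (coding_eq full h) subrr normr0 mulr0.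
  by rewrite leNgt lg.
have dr : `|coding f nu - coding f om| < r.
  by apply: le_lt_trans dle _; apply: H2; rewrite size_mkseq.
have := H (coding f nu) (ex_intro2 _ _ nu I erefl) dpos dr; rewrite !conjugacyE// => h.
have a0 : 0 < a := lt_trans al0 ala.
have h2 : len g (mkseq om n) <= (2 * `|M| + 1) * len f (mkseq om n) `^ a.
  apply: le_trans osc _; apply: le_trans (_ : 2 * (`|M| * len f (mkseq om n) `^ a) <= _).
    rewrite ler_pM2l//; apply: le_trans h _.
    apply: le_trans (_ : `|M| * `|coding f nu - coding f om| `^ a <= _).
      by rewrite ler_wpM2r ?powR_ge0// ler_norm.
    by rewrite ler_wpM2l// ge0_ler_powR ?nnegrE// ltW.
  by rewrite mulrA ler_wpM2r ?powR_ge0// lerDl.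
have M0 : 0 < 2 * `|M| + 1 by rewrite ltr_wpDl// mulr_ge0.
have : ln (len g (mkseq om n)) <= Q + a * ln (len f (mkseq om n)).
  rewrite /Q -ln_powR -lnM ?posrE ?powR_gt0// ler_ln ?posrE ?mulr_gt0 ?powR_gt0//.
have := H1 n m1; rewrite ler_norml => /andP[_].
rewrite -[ln (len g _)]opprK -[ln (len f _)]opprK -/(lam g _) -/(lam f _).
have /andP[An _] := bd (mkseq om n); rewrite size_mkseq in An.
have q2 : (a - al) * (c * n%:R) <= (a - al) * lam f (mkseq om n) by rewrite ler_pM2l// subr_gt0.
have : Q < d * n%:R.
  rewrite mulrC -ltr_pdivrMr//; apply: lt_le_trans (truncnS_gt _) _.
  by rewrite ler_nat.
have q3 : d * n%:R = (a - al) * c / 2 * n%:R by [].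
rewrite q3; clear - q2; lra.
Qed.

End HoelderAtCodes.

(** * Moran sets *)

Section MassDistribution.
Context {R : realType}.

Lemma diam_ge (U : set R) x y : U x -> U y -> (`|x - y|%:E <= diam U)%E.
Proof. by move=> Ux Uy; apply: ereal_sup_ubound; exists (x, y). Qed.

Lemma diam_power_ge0 d (U : set R) : (0 <= diam_power d U)%E.
Proof. by rewrite /diam_power; case: ifP => // _; exact: poweR_ge0. Qed.

Lemma diam_power_ge d (U : set R) x y : 0 <= d -> U x -> U y ->
  ((`|x - y| `^ d)%:E <= diam_power d U)%E.
Proof.
move=> d0 Ux Uy; rewrite /diam_power; case: eqP => [U0|_]; first by rewrite U0 in Ux.
have h := diam_ge Ux Uy; rewrite -poweR_EFin; apply: gt0_ler_poweR => //; rewrite in_itv/= leey andbT ?lee_fin//.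
by apply: le_trans h; rewrite lee_fin.
Qed.

(* The sets of parameters z with P z in U_k cover [0, 1[ and have length at most
   M |U_k|^d, so Lebesgue measure plays the role of the mass distribution. *)
Lemma hausdorff_dim_ge (S : set R) (P : R -> R) (D : R) :
  (forall z, z \in `[0, 1[ -> S (P z)) ->
  (forall d, 0 <= d -> d < D -> exists2 M : R, 0 < M &
     forall z z', z \in `[0, 1[ -> z' \in `[0, 1[ -> `|z - z'| <= M * `|P z - P z'| `^ d) ->
  (D%:E <= hausdorff_dim S)%E.
Proof.
move=> SP HP; apply: le_ereal_inf_tmp => _ [d /= [d0 Hd] <-].
rewrite lee_fin leNgt; apply/negP => dD; have [M M0 HM] := HP d d0 dD.
have : (hausdorff_content d 1 S <= 0)%E.
  by rewrite -Hd; apply: ereal_sup_ubound; exists 1 => //=.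
(* The parameter intervals have total length at most [2 M] times the weight of the cover, hence less
   than 1/2, and cannot cover [0, 1[. *)
have e0 : (0 < ((4 * M)^-1)%:E)%E by rewrite lte_fin invr_gt0 mulr_gt0.
move=> /le_lt_trans /(_ e0) /ereal_inf_lt[_ [U [cov sm] <-]] h.
have /choice[I HI] : forall k, exists I : interval R,
    (forall z, z \in `[0, 1[ -> U k (P z) -> z \in I) /\
    ((lebesgue_measure : set R -> \bar R) [set` I] <= (2 * M)%:E * diam_power d (U k))%E.
  move=> k; have [[z [z01 Uz]]|H] := pselect (exists z, (z \in `[0, 1[) /\ U k (P z)); last first.
    exists `]0, 0[%R; split; first by move=> z z01 Uz; case: H; exists z.
    rewrite lebesgue_measure_itv/= ltxx mule_ge0 ?diam_power_ge0//.
    by rewrite lee_fin mulr_ge0// ltW.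
  case E : (diam_power d (U k)) => [r| |].
  - exists `[z - M * r, z + M * r]%R; split.
      move=> z' z'01 Uz'; have := HM z' z z'01 z01.
      have : `|P z' - P z| `^ d <= r by rewrite -lee_fin -E; exact: diam_power_ge.
      move=> h1 h2; have : `|z' - z| <= M * r by apply: le_trans h2 _; rewrite ler_pM2l.
      by rewrite in_itv/= ler_norml => /andP[h3 h4]; apply/andP; split; lra.
    rewrite lebesgue_measure_itv/= lte_fin; case: ifP => _.
      by rewrite -EFinB -EFinM lee_fin; lra.
    rewrite -EFinM lee_fin mulr_ge0 ?mulr_ge0 ?(ltW M0)//.
    by rewrite -lee_fin -E diam_power_ge0.
  - exists `]-oo, +oo[%R; split; first by move=> z' _ _; rewrite in_itv.
    by rewrite mulry gtr0_sg ?mulr_gt0// mul1e leey.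
  - by have := diam_power_ge0 d (U k); rewrite E.
have le1 : ((lebesgue_measure : set R -> \bar R) `[0%R, 1%R[%classic <=
    \sum_(0 <= k <oo) (lebesgue_measure : set R -> \bar R) [set` I k])%E.
  apply: measure_sigma_subadditive.
  - by move=> k; exact: measurable_itv.
  - exact: measurable_itv.
  - move=> z /= z01; have [k _ Uk] := cov _ (SP z z01).
    by exists k => //=; have [h1 _] := HI k; exact: h1.
have le2 : (\sum_(0 <= k <oo) (lebesgue_measure : set R -> \bar R) [set` I k] <=
    (2 * M)%:E * \sum_(0 <= k <oo) diam_power d (U k))%E.
  rewrite -nneseriesZl; last by move=> k _; exact: diam_power_ge0.
  apply: lee_nneseries => //.
  by move=> k _; have [_ h2] := HI k.
have := le_trans le1 le2; rewrite lebesgue_measure_itv/= lte_fin ltr01 oppr0 adde0.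
apply/negP; rewrite -ltNge.
apply: lt_trans (_ : (2 * M)%:E * ((4 * M)^-1)%:E < _)%E.
  by rewrite lte_pmul2l// lte_fin mulr_gt0.
rewrite -EFinM lte_fin.
have -> : 2 * M * (4 * M)^-1 = 2^-1 by field; rewrite gt_eqF.
by rewrite invf_lt1// ltr1n.
Qed.

End MassDistribution.

(** * Mixed-radix digits of points of [0, 1[ *)

Section MixedRadix.
Context {R : realType}.
Variable q : nat -> nat.
Hypothesis q0 : forall j, (0 < q j)%N.

Definition radix_prod j : nat := \prod_(i < j) q i.

Lemma radix_prod_gt0 j : (0 < radix_prod j)%N.
Proof. by apply: prodn_gt0. Qed.

(** Encodes the first [j] digits of [z] as one integer. *)
Definition radix_floor (z : R) j := Num.truncn (z * (radix_prod j)%:R).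

Definition radix_digit (z : R) j := (radix_floor z j.+1 %% q j)%N.

Lemma radix_digit_lt z j : (radix_digit z j < q j)%N.
Proof. by rewrite ltn_mod. Qed.

Lemma radix_floor_div (z : R) j : 0 <= z -> (radix_floor z j.+1 %/ q j)%N = radix_floor z j.
Proof.
move=> z0; rewrite /radix_floor /radix_prod big_ord_recr /= natrM mulrA.
set y := z * _; have y0 : 0 <= y by rewrite mulr_ge0.
have qp : (0 : R) < (q j)%:R by rewrite ltr0n.
have /andP[a b] := truncn_itv y0.
have yq0 : 0 <= y * (q j)%:R by rewrite mulr_ge0.
have /andP[a' b'] := truncn_itv yq0.
apply/eqP; rewrite eqn_leq; apply/andP; split.
  rewrite -ltnS ltn_divLR// -(ltr_nat R) natrM; apply: le_lt_trans a' _.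
  by rewrite ltr_pM2r.
rewrite leq_divRL// -ltnS -(ltr_nat R) natrM; apply: le_lt_trans b'.
by rewrite ler_pM2r.
Qed.

Lemma radix_floor_close (z z' : R) j : 0 <= z -> 0 <= z' -> radix_floor z j = radix_floor z' j ->
  `|z - z'| <= (radix_prod j)%:R^-1.
Proof.
move=> z0 z0' E; have Qp : (0 : R) < (radix_prod j)%:R by rewrite ltr0n radix_prod_gt0.
have /andP[a b] : (radix_floor z j)%:R <= z * (radix_prod j)%:R < (radix_floor z j).+1%:R.
  by apply: truncn_itv; rewrite mulr_ge0.
have /andP[a' b'] : (radix_floor z' j)%:R <= z' * (radix_prod j)%:R < (radix_floor z' j).+1%:R.
  by apply: truncn_itv; rewrite mulr_ge0.
rewrite -E in a' b'; rewrite -(ler_pM2r Qp) mulVf ?gt_eqF//.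
rewrite -[X in _ * X <= _](gtr0_norm Qp) -normrM mulrBl ler_norml.
rewrite -natr1 in b b'; apply/andP; split; lra.
Qed.

Lemma radix_first_diff (z z' : R) : z \in `[0, 1[ -> z' \in `[0, 1[ ->
  (exists j, radix_floor z j = radix_floor z' j /\ radix_digit z j <> radix_digit z' j) \/
  (forall j, radix_floor z j = radix_floor z' j).
Proof.
rewrite !in_itv/= => /andP[z0 z1] /andP[z0' z1'].
have [H|H] := pselect (exists j, radix_floor z j = radix_floor z' j /\ radix_digit z j <> radix_digit z' j).
  by left.
right; elim=> [|j ih].
  rewrite /radix_floor /radix_prod big_ord0 !mulr1.
  have t0 (x : R) : x < 1 -> Num.truncn x = 0%N by move=> x1; apply/truncn0Pn; rewrite -ltNge.
  by rewrite !t0.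
rewrite (divn_eq (radix_floor z j.+1) (q j)) (divn_eq (radix_floor z' j.+1) (q j)).
rewrite !radix_floor_div// ih; congr (_ + _)%N.
by apply: contrapT => h; apply: H; exists j.
Qed.

End MixedRadix.

(** * Codes built from blocks, and their dimension *)

Section Moran.
Context {R : realType} {s : nat} (f g : expanding_map R s.+2).
Hypothesis full : range (coding g) = `[0, 1]%classic.
Variables (al K C c D : R).
Hypothesis al0 : 0 < al.
Hypothesis K0 : 0 <= K.
Hypothesis C0 : 0 <= C.
Hypothesis c0 : 0 < c.
Let V w : R := lam g w - al * lam f w.
Hypothesis hX : forall u v, `|lam f (u ++ v) - (lam f u + lam f v)| <= K.
Hypothesis hV : forall u v, `|V (u ++ v) - (V u + V v)| <= K.
Hypothesis bX : forall w, c * (size w)%:R <= lam f w <= C * (size w)%:R.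
Hypothesis bV : forall w, `|V w| <= C * (size w)%:R.

Variables (U : nat -> seq (seq 'I_s.+2)) (l : nat -> nat) (x er : nat -> R).
Hypothesis blockU : forall j, block (lam f) V (l j) (x j) 0 (er j) (U j).
Hypothesis sizeU : forall j, (0 < size (U j))%N.
Hypothesis entropyU : forall j, D * x j - er j <= ln (size (U j))%:R.
Hypothesis K_le : forall j, K <= er j.
Hypothesis markU : forall j w, w \in U j -> exists u, w = u ++ [:: ord0; ord_max].

(** Starting position of block [j], a word of length [l j] chosen in [U j]; [Er] and [X] add up the
    tolerances and the centres of the earlier blocks. *)
Definition pos j : nat := \sum_(i < j) l i.
Let Er j : R := \sum_(i < j) er i.
Let X j : R := \sum_(i < j) x i.

Hypothesis er_small : forall d : R, 0 < d -> exists j0, forall j, (j0 <= j)%N -> Er j <= d * (pos j)%:R.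
Hypothesis l_small : forall d : R, 0 < d -> exists j0, forall j, (j0 <= j)%N -> (l j)%:R <= d * (pos j)%:R.

Lemma posS j : pos j.+1 = (pos j + l j)%N.
Proof. by rewrite /pos big_ord_recr. Qed.

Let ErS j : Er j.+1 = Er j + er j.
Proof. by rewrite /Er big_ord_recr. Qed.

Let XS j : X j.+1 = X j + x j.
Proof. by rewrite /X big_ord_recr. Qed.

Let er0 j : 0 <= er j. Proof. exact: le_trans K0 (K_le j). Qed.

Let Er0 j : 0 <= Er j. Proof. by apply: sumr_ge0 => i _; exact: er0. Qed.

Let K_le_Er j : (0 < j)%N -> K <= Er j.
Proof. by case: j => // j _; rewrite ErS; apply: le_trans (K_le j) _; rewrite lerDr. Qed.

Fixpoint moran_prefix (d : nat -> nat) j : seq 'I_s.+2 :=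
  if j is i.+1 then moran_prefix d i ++ nth [::] (U i) (d i) else [::].

(** The first [k.+1] blocks reach beyond position [k] since no block is empty. *)
Definition moran_code d : nat -> 'I_s.+2 := fun k => nth ord0 (moran_prefix d k.+1) k.

Definition valid (d : nat -> nat) := forall j, (d j < size (U j))%N.

Lemma l_gt1 j : (2 <= l j)%N.
Proof.
have h : nth [::] (U j) 0 \in U j by rewrite mem_nth.
have [_ /(_ _ h) <- _] := blockU j; have [u ->] := markU h.
by rewrite size_cat leq_addl.
Qed.

Lemma leq_pos i j : (i <= j)%N -> (pos i <= pos j)%N.
Proof.
by move=> /subnKC <-; elim: (j - i)%N => [|k ih]; rewrite ?addn0// addnS posS (leq_trans ih) ?leq_addr.
Qed.

Lemma pos_ge j : (j <= pos j)%N.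
Proof.
elim: j => [//|j ih]; rewrite posS -addn1 leq_add//; exact: ltnW (l_gt1 j).
Qed.

Lemma pos_ex n : exists j, (pos j <= n < pos j.+1)%N.
Proof.
elim: n => [|n [j /andP[h1 h2]]].
  by exists 0%N; rewrite posS {1}/pos big_ord0 /= addn_gt0 (ltnW (l_gt1 0)) orbT.
move: h2; rewrite leq_eqVlt => /orP[/eqP E|h]; last by exists j; rewrite leqW.
by exists j.+1; rewrite E leqnn /= [pos j.+2]posS -{1}(addn0 (pos _)) ltn_add2l (ltnW (l_gt1 _)).
Qed.

Lemma pos_lt_le j0 j n : (pos j0 <= n)%N -> (n < pos j.+1)%N -> (j0 <= j)%N.
Proof.
move=> h1 h2; rewrite leqNgt; apply/negP => h.
by have := leq_trans h2 (leq_trans (leq_pos h) h1); rewrite ltnn.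
Qed.

Section Code.
Variable d : nat -> nat.
Hypothesis vd : valid d.

Lemma moran_block j : nth [::] (U j) (d j) \in U j.
Proof. by rewrite mem_nth. Qed.

Lemma size_moran_prefix j : size (moran_prefix d j) = pos j.
Proof.
elim: j => [|j ih]; first by rewrite /pos big_ord0.
by rewrite /= size_cat ih posS; have [_ -> //] := blockU j; exact: moran_block.
Qed.

Lemma nth_moran_prefix i j k : (i <= j)%N -> (k < pos i)%N ->
  nth ord0 (moran_prefix d j) k = nth ord0 (moran_prefix d i) k.
Proof.
move=> ij ki; rewrite -(subnKC ij); elim: (j - i)%N => [|n ih]; first by rewrite addn0.
by rewrite addnS /= nth_cat size_moran_prefix (leq_trans ki) ?leq_pos ?leq_addr.
Qed.

Lemma mkseq_moran j : mkseq (moran_code d) (pos j) = moran_prefix d j.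
Proof.
apply: (@eq_from_nth _ ord0); rewrite size_mkseq ?size_moran_prefix// => k kj.
rewrite nth_mkseq// /moran_code; case/orP: (leq_total k.+1 j) => h.
  by rewrite (nth_moran_prefix h)//; exact: pos_ge.
by rewrite (nth_moran_prefix h).
Qed.

(** Each block adds its tolerance [er j] and one concatenation defect [K <= er j], whence the factor
    2. *)
Lemma lam_moran_prefix j : `|lam f (moran_prefix d j) - X j| <= 2 * Er j + K.
Proof.
elim: j => [|j ih].
  rewrite /= /X /Er !big_ord0 subr0 mulr0 add0r.
  by have := hX [::] [::]; rewrite /= opprD addNKr normrN.
have [_ _ /(_ _ (moran_block j)) [h _]] := blockU j.
have := hX (moran_prefix d j) (nth [::] (U j) (d j)); rewrite /= XS ErS.
have := K_le j; move: ih h; rewrite !ler_norml.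
move=> /andP[? ?] /andP[? ?] ? /andP[? ?]; apply/andP; split; lra.
Qed.

Lemma V_moran_prefix j : `|V (moran_prefix d j)| <= 2 * Er j + K.
Proof.
elim: j => [|j ih].
  rewrite /= /Er !big_ord0 mulr0 add0r.
  by have := hV [::] [::]; rewrite /= opprD addNKr normrN.
have [_ _ /(_ _ (moran_block j)) [_ h]] := blockU j.
have := hV (moran_prefix d j) (nth [::] (U j) (d j)); rewrite /= ErS.
have := K_le j; move: ih h; rewrite subr0 !ler_norml.
move=> /andP[? ?] /andP[? ?] ? /andP[? ?]; apply/andP; split; lra.
Qed.

(** The last two letters of the block; [ord0] and [ord_max] differ in an alphabet of [s.+2]
    letters. *)
Lemma moran_mark j : exists i1 i2, [/\ (pos j <= i1 < pos j.+1)%N, (pos j <= i2 < pos j.+1)%N,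
  moran_code d i1 != ord_max & moran_code d i2 != ord0].
Proof.
have [u uE] := markU (moran_block j).
have su : (size u + 2 = l j)%N.
  by have [_ /(_ _ (moran_block j)) <- _] := blockU j; rewrite uE size_cat.
have H k : (k < l j)%N -> moran_code d (pos j + k) = nth ord0 (u ++ [:: ord0; ord_max]) k.
  move=> kl; have kp : (pos j + k < pos j.+1)%N by rewrite posS ltn_add2l.
  have := mkseq_moran j.+1 => /(congr1 (nth ord0 ^~ (pos j + k)%N)).
  rewrite nth_mkseq// => ->.
  by rewrite /= nth_cat size_moran_prefix ltnNge leq_addr /= addKn uE.
exists (pos j + size u)%N, (pos j + (size u).+1)%N.
have k1 : (size u < l j)%N by rewrite -su addn2 ltnS leqnSn.
have k2 : ((size u).+1 < l j)%N by rewrite -su addn2.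
rewrite !leq_addr posS !ltn_add2l k1 k2 !H//; split => //.
  by rewrite nth_cat ltnn subnn.
by rewrite nth_cat ltnNge leqnSn /= subSnn.
Qed.

Lemma moran_regular (e : R) : 0 < e -> exists n0, forall n, (n0 <= n)%N ->
  `|V (mkseq (moran_code d) n)| <= e * n%:R.
Proof.
(* Tolerances and defects amount to at most [4 * Er j], half of the budget; the unfinished block
   gets the other half. *)
move=> e0; have e8 : 0 < e / 8 by rewrite divr_gt0.
have C1 : 0 < 2 * (C + 1) by rewrite mulr_gt0// ltr_wpDl.
have eC : 0 < e / (2 * (C + 1)) by rewrite divr_gt0.
have [j1 H1] := er_small e8; have [j2 H2] := l_small eC.
exists (pos (maxn (maxn j1 j2) 1)) => n hn; have [j /andP[jn nj]] := pos_ex n.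
have := pos_lt_le hn nj; rewrite !geq_max => /andP[/andP[g1 g2] g3].
rewrite -(subnKC jn) mkseq_cat mkseq_moran; set w := mkseq _ (n - pos j).
have sw : (size w <= l j)%N by rewrite size_mkseq leq_subLR -posS ltnW.
have swR : C * (size w)%:R <= C * (l j)%:R by rewrite ler_wpM2l// ler_nat.
have lE : C * (l j)%:R <= e / 2 * (pos j)%:R.
  apply: le_trans (_ : (C + 1) * (l j)%:R <= _); first by rewrite ler_wpM2r// lerDl.
  apply: le_trans (_ : (C + 1) * (e / (2 * (C + 1)) * (pos j)%:R) <= _).
    by rewrite ler_pM2l ?H2// ltr_wpDl.
  rewrite le_eqVlt; apply/orP; left; apply/eqP; field.
  by rewrite gt_eqF// ltr_wpDl.
have Kj := K_le_Er g3; have Ej := H1 j g1.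
have pn : e * (pos j)%:R <= e * n%:R by rewrite ler_pM2l// ler_nat.
rewrite subnKC//.
have := hV (moran_prefix d j) w; have := V_moran_prefix j; have := bV w.
rewrite !ler_norml => /andP[? ?] /andP[? ?] /andP[? ?]; apply/andP; split; lra.
Qed.

Lemma moran_marked (e : R) : 0 < e -> exists n0, forall n, (n0 <= n)%N -> exists i1 i2 p,
  [/\ (n <= i1 < p)%N, (n <= i2 < p)%N, moran_code d i1 != ord_max, moran_code d i2 != ord0 &
      p%:R <= n%:R + 1 + e * n%:R].
Proof.
move=> e0; pose e1 := Num.min 1 (e / 3).
have e10 : 0 < e1 by rewrite lt_min ltr01 divr_gt0.
have e11 : e1 <= 1 by rewrite ge_min lexx.
have e13 : e1 <= e / 3 by rewrite ge_min lexx orbT.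
have [j0 H] := l_small e10.
exists (pos j0) => n hn; have [j /andP[jn nj]] := pos_ex n.
have jj := pos_lt_le hn nj.
(* Position [n] may be past the markers of its own block [j], so those of the next block are
   used. *)
have [i1 [i2 [/andP[a1 b1] /andP[a2 b2] o1 o2]]] := moran_mark j.+1.
exists i1, i2, (pos j.+2); split => //.
- by rewrite b1 (leq_trans (ltnW nj)).
- by rewrite b2 (leq_trans (ltnW nj)).
have h1 := H j jj; have h2 := H j.+1 (leqW jj).
rewrite 2!posS !natrD; rewrite posS natrD in h2.
have jnR : (pos j)%:R <= n%:R :> R by rewrite ler_nat.
have p1 : e1 * (pos j)%:R <= e1 * n%:R by rewrite ler_pM2l.
have p2 : e1 * (l j)%:R <= 1 * (l j)%:R by rewrite ler_wpM2r.
have p3 : e1 * n%:R <= e / 3 * n%:R by rewrite ler_wpM2r.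
rewrite mulrDr in h2; lra.
Qed.

Lemma hoelder_exponent_moran :
  hoelder_exponent (repeller f) (conjugacy f g) (coding f (moran_code d)) = al%:E.
Proof.
apply: hoelder_exponent_coding => //; first exact: moran_regular.
exact: moran_marked.
Qed.

End Code.

Let q j := size (U j).

Lemma ln_radix_prod j : D * X j - Er j <= ln (radix_prod q j)%:R.
Proof.
elim: j => [|j ih]; first by rewrite /X /Er /radix_prod !big_ord0 ln1; lra.
have r0 : (0 < radix_prod q j)%N by exact: radix_prod_gt0.
have qp : (0 < q j)%N := sizeU j.
rewrite /radix_prod big_ord_recr /= natrM lnM ?posrE ?ltr0n// XS ErS.
by have := entropyU j; rewrite -/(q j) -/(radix_prod q j); lra.
Qed.

(** Codes that first differ in block [i] are separated by the markers of block [i.+1], so the mass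
    of a prefix of [i] blocks faces the length after [i.+2] blocks. Two blocks are negligible
    against [pos i], and [D - d] pays for them. *)
Lemma radix_prod_lower (d : R) : 0 < d -> d < D -> exists T : R, forall i dg, valid dg ->
  d * lam f (moran_prefix dg i.+2) <= ln (radix_prod q i)%:R + T.
Proof.
move=> d0 dD; have Dd : 0 < D - d by rewrite subr_gt0.
pose tau i := d * (X i.+2 + 2 * Er i.+2 + K) - (D * X i - Er i).
suff [i0 Hi0] : exists i0, forall i, (i0 <= i)%N -> tau i <= 0.
  have T0 : 0 <= \sum_(i < i0) `|tau i| by exact: sumr_ge0.
  exists (\sum_(i < i0) `|tau i|) => i dg vdg.
  have := ln_radix_prod i => h1.
  have h2 : tau i <= \sum_(i < i0) `|tau i|.
    have [h|h] := leqP i0 i; first exact: le_trans (Hi0 i h) T0.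
    rewrite (bigD1 (Ordinal h))//=; apply: le_trans (ler_norm _) _; rewrite lerDl; exact: sumr_ge0.
  have : d * lam f (moran_prefix dg i.+2) <= d * (X i.+2 + 2 * Er i.+2 + K).
    rewrite ler_pM2l//; have := lam_moran_prefix vdg i.+2; rewrite ler_norml => /andP[_]; lra.
  by move: h2; rewrite /tau; lra.
(* The coefficient of [e * pos i] when all errors in [tau i] are added; since [e <= 1], each extra
   block at most doubles the position. *)
pose E := d * (3 * C + 16) + 4 + 12 * (D - d).
have Ep : 0 < E.
  by rewrite /E !addr_gt0 ?mulr_gt0// ltr_wpDl// mulr_ge0.
pose e := Num.min 1 ((D - d) * c / E).
have e0 : 0 < e by rewrite lt_min ltr01 divr_gt0 ?mulr_gt0.
have e1 : e <= 1 by rewrite ge_min lexx.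
have eE : e * E <= (D - d) * c by rewrite -ler_pdivlMr// ge_min lexx orbT.
have [j1 H1] := er_small e0; have [j2 H2] := l_small e0.
exists (maxn (maxn j1 j2) 1) => i; rewrite !geq_max => /andP[/andP[g1 g2] g3].
(* Some admissible choice of blocks, used to bound [x] and [X], which are the same for all
   choices. *)
have vd0 : valid (fun=> 0%N) by move=> j; exact: sizeU.
have xle j : x j <= C * (l j)%:R + er j.
  have h := moran_block vd0 j; have [_ /(_ _ h) sw /(_ _ h) [hx _]] := blockU j.
  have /andP[_] := bX (nth [::] (U j) 0); rewrite sw => h2.
  by move: hx; rewrite ler_norml => /andP[h3 _]; lra.
have Xi : c * (pos i)%:R - 3 * Er i <= X i.
  have /andP[h _] := bX (moran_prefix (fun=> 0%N) i); rewrite (size_moran_prefix vd0) in h.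
  have := lam_moran_prefix vd0 i; rewrite ler_norml => /andP[_ h2]; have := K_le_Er g3; lra.
have l1 := H2 i g2; have l2 := H2 i.+1 (leqW g2); have E2 := H1 i.+2 (leqW (leqW g1)).
have pp (n : nat) : e * n%:R <= n%:R by rewrite ler_piMl.
have l1' := le_trans l1 (pp _); have l2' := le_trans l2 (pp _).
have P1 : (pos i.+1)%:R = (pos i)%:R + (l i)%:R :> R by rewrite posS natrD.
have P2 : (pos i.+2)%:R = (pos i.+1)%:R + (l i.+1)%:R :> R by rewrite posS natrD.
have ep1 : e * (pos i.+1)%:R <= e * (2 * (pos i)%:R) by rewrite ler_pM2l//; lra.
have ep2 : e * (pos i.+2)%:R <= e * (4 * (pos i)%:R) by rewrite ler_pM2l//; lra.
have E2' : Er i.+2 <= 4 * (e * (pos i)%:R) by lra.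
have ErE : Er i.+2 = Er i + er i + er i.+1 by rewrite !ErS.
have XE : X i.+2 = X i + x i + x i.+1 by rewrite !XS.
have Ki := K_le_Er g3; have Eri := Er0 i; have x1 := xle i; have x2 := xle i.+1.
have ei := er0 i; have ei1 := er0 i.+1.
have a1 : d * (X i.+2 + 2 * Er i.+2 + K) <= d * (X i + (C * (l i)%:R + C * (l i.+1)%:R) + 4 * Er i.+2).
  by rewrite ler_pM2l//; lra.
have a2 : C * (l i)%:R + C * (l i.+1)%:R <= 3 * C * (e * (pos i)%:R).
  rewrite -mulrDr -mulrA [3 * _]mulrC -mulrA ler_wpM2l//; lra.
have a3 : d * (X i + (C * (l i)%:R + C * (l i.+1)%:R) + 4 * Er i.+2) <=
   d * (X i + 3 * C * (e * (pos i)%:R) + 16 * (e * (pos i)%:R)).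
  by rewrite ler_pM2l//; lra.
have a4 : (D - d) * (c * (pos i)%:R - 3 * Er i) <= (D - d) * X i by rewrite ler_pM2l.
have a5 : (D - d) * Er i <= (D - d) * (4 * (e * (pos i)%:R)) by rewrite ler_pM2l//; lra.
have a6 : e * E * (pos i)%:R <= (D - d) * c * (pos i)%:R by rewrite ler_wpM2r.
rewrite /tau; move: a6; rewrite /E => a6.
lra.
Qed.

Lemma moran_dim_ge : (D%:E <= hausdorff_dim [set y | repeller f y /\
  hoelder_exponent (repeller f) (conjugacy f g) y = al%:E])%E.
Proof.
have [c1 [c10 hc1]] := len_rcons f.
have qp j : (0 < q j)%N := sizeU j.
have vz (z : R) : valid (radix_digit q z) by move=> j; exact: radix_digit_lt.
apply: (@hausdorff_dim_ge _ _ (fun z => coding f (moran_code (radix_digit q z)))).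
  by move=> z z01; split; [exists (moran_code (radix_digit q z)) | apply: hoelder_exponent_moran].
(* Positive even if [d = 0], as [radix_prod_lower] requires. *)
move=> d d0 dD; pose d1 := (d + D) / 2.
have d10 : 0 < d1 by rewrite /d1; lra.
have d1D : d1 < D by rewrite /d1; lra.
have dd1 : d <= d1 by rewrite /d1; lra.
have [T HT] := radix_prod_lower d10 d1D.
exists (expR (T - d1 * ln c1)); first exact: expR_gt0.
move=> z z' z01 z'01; set P := coding f _; set P' := coding f _.
have Qp j : (0 : R) < (radix_prod q j)%:R by rewrite ltr0n radix_prod_gt0.
have z0 : 0 <= z by move: z01; rewrite in_itv/= => /andP[].
have z0' : 0 <= z' by move: z'01; rewrite in_itv/= => /andP[].
have [[j [Ej dj]]|E] := radix_first_diff qp z01 z'01.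
  have h := radix_floor_close qp z0 z0' Ej; apply: le_trans h _.
  have nE : mkseq (moran_code (radix_digit q z)) (pos j.+1) != mkseq (moran_code (radix_digit q z')) (pos j.+1).
    rewrite !mkseq_moran//= eqseq_cat ?size_moran_prefix//; apply/negP => /andP[_].
    have [uU _ _] := blockU j; rewrite nth_uniq//; first by move/eqP.
    - exact: (vz z j).
    - exact: (vz z' j).
  have [i1 [i2 [b1 b2 o1 o2]]] := moran_mark (vz z) j.+1.
  have := marked_separation hc1 c10 nE b1 b2 o1 o2; rewrite mkseq_moran// -/P -/P' => sep.
  have l0 : 0 < c1 * len f (moran_prefix (radix_digit q z) j.+2) by rewrite mulr_gt0 ?len_gt0.
  have P1 : `|P - P'| <= 1.
    have /itv01P[? ?] : P \in `[0, 1] := coding01 f _.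
    have /itv01P[? ?] : P' \in `[0, 1] := coding01 f _.
    rewrite ler_norml; apply/andP; split; lra.
  have Ppos := lt_le_trans l0 sep.
  apply: le_trans (_ : expR (T - d1 * ln c1) * `|P - P'| `^ d1 <= _); last first.
    rewrite ler_pM2l ?expR_gt0//; apply: ger_powR => //; by rewrite Ppos.
  apply: le_trans (_ : expR (T - d1 * ln c1) * (c1 * len f (moran_prefix (radix_digit q z) j.+2)) `^ d1 <= _); last first.
    by rewrite ler_pM2l ?expR_gt0// ge0_ler_powR ?nnegrE// ltW.
  rewrite /powR (gt_eqF l0) -expRD lnM ?posrE ?len_gt0//.
  rewrite -[X in X^-1](lnK (Qp j)) -expRN ler_expR.
  have := HT j _ (vz z); rewrite /lam; move: (ln (len f _)) => t; lra.
(* All digits agree. Families may be singletons, so it is [radix_prod_lower] that makes the products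
   of radices unbounded and forces [z = z']. *)
have : `|z - z'| = 0; last by move=> ->; rewrite mulr_ge0 ?expR_ge0 ?powR_ge0.
apply/eqP; rewrite -[_ == _]negbK; apply/negP => zz.
have zp : 0 < `|z - z'| by rewrite lt_neqAle eq_sym zz /=.
pose j := (Num.truncn ((T - ln `|z - z'|) / (d1 * c))).+1.
have jE : T - ln `|z - z'| < d1 * c * j%:R.
  have dc : 0 < d1 * c by apply: mulr_gt0.
  have := truncnS_gt ((T - ln `|z - z'|) / (d1 * c)).
  by rewrite ltr_pdivrMr// [ltRHS]mulrC.
have := radix_floor_close qp z0 z0' (E j).
rewrite -[X in X^-1](lnK (Qp j)) -expRN -[X in X <= _]lnK ?posrE// ler_expR.
have := HT j _ (vz z); have /andP[h _] := bX (moran_prefix (radix_digit q z) j.+2).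
rewrite (size_moran_prefix (vz z)) in h.
have hj : d1 * (c * j%:R) <= d1 * lam f (moran_prefix (radix_digit q z) j.+2).
  rewrite ler_pM2l//; apply: le_trans h; rewrite ler_pM2l// ler_nat.
  by apply: leq_trans (pos_ge _); rewrite leqW.
lra.
Qed.

End Moran.

(** * The upper bound *)

Section CoverMeasure.
Context {R : realType} {s : nat}.
Variables (S : set R) (d : R) (P : seq 'I_s -> set R) (v : seq 'I_s -> R) (G : seq 'I_s -> Prop).
Hypothesis v0 : forall w, 0 <= v w.
Hypothesis diam_v : forall w, G w -> (diam_power d (P w) <= (v w)%:E)%E.

(** A cover uses words of all lengths from [n0] on; grouping by length leaves a geometric tail. *)
Lemma partial_sum_le (M q : R) n0 l : 0 <= M -> 0 < q -> q < 1 ->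
  (forall n, (n0 <= n)%N -> \sum_(w <- words n) v w <= M * q ^+ n) ->
  uniq l -> \sum_(w <- l | (n0 <= size w)%N) v w <= M * q ^+ n0 / (1 - q).
Proof.
move=> M0 q0 q1 H ul; pose N := (\max_(w <- l) size w).+1.
have sN w : w \in l -> (size w < N)%N by move=> wl; rewrite ltnS; exact: leq_bigmax_seq.
have geo n : \sum_(k < n) M * q ^+ (n0 + k) <= M * q ^+ n0 / (1 - q).
  have q1' : 0 < 1 - q by rewrite subr_gt0.
  have E : (\sum_(k < n) M * q ^+ (n0 + k)) * (1 - q) = M * q ^+ n0 - M * q ^+ (n0 + n).
    elim: n => [|n ih]; first by rewrite big_ord0 mul0r addn0 subrr.
    by rewrite big_ord_recr /= mulrDl ih addnS exprS; ring.
  by rewrite ler_pdivlMr// E lerBlDr lerDl mulr_ge0// exprn_ge0// ltW.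
apply: le_trans (geo N).
have -> : \sum_(w <- l | (n0 <= size w)%N) v w =
    \sum_(w <- l | (n0 <= size w)%N) \sum_(k < N | (n0 + k)%N == size w) v w.
  rewrite big_seq_cond [RHS]big_seq_cond; apply: eq_bigr => w /andP[wl nw].
  have kN : (size w - n0 < N)%N by apply: leq_ltn_trans (sN _ wl); rewrite leq_subr.
  rewrite (bigD1 (Ordinal kN)) /=; last by rewrite subnKC.
  rewrite big1 ?addr0// => k /andP[/eqP E /negP]; case; apply/eqP/val_inj => /=.
  by rewrite -E addKn.
rewrite (exchange_big_dep xpredT)//=; apply: ler_sum => k _.
apply: le_trans (H (n0 + k)%N (leq_addr _ _)); rewrite -big_filter.
apply: sum_uniq_sub_le => //; first exact: filter_uniq.
  exact: uniq_words.
by move=> w; rewrite mem_filter mem_words => /andP[/andP[_ /eqP ->] _].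
Qed.

(** Borel-Cantelli argument: each point of [S] lies in [P w] for arbitrarily long [w] satisfying
    [G], and the total weight of long words is the tail of a convergent series. *)
Lemma hausdorff_measure_eq0 (M q : R) n1 : 0 <= M -> 0 < q -> q < 1 ->
  (forall n, (n1 <= n)%N -> \sum_(w <- words n) v w <= M * q ^+ n) ->
  (forall e : R, 0 < e -> exists n0, forall w, (n0 <= size w)%N -> (diam (P w) <= e%:E)%E) ->
  (forall x, S x -> forall n0, exists w, [/\ (n0 <= size w)%N, G w & P w x]) ->
  hausdorff_measure d S = 0%E.
Proof.
move=> M0 q0 q1 H sm cov.
have cont e : 0 < e -> (hausdorff_content d e S <= 0)%E.
  move=> e0; apply/lee_addgt0Pr => h h0; rewrite add0e.
  have [n2 H2] := sm e e0.
  have q1' : 0 < 1 - q by rewrite subr_gt0.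
  have [n3 H3] : exists n3, forall n, (n3 <= n)%N -> M * q ^+ n / (1 - q) <= h.
    have : q ^+ n @[n --> \oo] --> (0 : R) by apply: cvg_expr; rewrite ger0_norm// ltW.
    have h1 : 0 < h * (1 - q) / (M + 1) by rewrite divr_gt0 ?mulr_gt0// ltr_wpDl.
    move=> /cvgrPdist_lt /(_ _ h1)[n3 _ h3]; exists n3 => n hn.
    have := h3 n hn; rewrite /= sub0r normrN ger0_norm ?exprn_ge0 ?(ltW q0)// => h4.
    rewrite ler_pdivrMr//; apply: le_trans (_ : (M + 1) * q ^+ n <= _).
      by rewrite ler_wpM2r ?exprn_ge0 ?(ltW q0)// lerDl.
    by rewrite mulrC -ler_pdivlMr ?ltW// ltr_wpDl.
  pose n0 := maxn n1 (maxn n2 n3).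
  have g1 : (n1 <= n0)%N by rewrite leq_max leqnn.
  have g2 : (n2 <= n0)%N by rewrite !leq_max leqnn orbT.
  have g3 : (n3 <= n0)%N by rewrite !leq_max leqnn !orbT.
  (* Countability of words indexes the cover by naturals; indices of no word, or of a short or
     rejected one, receive the empty set, of weight 0. *)
  pose U k : set R := if pickle_inv k is Some w then
    [set x | [/\ (n0 <= size w)%N, G w & P w x]] else set0.
  have diam0 : (diam (set0 : set R) = -oo)%E.
    rewrite /diam (_ : [set _ | _ in _] = set0) ?ereal_sup0//.
    by apply/seteqP; split => // y [[? ?] [[]]].
  have Uset k : U k = set0 \/ exists w, [/\ pickle_inv k = Some w, (n0 <= size w)%N, G w & U k = P w].
    rewrite /U; case E : (pickle_inv k) => [w|]; last by left.
    have [[h1 h2]|nh] := pselect ((n0 <= size w)%N /\ G w).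
      right; exists w; split => //; apply/seteqP; split => y /=; first by case.
      by move=> Py; split.
    by left; apply/seteqP; split => // y [h1 h2 _]; apply: nh.
  apply: le_trans (_ : (\sum_(0 <= k <oo) diam_power d (U k) <= _)%E).
    apply: ereal_inf_lbound; exists U => //; split.
      move=> x Sx; have [w [h1 h2 h3]] := cov x Sx n0.
      by exists (pickle w) => //; rewrite /U pickleK_inv.
    move=> k; have [->|[w [_ nw _ ->]]] := Uset k; first by rewrite diam0 leNye.
    by apply: H2; exact: leq_trans nw.
  apply: lime_le; first by apply: is_cvg_nneseries => k _ _; exact: diam_power_ge0.
  near=> m.
  pose u k : R := if pickle_inv k is Some w then (if (n0 <= size w)%N then v w else 0) else 0.
  have Uu k : (diam_power d (U k) <= (u k)%:E)%E.
    have [->|[w [E nw Gw ->]]] := Uset k.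
      rewrite /diam_power eqxx lee_fin /u; case: pickle_inv => // w.
      by case: ifP.
    by rewrite /u E nw; exact: diam_v.
  apply: le_trans (_ : ((\sum_(0 <= k < m) u k)%:E <= _)%E).
    by rewrite -sumEFin; apply: lee_sum => k _; exact: Uu.
  rewrite lee_fin.
  have -> : \sum_(0 <= k < m) u k = \sum_(w <- pmap pickle_inv (iota 0 m) | (n0 <= size w)%N) v w.
    rewrite /index_iota subn0; elim: (iota 0 m) => [|k t ih]; first by rewrite !big_nil.
    rewrite big_cons /= /u; case E : (pickle_inv k) => [w|]; last by rewrite add0r ih.
    by rewrite /= big_cons; case: ifP => _; rewrite ih ?add0r.
  apply: le_trans (H3 n0 g3); apply: partial_sum_le => //.
    by move=> n hn; apply: H; exact: leq_trans hn.
  by apply: (pmap_uniq (@pickle_invK _)); exact: iota_uniq.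
apply/eqP; rewrite eq_le; apply/andP; split.
  by apply: ge_ereal_sup => _ [e /= e0 <-]; exact: cont.
apply: le_trans (_ : (hausdorff_content d 1 S <= _)%E).
  apply: le_ereal_inf_tmp => _ [U _ <-]; apply: nneseries_ge0 => k _ _; exact: diam_power_ge0.
by apply: ereal_sup_ubound; exists 1 => //=.
Unshelve. all: by end_near.
Qed.

End CoverMeasure.

Section UpperBound.
Context {R : realType} {s : nat} (f g : expanding_map R s.+1).
Hypothesis full : range (coding g) = `[0, 1]%classic.
Implicit Types (om nu : nat -> 'I_s.+1) (w : seq 'I_s.+1).
Variable al : R.
Hypothesis al0 : 0 < al.

Let S := [set x | repeller f x /\ hoelder_exponent (repeller f) (conjugacy f g) x = al%:E].

(* The cylinder witnessing the exponent at x may contain only a nearby point y, at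
   distance at most its own length from x. *)
Definition fat_cylinder w : set R :=
  [set x | word_map f w 0 - len f w <= x <= word_map f w 1 + len f w].

Lemma diam_fat_cylinder w : (diam (fat_cylinder w) <= (3 * len f w)%:E)%E.
Proof.
apply: ge_ereal_sup => _ [[x y] /= [/andP[a b] /andP[c d]] <-]; rewrite lee_fin.
have E : len f w = word_map f w 1 - word_map f w 0 by [].
rewrite ler_norml; apply/andP; split; lra.
Qed.

Lemma diam_power_fat_cylinder (d : R) w : 0 <= d ->
  (diam_power d (fat_cylinder w) <= ((3 * len f w) `^ d)%:E)%E.
Proof.
move=> d0; have l0 := len_gt0 f w; rewrite /diam_power; case: eqP => [_|ne].
  by rewrite lee_fin powR_ge0.
rewrite -poweR_EFin; apply: gt0_ler_poweR => //; last exact: diam_fat_cylinder.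
  rewrite in_itv/= leey andbT.
  have x0 : fat_cylinder w (word_map f w 0).
    by apply/andP; have E : len f w = word_map f w 1 - word_map f w 0 by []; split; lra.
  by apply: le_trans (diam_ge x0 x0); rewrite lee_fin.
by rewrite in_itv/= leey andbT lee_fin mulr_ge0// ltW.
Qed.

Let large (c Q e : R) : 0 < c -> 0 < e -> exists n0 : nat, forall n : nat, (n0 <= n)%N -> Q <= e * (c * n%:R).
Proof.
by move=> c0 e0; have [n0 h] := archi_ge Q (mulr_gt0 e0 c0); exists n0 => n /h; rewrite mulrA.
Qed.

(** Serves b < 0. A Hoelder bound with exponent close to [al] limits the oscillation on small
    cylinders around the point, and [cylinder_half_osc] turns this into an upper bound for the
    g-length. *)
Lemma cover_neg om (e : R) n0 : 0 < e ->
  hoelder_exponent (repeller f) (conjugacy f g) (coding f om) = al%:E ->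
  exists n, (n0 <= n)%N /\ (al - e) * lam f (mkseq om n) <= lam g (mkseq om n).
Proof.
(* One [h] is lost in the exponent and one absorbs the constant [Q], within [e]; [h <= al / 2] keeps
   [a'] positive. *)
move=> e0 hE; pose h := Num.min e al / 2.
have h0 : 0 < h by rewrite divr_gt0// lt_min e0 al0.
have he : h + h <= e by rewrite /h -mulr2n -[_ *+ 2]mulr_natr divfK ?gt_eqF// ge_min lexx.
have hal : h + h <= al by rewrite /h -mulr2n -[_ *+ 2]mulr_natr divfK ?gt_eqF// ge_min lexx orbT.
have [a' [M [r [aa r0 H]]]] := @hoelder_exponent_lt _ _ _ _ _ (al - h) hE ltac:(by rewrite ltrBlDr ltrDl).
have a'0 : 0 < a' by lra.
have [c [C [c0 cC bd]]] := lam_bounds f.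
pose Q := ln (2 * `|M| + 1).
have [n1 H1] := large Q c0 h0; have [n2 H2] := len_small f r0.
pose n := maxn (maxn n0 n1) n2.
have m0 : (n0 <= n)%N by rewrite !leq_max leqnn.
have m1 : (n1 <= n)%N by rewrite !leq_max leqnn orbT.
have m2 : (n2 <= n)%N by rewrite !leq_max leqnn !orbT.
exists n; split => //.
have [nu [Enu osc]] := cylinder_half_osc full om n.
have lg := len_gt0 g (mkseq om n); have lf := len_gt0 f (mkseq om n).
have dle : `|coding f nu - coding f om| <= len f (mkseq om n).
  by rewrite -Enu; exact: coding_dist_le.
have dpos : 0 < `|coding f nu - coding f om|.
  rewrite normr_gt0 subr_eq0; apply/eqP => E; move: osc; rewrite (coding_eq full E) subrr normr0 mulr0.
  by rewrite leNgt lg.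
have dr : `|coding f nu - coding f om| < r.
  by apply: le_lt_trans dle _; apply: H2; rewrite size_mkseq.
have := H (coding f nu) (ex_intro2 _ _ nu I erefl) dpos dr; rewrite !conjugacyE// => hh.
have h2 : len g (mkseq om n) <= (2 * `|M| + 1) * len f (mkseq om n) `^ a'.
  apply: le_trans osc _; apply: le_trans (_ : 2 * (`|M| * len f (mkseq om n) `^ a') <= _).
    rewrite ler_pM2l//; apply: le_trans hh _.
    apply: le_trans (_ : `|M| * `|coding f nu - coding f om| `^ a' <= _).
      by rewrite ler_wpM2r ?powR_ge0// ler_norm.
    by rewrite ler_wpM2l// ge0_ler_powR ?nnegrE// ltW.
  by rewrite mulrA ler_wpM2r ?powR_ge0// lerDl.
have M0 : 0 < 2 * `|M| + 1 by rewrite ltr_wpDl// mulr_ge0.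
have : ln (len g (mkseq om n)) <= Q + a' * ln (len f (mkseq om n)).
  by rewrite /Q -ln_powR -lnM ?posrE ?powR_gt0// ler_ln ?posrE ?mulr_gt0 ?powR_gt0.
rewrite -[ln (len g _)]opprK -[ln (len f _)]opprK -/(lam g _) -/(lam f _).
have /andP[An _] := bd (mkseq om n); rewrite size_mkseq in An.
have cn : 0 <= c * n%:R by rewrite mulr_ge0// ltW.
have A0 := le_trans cn An.
have q1 : (al - h) * lam f (mkseq om n) <= a' * lam f (mkseq om n) by rewrite ler_wpM2r// ltW.
have q2 : h * (c * n%:R) <= h * lam f (mkseq om n) by rewrite ler_pM2l.
have q3 : (h + h) * lam f (mkseq om n) <= e * lam f (mkseq om n) by rewrite ler_wpM2r.
have := H1 n m1; lra.
Qed.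

(** The prefix just before [c1] times the length first drops to [r]; one letter shrinks the length
    by at most the factor [c1]. *)
Lemma scale_prefix (c1 r : R) om : (forall w i, c1 * len f w <= len f (rcons w i)) -> 0 < c1 ->
  0 < r -> r < c1 -> exists n, r < c1 * len f (mkseq om n) /\ c1 * (c1 * len f (mkseq om n)) <= r.
Proof.
move=> hc1 c10 r0 rc.
have ex : exists n, c1 * len f (mkseq om n) <= r.
  have [n h] := len_small f (divr_gt0 r0 c10); exists n.
  by have := h (mkseq om n); rewrite size_mkseq leqnn => /(_ isT)/ltW; rewrite ler_pdivlMr// mulrC.
case: (ex_minnP ex) => -[|n] hn mn.
  by move: hn; rewrite /= /len/= subr0 mulr1 leNgt rc.
exists n; split.
  by rewrite ltNge; apply/negP => /mn; rewrite ltnn.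
apply: le_trans hn; rewrite ler_pM2l// mkseqS; exact: hc1.
Qed.

(** Serves b >= 0. There are y near x with |Theta y - Theta x| above a power of |x - y|; by
    [conjugacy_dist] one of the cylinders of x and y at that scale has at least half of this as
    g-length. *)
Lemma cover_pos om (e : R) n0 : 0 < e ->
  hoelder_exponent (repeller f) (conjugacy f g) (coding f om) = al%:E ->
  exists w, [/\ (n0 <= size w)%N, lam g w <= (al + e) * lam f w & fat_cylinder w (coding f om)].
Proof.
move=> e0 hE; have [c [C [c0 cC bd]]] := lam_bounds f.
have [c1 [c10 hc1]] := len_rcons f.
have C0 := lt_le_trans c0 cC.
have c11 : c1 <= 1.
  have := hc1 [::] ord0; have := len_le1 f (rcons [::] ord0).
  have -> : len f [::] = 1 by rewrite /len/= subr0.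
  by rewrite mulr1 => h1 h2; exact: le_trans h2 h1.
pose a := al + e / 2.
have alp := al0; have a0 : 0 < a by rewrite /a; lra.
pose Q := ln 2 - 2 * a * ln c1.
have e2 : 0 < e / 2 by lra.
have [n1 H1] := large Q c0 e2.
pose N := maxn n0 n1.
(* Points this close force words of length at least [N], because [len f w >= exp (- C * size w)]. *)
pose r := Num.min c1 (c1 * c1 * expR (- (C * N%:R))).
have r0 : 0 < r by rewrite lt_min c10 !mulr_gt0 ?expR_gt0.
have [_ [[nu _ <-] y0 yr yT]] := @hoelder_exponent_gt _ _ _ _ _ a 1 r hE ltac:(by rewrite /a; lra) a0 r0.
move: yT; rewrite !conjugacyE// mul1r => yT.
set p := `|coding f nu - coding f om| in y0 yr yT.
have pc : p < c1 by apply: lt_le_trans yr _; rewrite ge_min lexx.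
have pE : p < c1 * c1 * expR (- (C * N%:R)) by apply: lt_le_trans yr _; rewrite ge_min lexx orbT.
have [n [hn1 hn2]] := scale_prefix om hc1 c10 y0 pc.
have [m [hm1 hm2]] := scale_prefix nu hc1 c10 y0 pc.
have D := @conjugacy_dist _ _ f g full c1 hc1 c10 nu om m n.
have {}D := D hm1 hn1.
(* Stated for any word of the right scale, as it is not known in advance which of the two cylinders
   is the large one. *)
have key w : p < c1 * len f w -> c1 * (c1 * len f w) <= p -> p `^ a <= 2 * len g w ->
    (n0 <= size w)%N /\ lam g w <= (al + e) * lam f w.
  move=> h1 h2 h3; have lf := len_gt0 f w; have lg := len_gt0 g w.
  have /andP[b1 b2] := bd w.
  have sN : (N <= size w)%N.
    rewrite leqNgt; apply/negP => sw.
    have : C * (size w)%:R <= C * N%:R by rewrite ler_pM2l// ler_nat ltnW.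
    move=> h4; have : expR (- (C * N%:R)) <= len f w by rewrite -expR_lam ler_expR; lra.
    move=> h5; have : c1 * c1 * expR (- (C * N%:R)) <= c1 * (c1 * len f w).
      by rewrite mulrA ler_pM2l ?mulr_gt0.
    by move=> h6; have := lt_le_trans pE (le_trans h6 h2); rewrite ltxx.
  split; first by apply: leq_trans sN; rewrite leq_max leqnn.
  have : ln (p `^ a) <= ln (2 * len g w) by rewrite ler_ln ?posrE ?powR_gt0 ?mulr_gt0.
  have h2' : ln (c1 * (c1 * len f w)) <= ln p by rewrite ler_ln ?posrE ?mulr_gt0.
  rewrite !lnM ?posrE ?mulr_gt0// in h2'.
  rewrite ln_powR lnM ?posrE//.
  have ah : a * (ln c1 + (ln c1 + ln (len f w))) <= a * ln p by rewrite ler_pM2l.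
  have -> : ln (len g w) = - lam g w by rewrite opprK.
  have lfE : ln (len f w) = - lam f w by rewrite opprK.
  rewrite lfE in ah => h4.
  have := H1 (size w) (leq_trans (leq_maxr _ _) sN).
  have : e / 2 * (c * (size w)%:R) <= e / 2 * lam f w by rewrite ler_pM2l.
  rewrite /Q; have aE : a = al + e / 2 by []; rewrite aE in ah h4 *.
  lra.
have lw w : p < c1 * len f w -> p <= len f w.
  by move=> h; apply: le_trans (ltW h) _; rewrite ler_piMl// ltW// len_gt0.
have [h|h] := leP (p `^ a) (2 * len g (mkseq om n)).
  have [k1 k2] := key _ hn1 hn2 h; exists (mkseq om n); split => //.
  have /andP[i1 i2] := coding_in f om n; have := len_gt0 f (mkseq om n) => l0.
  by rewrite /fat_cylinder /=; apply/andP; split; lra.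
have h' : p `^ a <= 2 * len g (mkseq nu m) by lra.
have [k1 k2] := key _ hm1 hm2 h'; exists (mkseq nu m); split => //.
have /andP[i1 i2] := coding_in f nu m; have := lw _ hm1.
rewrite /p ler_norml => /andP[h1 h2]; rewrite /fat_cylinder /=; apply/andP; split; lra.
Qed.

Lemma upper_bound (t b d : R) : 0 <= d -> t + b * al < d ->
  (forall e : R, 0 < e -> exists n0, forall n, (n0 <= n)%N ->
     partition_sum (fun w => - (t * lam f w) - b * lam g w) n <= expR (e * n%:R)) ->
  hausdorff_measure d S = 0%E.
Proof.
move=> d0 td HZ; pose e := d - (t + b * al).
have e0 : 0 < e by rewrite subr_gt0.
have [c [C [c0 cC bd]]] := lam_bounds f.
pose G w := b * lam g w <= (b * al + e / 2) * lam f w.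
pose v w : R := if b * lam g w <= (b * al + e / 2) * lam f w then (3 * len f w) `^ d else 0.
(* On words in [G] the exponent [d] gains [e / 2 * lam f], at least [e c n / 2]; half of it beats
   the growth of the sums and half remains as geometric decay. *)
have ec : 0 < e * c / 4 by rewrite divr_gt0// mulr_gt0.
have [n1 H1] := HZ _ ec.
apply: (@hausdorff_measure_eq0 _ _ S d fat_cylinder v G _ _ (3 `^ d) (expR (- (e * c / 4))) n1).
- by move=> w; rewrite /v; case: ifP => // _; exact: powR_ge0.
- by move=> w Gw; rewrite /v ifT//; exact: diam_power_fat_cylinder.
- exact: powR_ge0.
- exact: expR_gt0.
- by rewrite expR_lt1 oppr_lt0.
- move=> n hn; apply: le_trans (_ : 3 `^ d * expR (- (e * c / 2 * n%:R)) *
      partition_sum (fun w => - (t * lam f w) - b * lam g w) n <= _).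
    rewrite /partition_sum mulr_sumr big_seq_cond [leRHS]big_seq_cond.
    apply: ler_sum => w; rewrite andbT mem_words => /eqP sw; rewrite /v.
    case: ifP => Gw; last by rewrite mulr_ge0 ?expR_ge0// mulr_ge0 ?expR_ge0 ?powR_ge0.
    rewrite powRM ?(ltW (len_gt0 f w))// -mulrA ler_wpM2l ?powR_ge0// -expRD.
    rewrite /powR (gt_eqF (len_gt0 f w)) ler_expR.
    have -> : ln (len f w) = - lam f w by rewrite opprK.
    have /andP[h1 _] := bd w; rewrite sw in h1.
    have h2 : e / 2 * (c * n%:R) <= e / 2 * lam f w by rewrite ler_pM2l// divr_gt0.
    have dE : d = e + (t + b * al) by rewrite /e; ring.
    rewrite dE; lra.
  rewrite -mulrA ler_wpM2l ?powR_ge0//.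
  apply: le_trans (_ : expR (- (e * c / 2 * n%:R)) * expR (e * c / 4 * n%:R) <= _).
    by rewrite ler_pM2l ?expR_gt0// H1.
  rewrite -expRD -expRM_natl ler_expR; lra.
- move=> r r0; have r3 : 0 < r / 3 by rewrite divr_gt0.
  have [n0 h] := len_small f r3; exists n0 => w sw.
  apply: le_trans (diam_fat_cylinder w) _; rewrite lee_fin; have := h w sw; lra.
- move=> _ [[om _ <-] hE] n0.
  have A0 w : 0 <= lam f w.
    by have /andP[h _] := bd w; apply: le_trans h; rewrite mulr_ge0// ltW.
  (* [G] asks for a small [lam g] if [b >= 0] and a large one if [b < 0]; dividing by [b + 1] also
     covers [b = 0]. *)
  have [b0|b0] := leP 0 b.
    have b1 : 0 < 2 * (b + 1) by rewrite mulr_gt0// ltr_wpDl.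
    have h0 : 0 < e / (2 * (b + 1)) by rewrite divr_gt0.
    have [w [h1 h2 h3]] := cover_pos n0 h0 hE; exists w; split => //.
    rewrite /G; have h4 : b * lam g w <= b * ((al + e / (2 * (b + 1))) * lam f w) by rewrite ler_wpM2l.
    apply: le_trans h4 _; rewrite mulrA ler_wpM2r// mulrDr lerD2l.
    rewrite mulrA ler_pdivrMr//.
    have -> : e / 2 * (2 * (b + 1)) = e * (b + 1) by field.
    by rewrite [leRHS]mulrDr mulr1 mulrC lerDl ltW.
  have b1 : 0 < 2 * (- b) by rewrite mulr_gt0// oppr_gt0.
  have h0 : 0 < e / (2 * (- b)) by rewrite divr_gt0.
  have [n [h1 h2]] := cover_neg n0 h0 hE; exists (mkseq om n); split => //.
  + by rewrite size_mkseq.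
  + have h4 : b * lam g (mkseq om n) <= b * ((al - e / (2 * - b)) * lam f (mkseq om n)) by rewrite ler_nM2l.
    apply: le_trans h4 _; rewrite mulrA ler_wpM2r//.
    rewrite le_eqVlt; apply/orP; left; apply/eqP; field.
    by rewrite lt_eqF.
  + have /andP[i1 i2] := coding_in f om n; have := len_gt0 f (mkseq om n) => l0.
    by rewrite /fat_cylinder /=; apply/andP; split; lra.
Qed.

End UpperBound.

(** * The lower bound *)

(** With [N k] the length of the words of precision [k], block [j] then has length at most
    [j / k j], negligible against what precedes it. *)
Lemma slow_index (N : nat -> nat) : exists k : nat -> nat,
  (forall j, (k j * N (k j) <= j)%N) /\ (forall m, exists j0, forall j, (j0 <= j)%N -> (m <= k j)%N).
Proof.
exists (fun j => \max_(i < j.+1 | (i * N i <= j)%N) i); split.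
  move=> j; have h0 : (0 < #|[pred i : 'I_j.+1 | (i * N i <= j)%N]|)%N.
    by apply/card_gt0P; exists ord0; rewrite inE.
  have [i /= hi E] := eq_bigmax_cond (fun i : 'I_j.+1 => i : nat) h0.
  by rewrite E; exact: hi.
move=> m; exists (maxn m (m * N m)) => j; rewrite geq_max => /andP[h1 h2].
have mj : (m < j.+1)%N by rewrite ltnS.
exact: (@leq_bigmax_cond _ (fun i : 'I_j.+1 => i * N i <= j)%N (fun i : 'I_j.+1 => i : nat) (Ordinal mj)).
Qed.

Section LowerBound.
Context {R : realType} {s : nat} (f g : expanding_map R s.+2).
Hypothesis full : range (coding g) = `[0, 1]%classic.
Variables (al D : R) (t : R -> R).
Hypothesis al0 : 0 < al.
Hypothesis D0 : 0 <= D.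
Hypothesis tD : forall b, D <= t b + b * al.
Hypothesis low : forall b (e : R), 0 < e -> forall n0, exists2 n, (n0 <= n)%N &
  expR (- (e * n%:R)) <= partition_sum (fun w => - (t b * lam f w) - b * lam g w) n.

Let V w : R := lam g w - al * lam f w.

Lemma level_set_constants : exists (K c : R) (C : nat), [/\ 0 <= K, 0 < c,
  forall u v, `|lam f (u ++ v) - (lam f u + lam f v)| <= K,
  forall u v, `|V (u ++ v) - (V u + V v)| <= K &
  forall w, c * (size w)%:R <= lam f w <= C%:R * (size w)%:R /\ `|V w| <= C%:R * (size w)%:R].
Proof.
have [K1 [K10 H1]] := lam_cat f; have [K2 [K20 H2]] := lam_cat g.
have [c1 [C1 [c10 cC1 B1]]] := lam_bounds f; have [c2 [C2 [c20 cC2 B2]]] := lam_bounds g.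
have alp := ltW al0.
pose C := (Num.truncn (C1 + (C2 + al * C1))).+1.
have CE : C1 + (C2 + al * C1) <= C%:R := ltW (truncnS_gt _).
have aC : 0 <= al * C1 by rewrite mulr_ge0//; lra.
exists (K1 + (K2 + al * K1)), c1, C; split => //.
- by rewrite !addr_ge0// mulr_ge0.
- move=> u v; apply: le_trans (H1 u v) _; rewrite lerDl addr_ge0// mulr_ge0//.
- move=> u v; have -> : V (u ++ v) - (V u + V v) = (lam g (u ++ v) - (lam g u + lam g v)) -
     al * (lam f (u ++ v) - (lam f u + lam f v)) by rewrite /V; ring.
  apply: le_trans (ler_normB _ _) _; rewrite normrM (ger0_norm alp).
  apply: le_trans (_ : K2 + al * K1 <= _); last by rewrite lerDr.
  by apply: lerD => //; rewrite ler_wpM2l.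
move=> w; have /andP[a1 a2] := B1 w; have /andP[a3 a4] := B2 w.
have n0 : 0 <= (size w)%:R :> R by [].
have h : (C1 + (C2 + al * C1)) * (size w)%:R <= C%:R * (size w)%:R by rewrite ler_wpM2r.
have h1 : 0 <= C1 * (size w)%:R by rewrite mulr_ge0//; lra.
have h2 : 0 <= C2 * (size w)%:R by rewrite mulr_ge0//; lra.
have h3 : 0 <= c1 * (size w)%:R by rewrite mulr_ge0//; lra.
have h4 : 0 <= c2 * (size w)%:R by rewrite mulr_ge0//; lra.
have h5 : 0 <= al * (C1 * (size w)%:R) by rewrite mulr_ge0.
have h6 : al * lam f w <= al * (C1 * (size w)%:R) by rewrite ler_wpM2l.
have h7 : 0 <= al * lam f w by rewrite mulr_ge0//; lra.
split; first by rewrite a1 /=; lra.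
by rewrite /V ler_norml; apply/andP; split; lra.
Qed.

(** Replacing [t b] by the smaller [D - b * al] only increases the summands as [lam f >= 0], so
    [low] persists; the defect of the tilted exponent is [K * (D + |b|)]. *)
Lemma partition_sum_tilted b (K c : R) : 0 <= K -> 0 < c ->
  (forall u v, `|lam f (u ++ v) - (lam f u + lam f v)| <= K) ->
  (forall u v, `|V (u ++ v) - (V u + V v)| <= K) ->
  (forall w, c * (size w)%:R <= lam f w) ->
  forall N, (0 < N)%N ->
  expR (- (K * (D + 1) * (1 + `|b|))) <= partition_sum (fun w => - (D * lam f w) - b * V w) N.
Proof.
move=> K0 c0 hX hV bX N N0; have Dp := D0.
have A0 w : 0 <= lam f w by apply: le_trans (bX w); rewrite mulr_ge0// ltW.
have b0 := normr_ge0 b.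
apply: le_trans (_ : expR (- (K * (D + `|b|))) <= _).
  rewrite ler_expR lerN2 -mulrA ler_wpM2l//.
  have : 0 <= D * `|b| by rewrite mulr_ge0.
  lra.
apply: partition_lower N0.
  move=> u v.
  have -> : - (D * lam f (u ++ v)) - b * V (u ++ v) -
    (- (D * lam f u) - b * V u + (- (D * lam f v) - b * V v)) =
    - (D * (lam f (u ++ v) - (lam f u + lam f v)) + b * (V (u ++ v) - (V u + V v))) by ring.
  rewrite normrN; apply: le_trans (ler_normD _ _) _; rewrite !normrM (ger0_norm Dp).
  by rewrite [leRHS]mulrDr; apply: lerD; rewrite [leLHS]mulrC ler_wpM2r.
move=> e e0 n0; have [n nn0 h] := low b e0 n0; exists n => //; apply: le_trans h _.
apply: ler_sum => w _; rewrite ler_expR /V.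
have : D * lam f w <= (t b + b * al) * lam f w by rewrite ler_wpM2r.
lra.
Qed.

Lemma marked_block (K c : R) (C : nat) (e : R) : 0 <= K -> 0 < c ->
  (forall u v, `|lam f (u ++ v) - (lam f u + lam f v)| <= K) ->
  (forall u v, `|V (u ++ v) - (V u + V v)| <= K) ->
  (forall w, c * (size w)%:R <= lam f w <= C%:R * (size w)%:R /\ `|V w| <= C%:R * (size w)%:R) ->
  0 < e -> exists N x W, [/\ block (lam f) V N x 0 (e * N%:R) W, (0 < size W)%N,
    D * x - e * N%:R <= ln (size W)%:R, K <= e * N%:R &
    forall w, w \in W -> exists u, w = u ++ [:: ord0; ord_max]].
Proof.
move=> K0 c0 hX hV hB e0; pose m : seq 'I_s.+2 := [:: ord0; ord_max].
(* All that the marker can change; a bounded amount, absorbed by taking [N] large. *)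
pose Q := K + `|V m| + `|D * lam f m| + K.
pose n0 := (Num.truncn (Q / (e / 2))).+1.
have e2 : 0 < e / 2 by rewrite divr_gt0.
have bX w : 0 <= lam f w <= C%:R * (size w)%:R.
  have [/andP[h1 h2] _] := hB w; by rewrite h2 andbT; apply: le_trans h1; rewrite mulr_ge0// ltW.
have bV w : `|V w| <= C%:R * (size w)%:R by have [] := hB w.
have bc w : c * (size w)%:R <= lam f w by have [/andP[]] := hB w.
have C10 : 0 <= K * (D + 1) by have Dp := D0; rewrite mulr_ge0// addr_ge0.
have [N [x [W [nN bW sW HW]]]] := @typical_block _ _ (lam f) V K K0 hX hV C (K * (D + 1)) D
  C10 D0 bX bV (fun b N => @partition_sum_tilted b K c K0 c0 hX hV bc N) (e / 2) n0 e2.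
have QN : Q <= e / 2 * N%:R.
  rewrite [leRHS]mulrC -ler_pdivrMr//; apply: le_trans (ltW (truncnS_gt _)) _.
  by rewrite ler_nat.
have bm : block (lam f) V 2 (lam f m) (V m) 0 [:: m].
  split => //; first by move=> w; rewrite inE => /eqP ->.
  by move=> w; rewrite inE => /eqP ->; rewrite !subrr normr0.
have B := block_cat hX hV bW bm.
have v1 := normr_ge0 (V m); have v2 := normr_ge0 (D * lam f m).
have eN : e * (N + 2)%:R = e / 2 * N%:R + e / 2 * N%:R + e * 2 by rewrite natrD; field.
have QN' : K + `|V m| + `|D * lam f m| + K <= e / 2 * N%:R by [].
exists (N + 2)%N, (x + lam f m), (cat_blocks W [:: m]); split.
- have h : e / 2 * N%:R + 0 + K <= e * (N + 2)%:R by rewrite eN; lra.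
  apply: (block_weaken B h); rewrite add0r subr0 eN; lra.
- by rewrite size_cat_blocks muln1.
- rewrite size_cat_blocks muln1 eN mulrDr; have := ler_norm (D * lam f m); lra.
- rewrite eN; lra.
by move=> w /allpairsP[[u v] /= [_]]; rewrite inE => /eqP -> ->; exists u.
Qed.

Lemma lower_bound : (D%:E <= hausdorff_dim [set y | repeller f y /\
  hoelder_exponent (repeller f) (conjugacy f g) y = al%:E])%E.
Proof.
have [K [c [C [K0 c0 hX hV hB]]]] := level_set_constants.
have /choice[N /choice[x /choice[W HW]]] : forall k : nat, exists N x W,
    [/\ block (lam f) V N x 0 (k.+1%:R^-1 * N%:R) W, (0 < size W)%N,
    D * x - k.+1%:R^-1 * N%:R <= ln (size W)%:R, K <= k.+1%:R^-1 * N%:R &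
    forall w, w \in W -> exists u, w = u ++ [:: ord0; ord_max]].
  move=> k; exact: (marked_block K0 c0 hX hV hB).
have [kp [kp1 kp2]] := slow_index N.
pose l j := N (kp j); pose er j : R := (kp j).+1%:R^-1 * (l j)%:R.
have l1 j : (1 <= l j)%N.
  have [[_ sW _] h0 _ _ mk] := HW (kp j).
  have h : nth [::] (W (kp j)) 0 \in W (kp j) by rewrite mem_nth.
  by rewrite /l -(sW _ h); have [u ->] := mk _ h; rewrite size_cat addn_gt0 orbT.
have posS j : pos l j.+1 = (pos l j + l j)%N by rewrite /pos big_ord_recr.
have pos_ge j : (j <= pos l j)%N.
  elim: j => [//|j ih]; rewrite posS -addn1 leq_add//.
have l_le j : (kp j * l j <= pos l j)%N := leq_trans (kp1 j) (pos_ge j).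
have inv_small (e : R) : 0 < e -> exists k0 : nat, forall k, (k0 <= k)%N -> k.+1%:R^-1 <= e /\ 1 <= e * k%:R.
  move=> e0; exists (Num.truncn e^-1).+1 => k hk.
  have h : e^-1 <= k%:R by apply: le_trans (ltW (truncnS_gt _)) _; rewrite ler_nat.
  split; last by rewrite -ler_pdivrMl// mulr1.
  rewrite -[leRHS]invrK lef_pV2 ?posrE ?invr_gt0//; apply: le_trans h _; by rewrite ler_nat.
apply: (@moran_dim_ge _ _ f g full al K C%:R c D al0 K0 (ler0n _ _) c0 hX hV _ _
  (fun j => W (kp j)) l (fun j => x (kp j)) er).
- by move=> w; have [] := hB w.
- by move=> w; have [] := hB w.
- by move=> j; have [] := HW (kp j).
- by move=> j; have [] := HW (kp j).
- by move=> j; have [] := HW (kp j).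
- by move=> j; have [] := HW (kp j).
- by move=> j w; have [_ _ _ _] := HW (kp j); apply.
- move=> d d0; have d2 : 0 < d / 2 by rewrite divr_gt0.
  have [k0 Hk] := inv_small _ d2; have [j1 Hj] := kp2 k0.
  exists (maxn j1 (Num.truncn ((pos l j1)%:R / (d / 2))).+1) => j; rewrite geq_max => /andP[h1 h2].
  have er_le i : er i <= (l i)%:R.
    by rewrite /er ler_piMl// invf_le1// ler1n.
  (* Cesaro argument: the first [j1] blocks are bounded trivially and become negligible, later ones
     have relative tolerance at most [d / 2]. *)
  have step n : \sum_(i < j1 + n) er i <= d / 2 * (pos l (j1 + n))%:R + (pos l j1)%:R.
    elim: n => [|n ih].
      rewrite addn0; apply: le_trans (_ : (pos l j1)%:R <= _).
        by rewrite /pos natr_sum; apply: ler_sum => i _; exact: er_le.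
      by rewrite lerDr mulr_ge0// ltW.
    rewrite addnS big_ord_recr /= posS natrD mulrDr.
    have [h _] := Hk _ (Hj (j1 + n)%N (leq_addr _ _)).
    have : er (j1 + n)%N <= d / 2 * (l (j1 + n))%:R by rewrite /er ler_wpM2r.
    lra.
  have := step (j - j1)%N; rewrite subnKC// => h3; apply: le_trans h3 _.
  have h4 : (pos l j1)%:R <= d / 2 * (pos l j)%:R.
    rewrite [leRHS]mulrC -ler_pdivrMr//; apply: le_trans (ltW (truncnS_gt _)) _.
    by rewrite ler_nat (leq_trans h2).
  lra.
move=> d d0; have [k0 Hk] := inv_small _ d0; have [j1 Hj] := kp2 k0.
exists j1 => j hj; have [_ h] := Hk _ (Hj j hj).
apply: le_trans (_ : d * (kp j)%:R * (l j)%:R <= _); first by rewrite ler_peMl.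
by rewrite -mulrA ler_pM2l// -natrM ler_nat.
Qed.

End LowerBound.

(** * Position of the pressure lines *)

Section Spectrum.
Context {R : realType} {s : nat} (f g : expanding_map R s.+1).
Implicit Types (om : nat -> 'I_s.+1).

Lemma birkhoff_linear (a b : R) (u v : (nat -> 'I_s.+1) -> R) n om :
  birkhoff (fun w => a * u w + b * v w) n om = a * birkhoff u n om + b * birkhoff v n om.
Proof. by rewrite /birkhoff big_split /= -!mulr_sumr. Qed.

Lemma pressure0_lam (t b : R) :
  pressure (fun w => t * geometric_potential f w + b * geometric_potential g w) = 0%E ->
  (forall e : R, 0 < e -> exists n0, forall n, (n0 <= n)%N ->
    partition_sum (fun w => - (t * lam f w) - b * lam g w) n <= expR (e * n%:R)) /\
  (forall e : R, 0 < e -> forall n0, exists2 n, (n0 <= n)%N &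
    expR (- (e * n%:R)) <= partition_sum (fun w => - (t * lam f w) - b * lam g w) n).
Proof.
have [K1 [K10 H1]] := lam_birkhoff f; have [K2 [K20 H2]] := lam_birkhoff g.
apply: (@pressure0_partition_sum _ _ _ _ (`|t| * K1 + `|b| * K2)) => om n.
rewrite birkhoff_linear; have := H1 om n; have := H2 om n.
move: (birkhoff (geometric_potential f) n om) (birkhoff (geometric_potential g) n om).
move: (lam f _) (lam g _) => A B Sf Sg h2 h1.
have -> : t * Sf + b * Sg - (- (t * A) - b * B) = t * (A + Sf) + b * (B + Sg) by ring.
by apply: le_trans (ler_normD _ _) _; rewrite !normrM; apply: lerD; apply: ler_wpM2l.
Qed.

Lemma alpha_minus_gt0 : (0 < alpha_minus f g)%E.
Proof.
have [K1 [K10 H1]] := lam_birkhoff f; have [K2 [K20 H2]] := lam_birkhoff g.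
have [c1 [C1 [c10 cC1 B1]]] := lam_bounds f; have [c2 [C2 [c20 cC2 B2]]] := lam_bounds g.
have C10 := lt_le_trans c10 cC1.
(* For large n the g-sum is at least [c2 n / 2] and the f-sum at most [2 C1 n] in absolute value. *)
have k0 : 0 < c2 / (4 * C1) by rewrite divr_gt0// mulr_gt0.
apply: lt_le_trans (_ : ((c2 / (4 * C1))%:E <= _)%E); first by rewrite lte_fin.
apply: le_ereal_inf_tmp => _ [om _ <-]; rewrite /limn_einf leeNr; apply: limf_esup_le.
have c12 : 0 < c1 / 2 by rewrite divr_gt0.
have c22 : 0 < c2 / 2 by rewrite divr_gt0.
have [n1 L1] := archi_ge K1 c12; have [n2 L2] := archi_ge K2 c22.
exists (maxn n1 n2).+1 => // n /= hn.
have g1 : (n1 <= n)%N by apply: leq_trans (ltnW hn); rewrite leq_max leqnn.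
have g2 : (n2 <= n)%N by apply: leq_trans (ltnW hn); rewrite leq_max leqnn orbT.
have np : 0 < n%:R :> R by rewrite ltr0n; case: n hn {g1 g2}.
rewrite lee_fin lerN2.
set Sg := birkhoff _ n om; set Sf := birkhoff _ n om.
have := H1 om n; have := H2 om n; rewrite -/Sg -/Sf; clearbody Sg Sf.
rewrite !ler_norml => /andP[a1 a2] /andP[a3 a4].
have := B1 (mkseq om n); have := B2 (mkseq om n); rewrite size_mkseq => /andP[b1 b2] /andP[b3 b4].
have l1 := L1 n g1; have l2 := L2 n g2.
have c1n : c1 * n%:R <= C1 * n%:R by rewrite ler_wpM2r// ltW.
have c1p : 0 < c1 * n%:R by rewrite mulr_gt0.
have Sf0 : 0 < - Sf by lra.
have -> : Sg / Sf = (- Sg) / (- Sf) by rewrite invrN mulrNN.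
rewrite ler_pdivlMr// mulrAC ler_pdivrMr ?mulr_gt0//.
have h1 : c2 * (- Sf) <= c2 * (2 * C1 * n%:R) by rewrite ler_pM2l//; lra.
have h2 : (4 * C1) * (c2 / 2 * n%:R) <= (4 * C1) * (- Sg) by rewrite ler_pM2l ?mulr_gt0//; lra.
lra.
Qed.

Let below_arith (b k K1 K2 A B Sf Sg : R) : 0 <= b -> 0 <= k -> `|A + Sf| <= K1 -> `|B + Sg| <= K2 ->
  k * Sf < Sg -> b * B <= b * (k * A) + b * (k * K1 + K2).
Proof.
move=> b0 k0; rewrite !ler_norml => /andP[a1 a2] /andP[a3 a4] h; rewrite -mulrDr ler_wpM2l//.
have : k * (- Sf) <= k * (A + K1) by rewrite ler_wpM2l//; lra.
lra.
Qed.

Let above_arith (b al h K1 K2 A B Sf Sg : R) : 0 <= b -> 0 < al -> 0 <= h -> `|A + Sf| <= K1 -> `|B + Sg| <= K2 ->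
  Sg < (al - h) * Sf -> b * (al * A - h * A - (al + h) * K1 - K2) <= b * B.
Proof.
move=> b0 al0 h0; rewrite !ler_norml => /andP[a1 a2] /andP[a3 a4] hr; rewrite ler_wpM2l//.
have : al * (A - K1) <= al * (- Sf) by rewrite ler_pM2l//; lra.
have : h * (- Sf) <= h * (A + K1) by rewrite ler_wpM2l//; lra.
lra.
Qed.

Section Sign.
Variables (t : R -> R) (al : R).
Hypothesis al0 : 0 < al.
Hypothesis am : (alpha_minus f g <= al%:E)%E.
Hypothesis ap : (al%:E <= alpha_plus f g)%E.

Lemma ratio_below (e : R) : 0 < e -> exists om, forall n0, exists2 n, (n0 <= n)%N &
  birkhoff (geometric_potential g) n om / birkhoff (geometric_potential f) n om < al + e.
Proof.
move=> e0; have : (alpha_minus f g < (al + e)%:E)%E.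
  by apply: le_lt_trans am _; rewrite lte_fin ltrDl.
move=> /ereal_inf_lt[_ [om _ <-] h]; exists om => n0; apply: contrapT => H.
move: h; rewrite ltNge => /negP; apply; rewrite /limn_einf leeNr; apply: limf_esup_le.
exists n0 => // n /= hn; rewrite lee_fin lerN2 leNgt; apply/negP => h; apply: H.
by exists n.
Qed.

Lemma ratio_above (e : R) : 0 < e -> exists om, forall n0, exists2 n, (n0 <= n)%N &
  al - e < birkhoff (geometric_potential g) n om / birkhoff (geometric_potential f) n om.
Proof.
move=> e0; have : ((al - e)%:E < alpha_plus f g)%E.
  by apply: lt_le_trans ap; rewrite lte_fin ltrBlDr ltrDl.
move=> /ereal_sup_gt[_ [om _ <-] h]; exists om => n0; apply: contrapT => H.
move: h; rewrite ltNge => /negP; apply; apply: limf_esup_le.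
exists n0 => // n /= hn; rewrite lee_fin leNgt; apply/negP => h; apply: H.
by exists n.
Qed.

(** The sign of [b] selects the end of the spectrum: [al >= alpha_minus] gives words with small
    [lam g], [al <= alpha_plus] words with large [lam g]. *)
Lemma ratio_words (b e : R) : 0 < e -> exists Q : R, forall n0, exists w,
  (n0 <= size w)%N /\ b * lam g w <= b * al * lam f w + e * lam f w + Q.
Proof.
move=> e0; have alp := al0.
have [K1 [K10 H1]] := lam_birkhoff f; have [K2 [K20 H2]] := lam_birkhoff g.
have [c1 [C1 [c10 cC1 B1]]] := lam_bounds f.
have c12 : 0 < c1 / 2 by rewrite divr_gt0.
have [n1 L1] := archi_ge K1 c12.
pose h := e / (`|b| + 1).
have b1 : 0 < `|b| + 1 by rewrite ltr_wpDl.
have h0 : 0 < h by rewrite divr_gt0.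
have hE : h * (`|b| + 1) = e by rewrite /h divfK// gt_eqF.
have Sneg om n : (n1 <= n)%N -> (0 < n)%N -> birkhoff (geometric_potential f) n om < 0.
  move=> n1n np; have nR : 0 < n%:R :> R by rewrite ltr0n.
  have := H1 om n; rewrite ler_norml => /andP[_ a4].
  have := B1 (mkseq om n); rewrite size_mkseq => /andP[b3 _].
  have := L1 n n1n; have : 0 < c1 * n%:R by rewrite mulr_gt0.
  lra.
exists (`|b| * ((al + h) * K1 + K2)) => n0.
have A0 w : 0 <= lam f w.
  by have /andP[k _] := B1 w; apply: le_trans k; rewrite mulr_ge0// ltW.
have fin w : `|b| * h * lam f w <= e * lam f w.
  by rewrite ler_wpM2r// -hE [leRHS]mulrC ler_pM2r// lerDl.
have [b0|b0] := leP 0 b.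
  have [om Hom] := ratio_below h0; have [n hn hr] := Hom (maxn n0 n1).+1.
  have g0 : (n0 <= n)%N by apply: leq_trans (ltnW hn); rewrite leq_max leqnn.
  have g1 : (n1 <= n)%N by apply: leq_trans (ltnW hn); rewrite leq_max leqnn orbT.
  have np : (0 < n)%N by exact: leq_ltn_trans hn.
  exists (mkseq om n); rewrite size_mkseq; split => //.
  have Sf := Sneg om n g1 np; rewrite ltr_ndivrMr// in hr.
  have := fin (mkseq om n); rewrite ger0_norm// => hf.
  have ah : 0 <= al + h by rewrite addr_ge0// ltW.
  have := below_arith b0 ah (H1 om n) (H2 om n) hr; move: hf; clear.
  by move: (lam f _) (lam g _) => A B; rewrite mulrDr mulrDl; lra.
have [om Hom] := ratio_above h0; have [n hn hr] := Hom (maxn n0 n1).+1.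
have g0 : (n0 <= n)%N by apply: leq_trans (ltnW hn); rewrite leq_max leqnn.
have g1 : (n1 <= n)%N by apply: leq_trans (ltnW hn); rewrite leq_max leqnn orbT.
have np : (0 < n)%N by exact: leq_ltn_trans hn.
exists (mkseq om n); rewrite size_mkseq; split => //.
have Sf := Sneg om n g1 np; rewrite ltr_ndivlMr// in hr.
have := fin (mkseq om n); rewrite ltr0_norm// => hf.
have nb : 0 <= - b by rewrite oppr_ge0 ltW.
have := above_arith nb alp (ltW h0) (H1 om n) (H2 om n) hr; move: hf; clear.
by move: (lam f _) (lam g _) => A B; lra.
Qed.

(** If the value were negative, the single term of a word from [ratio_words] would already grow
    exponentially. *)
Lemma pressure_line_ge0 (b : R) :
  (forall e : R, 0 < e -> exists n0, forall n, (n0 <= n)%N ->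
    partition_sum (fun w => - (t b * lam f w) - b * lam g w) n <= expR (e * n%:R)) ->
  0 <= t b + b * al.
Proof.
move=> HZ; rewrite leNgt; apply/negP => neg.
pose tau := - (t b + b * al); have tau0 : 0 < tau by rewrite oppr_gt0.
have [c1 [C1 [c10 cC1 B1]]] := lam_bounds f.
have t2 : 0 < tau / 2 by rewrite divr_gt0.
(* The term is at least [exp (tau c1 n / 2 - Q)] and the sum at most [exp (tau c1 n / 4)], which
   fails once [Q + 1 <= tau c1 n / 8]. *)
have t4 : 0 < tau * c1 / 4 by rewrite divr_gt0// mulr_gt0.
have t8 : 0 < tau * c1 / 8 by rewrite divr_gt0// mulr_gt0.
have [Q HQ] := ratio_words b t2; have [n1 Hn1] := HZ _ t4.
have [n2 L2] := archi_ge (Q + 1) t8.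
have [w [sw hw]] := HQ (maxn n1 n2).
have g1 : (n1 <= size w)%N by apply: leq_trans sw; rewrite leq_max leqnn.
have g2 : (n2 <= size w)%N by apply: leq_trans sw; rewrite leq_max leqnn orbT.
have := Hn1 _ g1; have ww : w \in words (size w) by rewrite mem_words.
rewrite /partition_sum (big_rem _ ww) /= => h.
have : expR (- (t b * lam f w) - b * lam g w) <= expR (tau * c1 / 4 * (size w)%:R).
  apply: le_trans h; rewrite lerDl; apply: sumr_ge0 => v _; exact: expR_ge0.
rewrite ler_expR => h1.
have h2 := L2 _ g2; have /andP[h3 _] := B1 w.
have h4 : tau / 2 * (c1 * (size w)%:R) <= tau / 2 * lam f w by rewrite ler_pM2l.
have tauE : t b = - tau - b * al by rewrite /tau; ring.
rewrite tauE in h1.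
have p : 0 <= tau * c1 / 8 * (size w)%:R by rewrite mulr_ge0// ltW.
lra.
Qed.

End Sign.

End Spectrum.

(** The supremum defining the conjugate is minus the infimum of the pressure lines; their
    nonnegativity makes it a real number and the dimension nonnegative. *)
Lemma legendre_inf {R : realType} (t : R -> R) (al : R) : (forall b, 0 <= t b + b * al) ->
  exists D : R, [/\ 0 <= D, legendre t (- al) = (- D)%:E, forall b, D <= t b + b * al &
    forall d, D < d -> exists b, t b + b * al < d].
Proof.
move=> H; pose A := range (fun b => t b + b * al).
have Ai : has_inf A.
  by split; [exists (t 0 + 0 * al), 0 | exists 0 => _ [b _ <-]; exact: H].
have low b : inf A <= t b + b * al by apply: ge_inf; [case: Ai | exists b].
have adh d : inf A < d -> exists b, t b + b * al < d.
  move=> h; have e0 : 0 < d - inf A by rewrite subr_gt0.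
  have [_ [b _ <-] hb] := inf_adherent e0 Ai; exists b.
  by rewrite addrCA subrr addr0 in hb.
exists (inf A); split => //.
  by apply: lb_le_inf; [case: Ai | move=> _ [b _ <-]; exact: H].
apply/eqP; rewrite eq_le; apply/andP; split.
  by apply: ge_ereal_sup => _ [b _ <-]; rewrite lee_fin; have := low b; lra.
apply/lee_subgt0Pr => e e0; have [|b hb] := adh (inf A + e); first by rewrite ltrDl.
apply: le_trans (_ : ((- al * b - t b)%:E <= _)%E).
  by rewrite -EFinB lee_fin; lra.
by apply: ereal_sup_ubound; exists b.
Qed.

Theorem corollary1p3 (R : realType) (s : nat) (f g : expanding_map R s)
  (t : R -> R) (alpha : R) :
  (2 <= s)%N ->
  range (coding g) = `[0, 1]%classic ->
  (forall beta : R,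
     pressure (fun w => t beta * geometric_potential f w
                        + beta * geometric_potential g w) = 0%E) ->
  (alpha_minus f g <= alpha%:E)%E ->
  (alpha%:E <= alpha_plus f g)%E ->
  hausdorff_dim
    [set x | repeller f x /\
             hoelder_exponent (repeller f) (conjugacy f g) x = alpha%:E]
  = (- legendre t (- alpha))%E.
Proof.
(* An alphabet of the form ['I_s.+2] has distinct first and last letters, as the markers require. *)
case: s f g => [//|[//|s]] f g _ full P am ap.
have al0 : 0 < alpha by rewrite -lte_fin; exact: lt_le_trans (alpha_minus_gt0 f g) am.
have Z b := pressure0_lam (P b).
have [D [D0 -> Dle Dadh]] := @legendre_inf R t alpha
  (fun b => @pressure_line_ge0 _ _ f g t alpha al0 am ap b (Z b).1).
rewrite -EFinN opprK; apply/eqP; rewrite eq_le; apply/andP; split; last first.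
  exact: (lower_bound full al0 D0 Dle (fun b => (Z b).2)).
apply/lee_addgt0Pr => e e0; have [|b hb] := Dadh (D + e); first by rewrite ltrDl.
apply: ereal_inf_lbound; exists (D + e) => //=; split; first by rewrite addr_ge0// ltW.
apply: (upper_bound full al0 _ hb (Z b).1).
by rewrite addr_ge0// ltW.
Qed.
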